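(* There exists a minimizer $\bar q\in\mathcal A$ of the functional $$J(q)=\frac12\int_0^l|u(x,T;q)-g(x)|^2\,dx+\frac N2\int_0^l|\nabla q|^2\,dx,\qquad q\in\mathcal A,$$ i.e. there is $\bar q\in\mathcal A$ with $J(\bar q)=\min_{q\in\mathcal A}J(q)$.
   Context: Let $l,T>0$, $Q=(0,l)\times(0,T]$, and let $\nabla$ denote $\partial/\partial x$. Standing assumptions: $a\in C^1[0,l]$, $a(0)=a(l)=0$, $a(x)>0$ for $x\in(0,l)$; $\phi$ is a given smooth function on $[0,l]$ with $\phi\ge0$, $\phi\not\equiv0$; $g\in L^\infty(0,l)$; $N>0$ is the regularization parameter; $\alpha,\beta$ are given positive constants (with $\alpha\le\beta$). The admissible set is $$\mathcal A=\{q:\ 0<\alpha\le q\le\beta,\ \|q\|_{H^1(0,l)}<\infty\}.$$ $\mathscr H^1(0,l)$ is the closure of $C_0^\infty(0,l)$ under the norm $\|v\|_{\mathscr H^1}^2=\int_0^l a(x)(|v|^2+|\nabla v|^2)\,dx$. For $q\in\mathcal A$, $u(q)=u(\cdot,\cdot;q)$ is the (unique) weak solution of $u_t-(a(x)u_x)_x+q(x)u=0$ in $Q$, $u|_{t=0}=\phi$ (no boundary condition at $x=0,l$), that is: $u\in H^1((0,T);L^2(0,l))\cap L^2((0,T);\mathscr H^1(0,l))$, $u(x,0)=\phi(x)$, and for a.e. $t\in(0,T]$ $$\int_0^l u_t\psi\,dx+\int_0^l a\nabla u\cdot\nabla\psi\,dx+\int_0^l qu\psi\,dx=0\qquad\forall\psi\in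 L^2(0,l)\cap\mathscr H^1(0,l).$$ *)

(* Defs.v *)
From HB Require Import structures.
From mathcomp Require Import all_boot all_order all_algebra.
From mathcomp Require Import all_classical all_reals all_analysis.

Set Implicit Arguments.
Unset Strict Implicit.
Unset Printing Implicit Defensive.
Import Order.TTheory GRing.Theory Num.Theory.
Import numFieldNormedType.Exports.
Local Open Scope classical_set_scope.
Local Open Scope ring_scope.

Notation leb R := (@lebesgue_measure R).
Notation Ioo b := `]0%R, b[%classic.

(** Functions of [x] on [(0, b)] are total functions [R -> R]; only their values
    on [(0, b)] matter.  A function of [t] with values in a space of functions of
    [x] is [u : R -> R -> R], with [u t x] in this order. *)

(** C^n[0, b]: the derivatives up to order [n] in the open interval extend
    continuously to the closed one. *)
Definition C_cc (R : realType) (b : R) (n : nat) (f : R -> R) : Prop :=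
  exists d : nat -> R -> R,
    [/\ {in `[0, b], d 0%N =1 f},
        forall k, (k <= n)%N -> {within `[0, b], continuous (d k)} &
        forall k, (k < n)%N ->
          forall x, x \in `]0, b[ -> is_derive x (1 : R) (d k) (d k.+1 x)].

Definition smooth_cc (R : realType) (b : R) (f : R -> R) : Prop :=
  forall n, C_cc b n f.

(** C_0^oo(0, b), extended by zero to the whole line. *)
Definition test_fun (R : realType) (b : R) (v : R -> R) : Prop :=
  (forall n x, derivable (derive1n n v) x 1) /\
  (exists c d : R, [/\ 0 < c, d < b & forall x, x \notin `[c, d] -> v x = 0]).

Definition L2norm (R : realType) (b : R) (f : R -> R) : \bar R :=
  Lnorm (leb R) 2%:E (EFin \o (f \_ (Ioo b))).

Definition L2 (R : realType) (b : R) : set (R -> R) :=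
  [set f | f \_ (Ioo b) \in Lfun (leb R) 2%:E].

Definition Linfty (R : realType) (b : R) : set (R -> R) :=
  [set f | f \_ (Ioo b) \in Lfun (leb R) +oo%E].

Definition weak_deriv (R : realType) (b : R) (f h : R -> R) : Prop :=
  [/\ locally_integrable (Ioo b) f, locally_integrable (Ioo b) h &
      forall v, test_fun b v ->
        \int[leb R]_(x in Ioo b) (f x * derive1 v x) =
        - \int[leb R]_(x in Ioo b) (h x * v x)].

(** Some weak derivative of [f] on [(0, b)] (they all agree almost everywhere). *)
Definition grad (R : realType) (b : R) (f : R -> R) : R -> R :=
  xget (cst 0) [set h | weak_deriv b f h].

Definition weakly_differentiable (R : realType) (b : R) (f : R -> R) : Prop :=
  exists h, weak_deriv b f h.

Definition H1 (R : realType) (b : R) : set (R -> R) :=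
  [set f | [/\ L2 b f, weakly_differentiable b f & L2 b (grad b f)]].

Definition admissible (R : realType) (l alpha beta : R) : set (R -> R) :=
  [set q | H1 l q /\
    {ae leb R, forall x, x \in `]0, l[ -> alpha <= q x <= beta}].

Definition wH1norm (R : realType) (l : R) (a v : R -> R) : \bar R :=
  ((\int[leb R]_(x in Ioo l)
     (a x * (`|v x| ^+ 2 + `|grad l v x| ^+ 2))%R%:E) `^ 2^-1%R)%E.

(** Closure of the test functions, taken among the weakly differentiable
    functions: since [a] is bounded below by a positive constant on compact
    subintervals of [(0, l)], this is the abstract completion. *)
Definition wH1 (R : realType) (l : R) (a : R -> R) : set (R -> R) :=
  [set v | weakly_differentiable l v /\
    exists2 w : nat -> R -> R, (forall n, test_fun l (w n)) &
      (fun n => wH1norm l a (v \- w n)) @ \oo --> 0%E].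

(** Simple functions of [t] with values in the functions of [x]:
    the sum of the [\1_(stepset i) * stepval i]. *)
Record step (R : realType) := Step {
  stepsize : nat;
  stepset : 'I_stepsize -> set R;
  stepval : 'I_stepsize -> R -> R }.

Definition step_in (R : realType) (X : set (R -> R)) (s : step R) : Prop :=
  (forall i, measurable (@stepset R s i)) /\ (forall i, X (@stepval R s i)).

Definition step_fun (R : realType) (s : step R) (t x : R) : R :=
  \sum_i \1_(@stepset R s i) t * @stepval R s i x.

Definition step_int (R : realType) (T : R) (s : step R) (x : R) : R :=
  \sum_i fine (leb R (Ioo T `&` @stepset R s i)) * @stepval R s i x.

(** Bochner (strong) measurability, integral and L^2 space on [(0, T)], for the
    space [X] of functions of [x] normed by [nX]. *)
Definition strongly_measurable (R : realType) (T : R) (X : set (R -> R))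
    (nX : (R -> R) -> \bar R) (f : R -> R -> R) : Prop :=
  exists2 s : nat -> step R, (forall n, step_in X (s n)) &
    {ae leb R, forall t, t \in `]0, T[ ->
      (fun n => nX (f t \- step_fun (s n) t)) @ \oo --> 0%E}.

Definition bochner_integral (R : realType) (T : R) (X : set (R -> R))
    (nX : (R -> R) -> \bar R) (f : R -> R -> R) (w : R -> R) : Prop :=
  X w /\
  exists s : nat -> step R,
    [/\ forall n, step_in X (s n),
        {ae leb R, forall t, t \in `]0, T[ ->
          (fun n => nX (f t \- step_fun (s n) t)) @ \oo --> 0%E},
        (fun n => \int[leb R]_(t in Ioo T) nX (f t \- step_fun (s n) t)%R)%E
          @ \oo --> 0%E &
        (fun n => nX (w \- step_int T (s n))) @ \oo --> 0%E].

Definition bochner_L2 (R : realType) (T : R) (X : set (R -> R))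
    (nX : (R -> R) -> \bar R) (f : R -> R -> R) : Prop :=
  [/\ {ae leb R, forall t, t \in `]0, T[ -> X (f t)},
      strongly_measurable T X nX f &
      (\int[leb R]_(t in Ioo T) (nX (f t) `^ 2) < +oo)%E].

(** [ut] is the derivative of [u] in the sense of distributions on [(0, T)] with
    values in [L^2(0, l)]. *)
Definition weak_time_deriv (R : realType) (l T : R) (u ut : R -> R -> R) : Prop :=
  forall theta, test_fun T theta ->
    exists2 w : R -> R,
      bochner_integral T (L2 l) (L2norm l)
        (fun t x => derive1 theta t * u t x) w &
      bochner_integral T (L2 l) (L2norm l)
        (fun t x => theta t * ut t x) (\- w).

(** An element of [H^1((0, T); L^2(0, l))] has a representative that is continuous
    from [[0, T]] to [L^2(0, l)]; [u] is required to be that representative, which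
    is what gives [u 0] and [u T] a meaning. *)
Definition weak_solution (R : realType) (l T : R) (a phi q : R -> R)
    (u : R -> R -> R) : Prop :=
  (forall t, t \in `[0, T] -> L2 l (u t) /\
     (fun s => L2norm l (u s \- u t)) @ within [set` `[0, T]] (nbhs t)
       --> 0%E) /\
  {ae leb R, forall x, x \in `]0, l[ -> u 0 x = phi x} /\
  exists ut : R -> R -> R,
    [/\ bochner_L2 T (L2 l) (L2norm l) u,
        bochner_L2 T (L2 l) (L2norm l) ut,
        weak_time_deriv l T u ut,
        bochner_L2 T (wH1 l a) (wH1norm l a) u &
        {ae leb R, forall t, t \in `]0, T[ ->
          forall psi, L2 l psi -> wH1 l a psi ->
            \int[leb R]_(x in Ioo l) (ut t x * psi x) +
            \int[leb R]_(x in Ioo l) (a x * grad l (u t) x * grad l psi x) +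
            \int[leb R]_(x in Ioo l) (q x * u t x * psi x) = 0}].

(** The cost functional, for a given solution map [u : q |-> u(q)]. *)
Definition J (R : realType) (l T N : R) (g : R -> R)
    (u : (R -> R) -> R -> R -> R) (q : R -> R) : \bar R :=
  ((2^-1)%R%:E * \int[leb R]_(x in Ioo l) (`|u q T x - g x| ^+ 2)%R%:E +
   (N / 2)%R%:E * \int[leb R]_(x in Ioo l) (`|grad l q x| ^+ 2)%R%:E)%E.

(* Main.v *)
(* Direct method.  The energy estimate for the difference of two solutions gives
   |u(q1)(T) - u(q2)(T)|_2 <= C |q1 - q2|_oo, so it suffices to extract from a
   minimizing sequence a uniform limit whose gradient has norm at most the limit of
   the norms.  The terms of the sequence have equi-Hoelder (exponent 1/2)
   representatives, the limit is taken along a nonprincipal ultrafilter on nat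
   instead of a subsequence, and the lower semicontinuity of the gradient norm comes
   from testing: the limit Q satisfies |\int Q v'| <= K |v|_2 for all test functions
   v, with K the limit of the gradient norms, hence has a weak derivative of norm at
   most K by Riesz representation. *)
Require Import Defs.
From HB Require Import structures.
From mathcomp Require Import all_boot all_order all_algebra.
From mathcomp Require Import all_classical all_reals all_analysis.
From mathcomp Require Import measurable_realfun ess_sup_inf.
From mathcomp Require Import ring lra.
Import Order.TTheory GRing.Theory Num.Theory.
Import numFieldNormedType.Exports.
Local Open Scope classical_set_scope.
Local Open Scope ring_scope.

Set Implicit Arguments.
Unset Strict Implicit.
Unset Printing Implicit Defensive.

(** The difference w = u(q1) - u(q2) solves the equation with coefficient q1 and source -(q1 - q2)
    u(q2). The weight a degenerates at both ends, so the diffusion term enters only through its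
    sign, and the lower bound alpha of q1 absorbs the source. Hence C involves a norm bound of only
    one of the two solutions. Taking for it the solution of the limit coefficient keeps C fixed
    along the minimizing sequence, without any bound on u(q) uniform in q. The main obstacle is that
    the time derivative is given through distributions and Bochner integrals, while the estimate
    compares the values at t = 0 and t = T. Pairing with a fixed function of x reduces matters to
    scalar functions of t; their increments are recovered at Lebesgue points by testing with
    explicit smooth trapezoids, which is why the file starts from e^(-1/y). *)

(** * Smooth steps and mollifiers *)

(** The classical e^(-1/y) is the case k = 0; the powers y^(-k) are carried along because
    differentiation produces them. *)
Definition flat (R : realType) (k : nat) (y : R) : R :=
  if 0 < y then y ^- k * expR (- y^-1) else 0.

(** The exponential series gives e^z >= z^(k+1) / (k+1)! for z >= 0; at z = 1/y this leaves one
    spare factor y, enough for continuity at 0. *)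
Lemma flat_le (R : realType) (k : nat) (y : R) :
  `|flat k y| <= (k.+1)`!%:R * `|y|.
Proof.
rewrite /flat; case: ifPn => y0; last by rewrite normr0 mulr_ge0.
rewrite ger0_norm ?mulr_ge0 ?expR_ge0 ?invr_ge0 ?exprn_ge0 ?(ltW y0)//.
rewrite gtr0_norm// expRN.
have yk : (y^-1) ^+ k.+1 / (k.+1)`!%:R <= expR y^-1.
  have := @expR_ge1Dxn R y^-1 k; rewrite invr_ge0 (ltW y0) => /(_ isT).
  by apply: le_trans; rewrite lerDr.
rewrite -exprVn ler_pdivrMr ?expR_gt0//.
have -> : y^-1 ^+ k = k.+1`!%:R * y * (y^-1 ^+ k.+1 / k.+1`!%:R).
  have f0 : (k.+1`!%:R : R) != 0 by rewrite pnatr_eq0 -lt0n fact_gt0.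
  by rewrite exprS; field; rewrite f0 gt_eqF.
by rewrite ler_pM2l// mulr_gt0// ltr0n fact_gt0.
Qed.

Lemma flat_continuous0 (R : realType) (k : nat) : {for 0, continuous (@flat R k)}.
Proof.
apply/cvgrPdist_le => e e0; apply/nbhs_ballP.
have f0 : 0 < (k.+1`!%:R : R) by rewrite ltr0n fact_gt0.
exists (k.+1`!%:R^-1 * e) => [|z]; first by rewrite /= mulr_gt0// invr_gt0.
rewrite /ball/= sub0r normrN => /ltW ze; rewrite {1}/flat ltxx sub0r normrN.
by rewrite (le_trans (flat_le _ _))// -ler_pdivlMl.
Qed.

Lemma is_derive_flat (R : realType) (k : nat) (y : R) :
  is_derive y (1 : R) (flat k) (flat k.+2 y - k%:R * flat k.+1 y).
Proof.
have [y0|y0|->] := ltrgtP y 0.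
- rewrite /flat ltNge (ltW y0)/= mulr0 subr0.
  apply: (near_eq_is_derive (f := cst 0)) => //.
  near=> z; rewrite ltNge ifN// negbK ltW//.
  by near: z; exact: lt_nbhsl.
- apply: (near_eq_is_derive (f := fun z : R => z ^- k * expR (- z^-1))).
    near=> z; rewrite /flat ifT//; near: z.
    by apply: lt_nbhsr.
  have yn0 : y != 0 by rewrite gt_eqF.
  have d1 : is_derive y (1:R) (fun z : R => (z ^+ k)^-1) (- (y ^+ k) ^- 2 *: (k%:R * y ^+ k.-1)).
    apply: is_deriveV; first by rewrite expf_neq0.
    have d0 : is_derive y (1 : R) (@GRing.exp R ^~ k) (k%:R * y ^+ k.-1 *: 1).
      have -> : @GRing.exp R ^~ k = (id : R -> R) ^+ k by apply/funext => z; rewrite exprfctE.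
      exact: (is_deriveX k (is_derive_id y (1 : R))).
    by apply: is_derive_eq d0 _; rewrite /GRing.scale/= mulr1.
  have d2 : is_derive y (1:R) (fun z : R => expR (- z^-1)) (expR (- y^-1) * (- (- y ^- 2 *: 1))).
    apply: (is_derive1_comp (f := expR) (g := fun z => - z^-1)).
    by apply: is_deriveN; apply: is_deriveV.
  apply: (is_derive_eq (is_deriveM d1 d2)).
  rewrite /flat y0/=; rewrite ![_ *: _]/GRing.scale/=.
  case: k d1 => [|k] _ /=; rewrite ?exprS; field; rewrite ?yn0 ?expf_neq0//.
- rewrite /flat ltxx mulr0 subr0.
  (* Since [flat k z = flat k.+1 z * z], the slope at 0 is [flat k.+1], which is continuous there
     with value 0. *)
  apply/is_derive1_caratheodory; exists (flat k.+1); split.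
  + move=> z; rewrite ltxx /flat; case: ifPn => z0; last by rewrite mul0r subrr.
    by rewrite !subr0 exprS; field; rewrite ?expf_neq0// gt_eqF.
  + exact: flat_continuous0.
  + by rewrite /flat ltxx.
Unshelve. all: by end_near. Qed.

(** Denominator of the smooth transition from 0 to 1; its two terms never vanish together, as y > 0
    or 1 - y > 0. *)
Definition bump_den (R : realType) (y : R) : R := flat 0 y + flat 0 (1 - y).

Lemma flat_ge0 (R : realType) (k : nat) (y : R) : 0 <= flat k y.
Proof.
rewrite /flat; case: ifPn => // y0.
by rewrite mulr_ge0 ?expR_ge0 ?invr_ge0 ?exprn_ge0 ?(ltW y0).
Qed.

Lemma flat_gt0 (R : realType) (k : nat) (y : R) : 0 < y -> 0 < flat k y.
Proof. by move=> y0; rewrite /flat y0 mulr_gt0 ?expR_gt0 ?invr_gt0 ?exprn_gt0. Qed.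

Lemma bump_den_gt0 (R : realType) (y : R) : 0 < bump_den y.
Proof.
rewrite /bump_den; have [y0|y0] := ltP 0 y.
  by rewrite ltr_pwDl ?flat_ge0 ?flat_gt0.
by rewrite ltr_wpDl ?flat_ge0 ?flat_gt0// subr_gt0 (le_lt_trans y0).
Qed.

(* The class is closed under differentiation, which gives smoothness of all
   orders at once. *)
Inductive elementary (R : realType) : (R -> R) -> Prop :=
| elem_cst c : elementary (cst c)
| elem_add f g : elementary f -> elementary g -> elementary (f + g)
| elem_mul f g : elementary f -> elementary g -> elementary (f * g)
| elem_flat k c d : elementary (fun x => flat k (c * x + d))
| elem_inv c d : elementary (fun x => (bump_den (c * x + d))^-1).

Lemma is_derive_affine (R : realType) (f : R -> R) (c d x df : R) :
  is_derive (c * x + d) (1 : R) f df ->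
  is_derive x (1 : R) (fun x => f (c * x + d)) (df * c).
Proof.
move=> Df; apply: (is_derive1_comp (f := f) (g := fun x => c * x + d)) => //.
have d1 : is_derive x (1 : R) (fun x : R => c * x) (c *: 1).
  exact: is_deriveZ.
have d2 := is_deriveD d1 (is_derive_cst d x (1 : R)).
by apply: is_derive_eq d2 _; rewrite addr0 /GRing.scale/= mulr1.
Qed.

Lemma elementary_derive (R : realType) (f : R -> R) : elementary f ->
  exists2 g, elementary g & forall x, is_derive x (1 : R) f (g x).
Proof.
elim=> {f} [c|f g fE [f' f'E Df] gE [g' g'E Dg]|f g fE [f' f'E Df] gE [g' g'E Dg]|k c d|c d].
- by exists (cst 0); [exact: elem_cst|move=> x; exact: is_derive_cst].
- by exists (f' + g'); [exact: elem_add|move=> x; exact: is_deriveD].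
- exists (f * g' + g * f'); last by move=> x; exact: is_deriveM.
  by apply: elem_add; apply: elem_mul.
- exists (((fun x => flat k.+2 (c * x + d)) +
           (cst (- k%:R)) * (fun x => flat k.+1 (c * x + d))) * cst c).
    by repeat constructor.
  move=> x; apply: is_derive_eq; first by apply: is_derive_affine; exact: is_derive_flat.
  by rewrite !fctE/= mulNr.
- pose e k : R -> R := fun x => flat k (c * x + d).
  pose e' k : R -> R := fun x => flat k ((- c) * x + (1 - d)).
  pose i : R -> R := fun x => (bump_den (c * x + d))^-1.
  exists (cst (-1) * (i * i) * ((e 2 + cst (-1) * e' 2) * cst c)).
    by repeat constructor.
  move=> x; apply: is_derive_eq.
    apply: (is_deriveV (f := fun x => bump_den (c * x + d))).
      by rewrite gt_eqF// bump_den_gt0.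
    apply: (is_derive_affine (f := @bump_den R)).
    apply: is_deriveD; first exact: is_derive_flat.
    have -> : (fun y : R => flat 0 (1 - y)) = (fun y => flat 0 ((-1) * y + 1)).
      by apply/funext => y; congr flat; ring.
    by apply: is_derive_affine; exact: is_derive_flat.
  rewrite /e /e' /i !fctE/= !mul0r !subr0 /GRing.scale/=.
  have -> : -1 * (c * x + d) + 1 = - c * x + (1 - d) by ring.
  by field; rewrite gt_eqF ?bump_den_gt0.
Qed.

Lemma elementary_smooth (R : realType) (f : R -> R) : elementary f ->
  forall n x, derivable (derive1n n f) x 1.
Proof.
move=> + n; elim: n f => [|n IH] f fE x.
  by have [g _ /(_ x) []] := elementary_derive fE.
have [g gE Dg] := elementary_derive fE.
have fg : derive1 f = g by apply/funext => z; rewrite derive1E; case: (Dg z).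
by rewrite derive1Sn fg; exact: IH.
Qed.

Definition smoothstep (R : realType) (y : R) : R := flat 0 y / bump_den y.

Lemma smoothstep_elementary (R : realType) (c d : R) :
  elementary (fun x => smoothstep (c * x + d)).
Proof. exact: (elem_mul (elem_flat 0 c d) (elem_inv c d)). Qed.

Lemma smoothstep0 (R : realType) (y : R) : y <= 0 -> smoothstep y = 0.
Proof. by move=> y0; rewrite /smoothstep {1}/flat ltNge y0/= mul0r. Qed.

Lemma smoothstep1 (R : realType) (y : R) : 1 <= y -> smoothstep y = 1.
Proof.
move=> y1; have := bump_den_gt0 y.
have f0 : flat 0 (1 - y) = 0 by rewrite /flat subr_gt0 ltNge y1.
rewrite /smoothstep /bump_den f0 addr0 => d0.
by rewrite divff// gt_eqF.
Qed.

Lemma smoothstep_itv (R : realType) (y : R) : 0 <= smoothstep y <= 1.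
Proof.
rewrite /smoothstep divr_ge0 ?flat_ge0 ?(ltW (bump_den_gt0 _))//=.
by rewrite ler_pdivrMr ?bump_den_gt0// mul1r lerDl flat_ge0.
Qed.

(** As the derivative of a step, the mollifier has a primitive in closed form: its mass is 1 by the
    fundamental theorem, and differences of steps are test functions whose derivatives are
    differences of mollifiers. *)
Definition mollifier (R : realType) : R -> R := derive1 (@smoothstep R).

Lemma smoothstep_elem (R : realType) : elementary (@smoothstep R).
Proof.
have -> : @smoothstep R = fun x => smoothstep (1 * x + 0).
  by apply/funext => x; rewrite mul1r addr0.
exact: smoothstep_elementary.
Qed.

Lemma is_derive_smoothstep (R : realType) (y : R) :
  is_derive y (1 : R) (@smoothstep R) (mollifier y).
Proof.
have [g _ Dg] := elementary_derive (smoothstep_elem R).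
suff -> : mollifier y = g y by [].
by rewrite /mollifier derive1E; case: (Dg y).
Qed.

Lemma mollifier_smooth (R : realType) n (y : R) :
  derivable (derive1n n (@mollifier R)) y 1.
Proof. rewrite /mollifier -derive1Sn; exact: (elementary_smooth (smoothstep_elem R)). Qed.

Lemma mollifier_continuous (R : realType) : continuous (@mollifier R).
Proof.
move=> y; apply: differentiable_continuous; apply/derivable1_diffP.
exact: (@mollifier_smooth R 0 y).
Qed.

Lemma mollifier_out (R : realType) (y : R) : y \notin `[0, 1] -> mollifier y = 0.
Proof.
rewrite in_itv/= negb_and -!ltNge /mollifier derive1E => /orP[y0|y1].
  have /@near_eq_derive -> // : \near y, @smoothstep R y = cst 0 y.
    by near=> z; apply: smoothstep0; rewrite ltW//; near: z; exact: lt_nbhsl.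
  by rewrite derive_val.
have /@near_eq_derive -> // : \near y, @smoothstep R y = cst 1 y.
  by near=> z; apply: smoothstep1; rewrite ltW//; near: z; exact: lt_nbhsr.
by rewrite derive_val.
Unshelve. all: by end_near. Qed.

Lemma mollifier_bounded (R : realType) : exists2 C : R, 0 < C & forall y, `|mollifier y| <= C.
Proof.
have cm : {within `[0, 1 : R], continuous (fun x => `|mollifier x|)}.
  apply: continuous_subspaceT => x; apply: continuous_comp; first exact: mollifier_continuous.
  exact: norm_continuous.
have [c _ cmax] := EVT_max (@ler01 R) cm.
exists (`|mollifier c| + 1) => [|y]; first by rewrite ltr_wpDl.
have [yi|yi] := boolP (y \in `[0, 1 : R]); last by rewrite mollifier_out// normr0 addr_ge0.
by rewrite (le_trans (cmax _ yi))// lerDl.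
Qed.

(** * Integrability of real-valued functions *)

Section real_integrable.
Context {R : realType}.
Notation mu := (@lebesgue_measure R).
Implicit Types (f g h : R -> R) (D : set R).

Definition rint D f := mu.-integrable D (EFin \o f).

Lemma rint_meas D f : rint D f -> measurable_fun D f.
Proof. by move=> /measurable_int/measurable_EFinP. Qed.

Lemma rintS (E D : set R) f : measurable E -> measurable D -> D `<=` E ->
  rint E f -> rint D f.
Proof. by move=> mE mD DE; exact: integrableS. Qed.

Lemma rintD D f g : measurable D -> rint D f -> rint D g ->
  rint D (fun x => f x + g x).
Proof.
move=> mD fi gi; exact: (@integrableD _ _ R mu D mD (EFin \o f) (EFin \o g) fi gi).
Qed.

Lemma rintB D f g : measurable D -> rint D f -> rint D g ->
  rint D (fun x => f x - g x).
Proof.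
move=> mD fi gi; exact: (@integrableB _ _ R mu D mD (EFin \o f) (EFin \o g) fi gi).
Qed.

Lemma rintZl D c f : measurable D -> rint D f -> rint D (fun x => c * f x).
Proof.
move=> mD fi; exact: (@integrableZl _ _ R mu D mD c (EFin \o f) fi).
Qed.

Lemma rintZr D c f : measurable D -> rint D f -> rint D (fun x => f x * c).
Proof.
move=> mD /(rintZl c mD); rewrite /rint.
by under eq_fun do rewrite mulrC.
Qed.

Lemma rint_normr D f : rint D f -> rint D (fun x => `|f x|).
Proof. exact: integrable_norm. Qed.

Lemma rint_le D f g : measurable D -> measurable_fun D f ->
  (forall x, D x -> `|f x| <= g x) -> rint D g -> rint D f.
Proof.
move=> mD mf fg gi; apply: le_integrable gi => //; first exact/measurable_EFinP.
by move=> x Dx; rewrite lee_fin (le_trans (fg _ Dx))// ler_norm.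
Qed.

Lemma rint_bounded D f C : measurable D -> (mu D < +oo)%E -> measurable_fun D f ->
  (forall x, D x -> `|f x| <= C) -> rint D f.
Proof.
move=> mD Dfin mf fC; apply: measurable_bounded_integrable => //.
exists C; split; first by rewrite num_real.
by move=> y Cy x Dx /=; rewrite (le_trans (fC _ Dx))// ltW.
Qed.

Lemma rint_mulr D f h C : measurable D -> rint D f -> measurable_fun D h ->
  (forall x, D x -> `|h x| <= C) -> rint D (fun x => f x * h x).
Proof.
move=> mD fi mh hC; apply: (@rint_le _ _ (fun x => `|f x| * C)) => //.
- by apply: measurable_funM => //; exact: rint_meas.
- by move=> x Dx; rewrite normrM ler_wpM2l// hC.
- by apply: rintZr => //; exact: rint_normr.
Qed.

Lemma rint_ereal D f : measurable D -> rint D f ->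
  (\int[mu]_(x in D) (f x)%:E = (\int[mu]_(x in D) f x)%:E)%E.
Proof. by move=> mD fi; rewrite fineK//; exact: integrable_fin_num. Qed.

Lemma mu_itv_lty (c d : R) b1 b2 :
  (mu [set` Interval (BSide b1 c) (BSide b2 d)] < +oo)%E.
Proof.
by rewrite lebesgue_measure_itv/=; case: ifPn => _; rewrite ?ltry// -EFinB ltry.
Qed.

Lemma Rintegral_subset_le D E f : measurable D -> measurable E -> E `<=` D ->
  rint D f -> (forall x, D x -> 0 <= f x) ->
  \int[mu]_(x in E) f x <= \int[mu]_(x in D) f x.
Proof.
move=> mD mE ED fi f0; rewrite /Rintegral; apply: fine_le.
- by apply: integrable_fin_num => //; exact: rintS fi.
- exact: integrable_fin_num.
- apply: ge0_subset_integral => //; first exact: measurable_int fi.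
Qed.

Lemma aeS (P Q : R -> Prop) : (forall x, P x -> Q x) ->
  {ae mu, forall x, P x} -> {ae mu, forall x, Q x}.
Proof. by apply: filterS; exact: (ae_filter_ringOfSetsType mu). Qed.

Lemma aeS2 (P Q S : R -> Prop) : (forall x, P x -> Q x -> S x) ->
  {ae mu, forall x, P x} -> {ae mu, forall x, Q x} -> {ae mu, forall x, S x}.
Proof. by apply: filterS2; exact: (ae_filter_ringOfSetsType mu). Qed.

End real_integrable.

(** * Mollification at Lebesgue points *)

Section mollification.
Context {R : realType}.
Notation mu := (@lebesgue_measure R).
Implicit Types (f h : R -> R) (D : set R).

Lemma Rintegral_sub0 D (A : set R) f : A `<=` D ->
  (forall x, D x -> ~ A x -> f x = 0) ->
  \int[mu]_(x in D) f x = \int[mu]_(x in A) f x.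
Proof.
move=> AD f0; rewrite Rintegral_mkcond [RHS]Rintegral_mkcond.
congr Rintegral; apply/funext => x; rewrite !patchE.
have [Dx|Dx] := pselect (D x); have [Ax|Ax] := pselect (A x).
- by rewrite !mem_set.
- by rewrite mem_set// memNset// f0.
- by exfalso; exact/Dx/AD.
- by rewrite !memNset.
Qed.

(** [moll s r] is the derivative of [ramp s r], concentrated on [[s, s + r]], and [trap s t r] is a
    smooth version of the indicator of []s, t]]. *)
Definition ramp (s r x : R) : R := smoothstep (r^-1 * (x - s)).
Definition moll (s r x : R) : R := r^-1 * mollifier (r^-1 * (x - s)).
Definition trap (s t r x : R) : R := ramp s r x - ramp t r x.

Lemma ramp_elementary s r : elementary (ramp s r).
Proof.
have -> : ramp s r = fun x => smoothstep (r^-1 * x + (- (r^-1 * s))).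
  by apply/funext => x; rewrite /ramp mulrBr.
exact: smoothstep_elementary.
Qed.

Lemma is_derive_ramp s r x : is_derive x (1 : R) (ramp s r) (moll s r x).
Proof.
have -> : ramp s r = fun x => smoothstep (r^-1 * x + (- (r^-1 * s))).
  by apply/funext => y; rewrite /ramp mulrBr.
have -> : moll s r x = mollifier (r^-1 * x + (- (r^-1 * s))) * r^-1.
  by rewrite /moll mulrC mulrBr.
apply: is_derive_affine; exact: is_derive_smoothstep.
Qed.

Lemma derive1_ramp s r : derive1 (ramp s r) = moll s r.
Proof. by apply/funext => x; rewrite derive1E; case: (is_derive_ramp s r x). Qed.

Lemma trap_elementary s t r : elementary (trap s t r).
Proof.
have -> : trap s t r = ramp s r + cst (-1) * ramp t r.
  by apply/funext => x; rewrite /trap !fctE/= mulN1r.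
by apply: elem_add; [|apply: elem_mul; [exact: elem_cst|]]; exact: ramp_elementary.
Qed.

Lemma derive1_trap s t r x : derive1 (trap s t r) x = moll s r x - moll t r x.
Proof.
rewrite derive1E.
by have := is_deriveB (is_derive_ramp s r x) (is_derive_ramp t r x); case.
Qed.

Lemma ramp0 s r x : 0 < r -> x <= s -> ramp s r x = 0.
Proof.
by move=> r0 xs; apply: smoothstep0; rewrite pmulr_rle0 ?invr_gt0// subr_le0.
Qed.

Lemma ramp1 s r x : 0 < r -> s + r <= x -> ramp s r x = 1.
Proof.
move=> r0 xs; apply: smoothstep1.
by rewrite -ler_pdivrMl ?invr_gt0// invrK mulr1 lerBrDl.
Qed.

Lemma moll_out s r x : 0 < r -> x \notin `[s, s + r] -> moll s r x = 0.
Proof.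
move=> r0 xs; rewrite /moll mollifier_out ?mulr0//; apply: contra xs.
rewrite !in_itv/= pmulr_rge0 ?invr_gt0// subr_ge0 => /andP[-> /=].
by rewrite -ler_pdivlMl ?invr_gt0// invrK mulr1 lerBlDl.
Qed.

Lemma moll_continuous s r : continuous (moll s r).
Proof.
move=> x; apply: differentiable_continuous; apply/derivable1_diffP.
rewrite -derive1_ramp.
exact: (@elementary_smooth R _ (ramp_elementary s r) 1 x).
Qed.

Lemma test_fun_trap b s t r : 0 < s -> s <= t -> 0 < r -> t + r < b ->
  test_fun b (trap s t r).
Proof.
move=> s0 st r0 tb; split; first exact: elementary_smooth (trap_elementary _ _ _).
exists s, (t + r); split => // x; rewrite in_itv/= negb_and -!ltNge.
move=> /orP[/ltW xs|/ltW xt]; rewrite /trap.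
  by rewrite !ramp0// ?subrr// (le_trans xs).
by rewrite !ramp1// ?subrr// (le_trans _ xt)// lerD2r.
Qed.

Lemma test_fun_moll b s r : 0 < s -> 0 < r -> s + r < b -> test_fun b (moll s r).
Proof.
move=> s0 r0 sb; split.
  move=> n x; rewrite -derive1_ramp -derive1Sn.
  exact: (@elementary_smooth R _ (ramp_elementary s r) n.+1 x).
by exists s, (s + r); split => // x; exact: moll_out.
Qed.

Lemma trap_bound s t r x : 0 < r -> `|trap s t r x| <= 1.
Proof.
move=> r0; rewrite /trap /ramp.
have /andP[a0 a1] := smoothstep_itv (r^-1 * (x - s)).
have /andP[b0 b1] := smoothstep_itv (r^-1 * (x - t)).
by rewrite ler_norml; apply/andP; split; lra.
Qed.

(** [ramp s r] is a primitive that rises from 0 to 1. The interval is half open so as to lie in the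
    open ball [ball s r] used by [mollify]. *)
Lemma integral_moll s r : 0 < r -> \int[mu]_(x in `[s, s + r[) moll s r x = 1.
Proof.
move=> r0.
have sr : s < s + r by rewrite ltrDl.
have cm : {within `[s, s + r], continuous (moll s r)}.
  by apply: continuous_subspaceT; exact: moll_continuous.
rewrite Rintegral_itv_bndo_bndc; last first.
  apply: (@integrableS _ _ _ mu `[s, s + r]%classic) => //.
    by apply: subset_itvl; rewrite bnd_simp.
  apply: continuous_compact_integrable => //; exact: segment_compact.
rewrite /Rintegral (continuous_FTC2 (F := ramp s r))//.
- by rewrite /= ramp1// ramp0// subr0.
- split.
  + by move=> x _; case: (is_derive_ramp s r x).
  + apply: cvg_at_right_filter; apply: differentiable_continuous.
    by apply/derivable1_diffP; case: (is_derive_ramp s r s).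
  + apply: cvg_at_left_filter; apply: differentiable_continuous.
    by apply/derivable1_diffP; case: (is_derive_ramp s r (s + r)).
- by move=> x _; rewrite derive1_ramp.
Qed.

Lemma locally_integrable_itv b f c d : locally_integrable (Ioo b) f ->
  0 < c -> d < b -> rint `[c, d] f.
Proof.
move=> [mf _ fint] c0 db.
have cdb : `[c, d]%classic `<=` `]0, b[%classic.
  by apply: subset_itvSoo; rewrite bnd_simp.
apply/integrableP; split.
  by apply/measurable_EFinP; apply: measurable_funS mf.
by apply: fint => //; exact: segment_compact.
Qed.

(** The kernel has mass 1, so the error is the integral of f - f s against it; the kernel is at most
    C / r, which makes the error at most 2 C times the average of |f - f s| over [ball s r], of
    length 2 r. *)
Lemma mollify b f s : 0 < s < b -> locally_integrable (Ioo b) f ->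
  lebesgue_pt f s ->
  \int[mu]_(x in Ioo b) (f x * moll s r x) @[r --> 0^'+] --> f s.
Proof.
move=> /andP[s0 sb] fint fs; have [C C0 hC] := mollifier_bounded R.
apply/cvgrPdist_le => /= e e0.
have /fine_cvgP[_ /cvgrPdist_le fs'] := fs.
have e1 : 0 < e / (2 * C) by rewrite divr_gt0// mulr_gt0.
near=> r.
have r0 : 0 < r by near: r; exact: nbhs_right_gt.
have sr0 : 0 < s - r by rewrite subr_gt0; near: r; exact: nbhs_right_lt.
have srb : s + r < b by rewrite -ltrBrDl; near: r; apply: nbhs_right_lt; rewrite subr_gt0.
have mB : measurable (ball s r) := measurable_ball s r.
have bi : ball s r `<=` `[s - r, s + r]%classic.
  by rewrite ball_itv; exact: subset_itv_oo_cc.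
have sb1 : `[s, s + r[%classic `<=` ball s r.
  by rewrite ball_itv; apply: subset_itvr; rewrite bnd_simp ltrBlDr ltrDl.
have fsiB : rint (ball s r) (fun x => f x - f s).
  apply: (@rintS _ `[s - r, s + r]%classic) => //.
  apply: rintB => //; first exact: locally_integrable_itv fint _ _.
  by apply: (@rint_bounded _ _ _ `|f s|) => //; exact: mu_itv_lty.
have fsi : rint `[s, s + r[ (fun x => f x - f s) by exact: rintS fsiB.
have mm D : measurable_fun D (moll s r).
  apply: measurable_funTS; exact: continuous_measurable_fun (@moll_continuous s r).
have mbd x : `|moll s r x| <= r^-1 * C.
  by rewrite /moll normrM gtr0_norm ?invr_gt0// ler_pM2l ?invr_gt0.
have fmi : rint `[s, s + r[ (fun x => (f x - f s) * moll s r x).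
  by apply: (rint_mulr (C := r^-1 * C)).
have mi : rint `[s, s + r[ (moll s r).
  by apply: (rint_bounded (C := r^-1 * C)) => //; exact: mu_itv_lty.
have -> : \int[mu]_(x in Ioo b) (f x * moll s r x) =
          \int[mu]_(x in `[s, s + r[) (f x * moll s r x).
  rewrite (@Rintegral_sub0 _ `[s, s + r]%classic).
  - rewrite Rintegral_itv_bndo_bndc//.
    apply: (rint_mulr (C := r^-1 * C)) => //.
    apply: (@rintS _ `[s - r, s + r]%classic) => //.
      exact: subset_trans bi.
    exact: locally_integrable_itv fint _ _.
  - by apply: subset_itvSoo; rewrite bnd_simp// (lt_trans sr0)// ltrBlDr ltrDl.
  - by move=> x _ /negP xs; rewrite moll_out// mulr0.
have -> : \int[mu]_(x in `[s, s + r[) (f x * moll s r x) =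
    \int[mu]_(x in `[s, s + r[) ((f x - f s) * moll s r x) + f s.
  rewrite -[X in _ = _ + X]mulr1 -(integral_moll s r0) -RintegralZl//.
  rewrite -RintegralD//; last exact: rintZl.
  by apply: eq_Rintegral => x _; rewrite -mulrDl subrK.
rewrite opprD addrCA subrr addr0 normrN.
apply: le_trans (le_normr_Rintegral _ _) _ => //.
apply: (@le_trans _ _ (\int[mu]_(x in `[s, s + r[) (`|f x - f s| * (r^-1 * C)))).
  apply: le_Rintegral => //.
  - exact: rint_normr.
  - by apply: rintZr => //; exact: rint_normr.
  - by move=> x _; rewrite normrM ler_wpM2l.
rewrite RintegralZr//; last exact: rint_normr.
apply: (@le_trans _ _ ((\int[mu]_(x in ball s r) `|f x - f s|) * (r^-1 * C))).
  apply: ler_wpM2r; first by rewrite mulr_ge0 ?invr_ge0// ltW.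
  by apply: Rintegral_subset_le => //; exact: rint_normr.
have : `|0 - fine (davg f s r)| <= e / (2 * C) by near: r; exact: fs'.
rewrite sub0r normrN /davg /iavg (lebesgue_measure_ball _ (ltW r0)).
rewrite inver mulrn_eq0/= gt_eqF//= fineM//=; last first.
  by apply: integrable_fin_num => //; exact: rint_normr fsiB.
move=> /(le_trans (ler_norm _)).
rewrite -[X in _ * X <= _]/(\int[mu]_(x in ball s r) `|f x - f s|).
set I := \int[mu]_(_ in _) _ => hI.
have -> : I * (r^-1 * C) = ((r *+ 2)^-1 * I) * (2 * C).
  by rewrite -mulr_natl; field; rewrite gt_eqF.
by rewrite -ler_pdivlMr// mulr_gt0.
Unshelve. all: by end_near. Qed.

End mollification.

(** * Weak derivatives: increments and uniqueness *)

Section weak_derivatives.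
Context {R : realType}.
Notation mu := (@lebesgue_measure R).
Implicit Types (f g h : R -> R) (D : set R).

Lemma rint_sub0 D (A : set R) f : measurable D -> measurable A -> A `<=` D ->
  (forall x, D x -> ~ A x -> f x = 0) -> rint A f -> rint D f.
Proof.
move=> mD mA AD f0 fi; apply/integrable_mkcond => //.
have -> : (EFin \o f) \_ D = (EFin \o f) \_ A.
  apply/funext => x; rewrite !patchE.
  have [Dx|Dx] := pselect (D x); have [Ax|Ax] := pselect (A x).
  - by rewrite !mem_set.
  - by rewrite mem_set// memNset//= f0.
  - by exfalso; exact/Dx/AD.
  - by rewrite !memNset.
exact: (@integrable_mkcond _ _ _ mu A (EFin \o f) mA).1 fi.
Qed.

Lemma dominated_cvg_real D (F : nat -> R -> R) f g : measurable D ->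
  (forall n, measurable_fun D (F n)) -> measurable_fun D f ->
  {ae mu, forall x, D x -> F n x @[n --> \oo] --> f x} ->
  rint D g -> {ae mu, forall x n, D x -> `|F n x| <= g x} ->
  rint D f /\ \int[mu]_(x in D) F n x @[n --> \oo] --> \int[mu]_(x in D) f x.
Proof.
move=> mD mF mf Ff gi Fg.
have [||||fi _ cv] // := @dominated_convergence _ _ _ mu D mD (fun n => EFin \o F n)
    (EFin \o f) (EFin \o g) _ _ _ gi.
- by move=> n; apply/measurable_EFinP; exact: mF.
- by apply/measurable_EFinP.
- by apply: aeS Ff => x Fx Dx; apply: cvg_EFin; [exact: nearW|exact: Fx].
split=> //; apply: (@cvg_trans _ ((fine (\int[mu]_(x in D) (F n x)%:E)) @[n --> \oo])) => //.
apply: fine_cvg; rewrite -/(Rintegral mu D f) -rint_ereal// in cv *.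
Qed.

(** At x = s the ramp is 0 for every r, so the limit is the indicator of an open half line; hence
    the half-open []s, t]] in the increment formulas. *)
Lemma cvg_ramp s x (r : nat -> R) : (forall n, 0 < r n) ->
  r n @[n --> \oo] --> 0 -> ramp s (r n) x @[n --> \oo] --> (\1_(`]s, +oo[%classic) x : R).
Proof.
move=> r0 rc; rewrite indicE mem_setE in_itv/= andbT.
have [xs|sx] := leP x s.
  by under eq_fun do rewrite ramp0//; exact: cvg_cst.
apply: cvg_near_cst; have /cvgrPdist_lt/(_ (x - s)) := rc; rewrite subr_gt0 => /(_ sx).
apply: filterS => n; rewrite sub0r normrN gtr0_norm// => rn.
by rewrite ramp1//; lra.
Qed.

Lemma cvg_trap s t x (r : nat -> R) : s <= t -> (forall n, 0 < r n) ->
  r n @[n --> \oo] --> 0 -> trap s t (r n) x @[n --> \oo] --> (\1_(`]s, t]%classic) x : R).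
Proof.
move=> st r0 rc.
have -> : \1_(`]s, t]%classic) x = \1_(`]s, +oo[%classic) x - \1_(`]t, +oo[%classic) x :> R.
  rewrite !indicE !mem_setE !in_itv/= !andbT.
  have [sx|xs] := ltP s x; have [tx|xt] := ltP t x => //=; rewrite ?subr0 ?subrr//.
  by have := lt_le_trans tx (le_trans xs st); rewrite ltxx.
by apply: cvgB; exact: cvg_ramp.
Qed.

Lemma trap_out (s t r x : R) : 0 < r -> s <= t -> x \notin `[s, t + r] -> trap s t r x = 0.
Proof.
move=> r0 st; rewrite in_itv/= negb_and -!ltNge /trap => /orP[/ltW xs|/ltW xt].
  by rewrite !ramp0// ?subrr// (le_trans xs).
by rewrite !ramp1// ?subrr// (le_trans _ xt)// lerD2r.
Qed.

Lemma trap_measurable s t r D : measurable_fun D (trap s t r).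
Proof.
apply: measurable_funTS; apply: continuous_measurable_fun => x.
apply: differentiable_continuous; apply/derivable1_diffP.
exact: (@elementary_smooth R _ (trap_elementary s t r) 0 x).
Qed.

(** The margin e keeps all the supports in the compact [[s, t + e]] inside (0, b), where |h| is
    integrable and dominates. *)
Lemma cvg_integral_trap b h s t (r : nat -> R) : locally_integrable (Ioo b) h ->
  0 < s -> s <= t -> (forall n, 0 < r n) -> (exists2 e, t + e < b & forall n, r n <= e) ->
  r n @[n --> \oo] --> 0 ->
  \int[mu]_(x in Ioo b) (h x * trap s t (r n) x) @[n --> \oo] -->
  \int[mu]_(x in `]s, t]) h x.
Proof.
move=> hi s0 st r0 [e te re] rc.
have e0 : 0 < e by rewrite (lt_le_trans (r0 0%N)).
have subD : `[s, t + e]%classic `<=` Ioo b by apply: subset_itvSoo; rewrite bnd_simp.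
have st1 : `]s, t]%classic `<=` `[s, t + e]%classic.
  by apply: subset_itv; rewrite bnd_simp// lerDl ltW.
have hi' : rint `[s, t + e] h by exact: locally_integrable_itv hi _ _.
have -> : \int[mu]_(x in `]s, t]) h x = \int[mu]_(x in `[s, t + e]) (h x * \1_(`]s, t]%classic) x).
  rewrite (@Rintegral_sub0 _ `[s, t + e]%classic `]s, t]%classic)//.
    by apply: eq_Rintegral => x; rewrite inE => xs; rewrite indicE mem_set// mulr1.
  by move=> x _ xs; rewrite indicE memNset// mulr0.
have -> : (fun n => \int[mu]_(x in Ioo b) (h x * trap s t (r n) x)) =
    (fun n => \int[mu]_(x in `[s, t + e]) (h x * trap s t (r n) x)).
  apply/funext => n; apply: Rintegral_sub0 => // x _ /negP xs.
  rewrite trap_out ?mulr0//; apply: contra xs; rewrite !in_itv/= => /andP[-> /=].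
  by move=> /le_trans; apply; rewrite lerD2l.
refine (proj2 (dominated_cvg_real (g := fun x => `|h x|) _ _ _ _ _ _)) => //.
- move=> n; apply: measurable_funM; [exact: rint_meas|exact: trap_measurable].
- apply: measurable_funM; first exact: rint_meas.
  exact: measurable_funTS.
- by apply: aeW => x _; apply: cvgM; [exact: cvg_cst|exact: cvg_trap].
- exact: rint_normr.
- by apply: aeW => x n _; rewrite normrM ler_piMr// trap_bound.
Qed.

Lemma rint_moll b f s r : locally_integrable (Ioo b) f -> 0 < s -> 0 < r -> s + r < b ->
  rint (Ioo b) (fun x => f x * moll s r x).
Proof.
move=> fi s0 r0 srb; have [C C0 hC] := mollifier_bounded R.
apply: (@rint_sub0 _ `[s, s + r]%classic) => //.
- by apply: subset_itvSoo; rewrite bnd_simp.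
- by move=> x _ /negP xs; rewrite moll_out// mulr0.
- apply: (rint_mulr (C := r^-1 * C)) => //; first exact: locally_integrable_itv fi _ _.
    apply: measurable_funTS; exact: continuous_measurable_fun (@moll_continuous _ s r).
  by move=> x _; rewrite /moll normrM gtr0_norm ?invr_gt0// ler_pM2l ?invr_gt0.
Qed.

(** Test with [trap s t r] and let r tend to 0: the derivative of the trapezoid samples f at s and
    at t by [mollify], while the trapezoid itself tends to the indicator of []s, t]]. *)
Lemma weak_deriv_increment b f h s t : weak_deriv b f h ->
  0 < s -> s <= t -> t < b -> lebesgue_pt f s -> lebesgue_pt f t ->
  f t - f s = \int[mu]_(x in `]s, t]) h x.
Proof.
move=> [fi hi fh] s0 st tb fs ft.
have sb : s < b by exact: le_lt_trans tb.
have t0 : 0 < t by exact: lt_le_trans st.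
(* Half the distance from t to b, so that the supports [[s, t + r n]], with r n <= e, stay inside
   (0, b). *)
pose e := (b - t) / 2.
have e0 : 0 < e by rewrite divr_gt0// subr_gt0.
have teb : t + e < b by rewrite /e; lra.
pose r n : R := e * harmonic n.
have r0 n : 0 < r n by rewrite /r mulr_gt0// /harmonic/= invr_gt0 ltr0n.
have re n : r n <= e.
  by rewrite /r ger_pMr// /harmonic/= invf_le1 ?ler1n.
have rc : r n @[n --> \oo] --> 0.
  by rewrite -(mulr0 e); apply: cvgM; [exact: cvg_cst|exact: cvg_harmonic].
have H1 := cvg_integral_trap hi s0 st r0 (ex_intro2 _ _ e teb re) rc.
have msb : 0 < s < b by rewrite s0.
have mtb : 0 < t < b by rewrite t0.
have /cvg_at_rightP/(_ r (conj r0 rc)) H2 := mollify msb fi fs.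
have /cvg_at_rightP/(_ r (conj r0 rc)) H3 := mollify mtb fi ft.
have E : (fun n => - \int[mu]_(x in Ioo b) (h x * trap s t (r n) x)) =
    (fun n : nat => \int[mu]_(x in Ioo b) (f x * moll s (r n) x)) -
    (fun n : nat => \int[mu]_(x in Ioo b) (f x * moll t (r n) x)).
  apply/funext => n; rewrite !fctE -fh; last first.
    by apply: test_fun_trap => //; rewrite (le_lt_trans _ teb)// lerD2l.
  rewrite -RintegralB//.
  - by apply: eq_Rintegral => x _; rewrite derive1_trap mulrBr.
  - by apply: rint_moll => //; rewrite (le_lt_trans _ teb)// lerD.
  - by apply: rint_moll => //; rewrite (le_lt_trans _ teb)// lerD2l.
have := cvgB H2 H3; rewrite -E => {}H4.
have : f s - f t = - \int[mu]_(x in `]s, t]) h x.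
  exact: (cvg_unique (@Rhausdorff R) (H4 _) (cvgN H1)).
by move=> /(congr1 -%R); rewrite opprB opprK.
Qed.

(** For small r the mollifier at s is itself a test function, so the approximations of h s given by
    [mollify] are all 0. *)
Lemma weak_deriv0_lebesgue_pt b h s : locally_integrable (Ioo b) h ->
  (forall v, test_fun b v -> \int[mu]_(x in Ioo b) (h x * v x) = 0) ->
  0 < s < b -> lebesgue_pt h s -> h s = 0.
Proof.
move=> hi h0 /[dup] msb /andP[s0 sb] hs; have H := mollify msb hi hs.
apply: (cvg_unique (@Rhausdorff R) H); apply: cvg_near_cst; near=> r.
have r0 : 0 < r by near: r; exact: nbhs_right_gt.
apply: h0; apply: test_fun_moll => //.
by rewrite -ltrBrDl; near: r; apply: nbhs_right_lt; rewrite subr_gt0.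
Unshelve. all: by end_near. Qed.

Lemma ae_lebesgue_pt b f : locally_integrable (Ioo b) f ->
  {ae mu, forall x, x \in `]0, b[ -> lebesgue_pt f x}.
Proof.
move=> fi.
(* The differentiation theorem concerns functions on the whole line; f is cut off to compacts
   exhausting (0, b), and averages over small balls around a point of (0, b) do not see the cut. *)
pose K n := `[harmonic n, b - harmonic n]%classic : set R.
have h0 n : 0 < harmonic n :> R by rewrite /harmonic/= invr_gt0 ltr0n.
have fK n : {ae mu, forall x, lebesgue_pt (f \_ (K n)) x}.
  apply: lebesgue_differentiation; apply: integrable_locally; first exact: measurable_itv.
  by apply: (locally_integrable_itv fi) => //; rewrite gtrBl.
apply: aeS (ae_foralln fK) => x fx /itvP xb.
have xb0 : 0 < Num.min x (b - x) by rewrite lt_min subr_gt0 !xb.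
have [n hn] : exists n, harmonic n < Num.min x (b - x).
  have /cvgrPdist_lt/(_ _ xb0)[N _ /(_ N (leqnn N))] := @cvg_harmonic R.
  by rewrite sub0r normrN gtr0_norm// => ?; exists N.
move: hn; rewrite lt_min => /andP[nx nbx].
apply: cvg_trans (fx n); apply: near_eq_cvg; near=> r.
have rx : r < x - harmonic n by near: r; apply: nbhs_right_lt; rewrite subr_gt0.
have rbx : r < b - x - harmonic n by near: r; apply: nbhs_right_lt; rewrite subr_gt0.
have r0 : 0 < r by near: r; exact: nbhs_right_gt.
have fE y : ball x r y -> (f \_ (K n)) y = f y.
  rewrite ball_itv/= in_itv/= => /andP[y1 y2].
  rewrite /K; move: (harmonic n) rx rbx => c rx rbx.
  by rewrite patchE mem_set//= in_itv/=; apply/andP; split; lra.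
rewrite /davg /iavg; congr *%E; apply: eq_integral => y; rewrite inE => yx /=.
by rewrite !fE//; exact: ballxx.
Unshelve. all: by end_near. Qed.

Lemma weak_deriv0_ae b h : locally_integrable (Ioo b) h ->
  (forall v, test_fun b v -> \int[mu]_(x in Ioo b) (h x * v x) = 0) ->
  {ae mu, forall x, x \in `]0, b[ -> h x = 0}.
Proof.
move=> hi h0; apply: aeS (ae_lebesgue_pt hi) => x hx /[dup] xb /hx {}hx.
by apply: (weak_deriv0_lebesgue_pt hi h0) => //; rewrite in_itv in xb.
Qed.

Lemma rint_test b f v : locally_integrable (Ioo b) f -> test_fun b v ->
  rint (Ioo b) (fun x => f x * v x).
Proof.
move=> fi [vd [c [d [c0 db v0]]]].
have cv : continuous v.
  move=> x; apply: differentiable_continuous; apply/derivable1_diffP; exact: (vd 0%N x).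
have [M vM] : exists M, forall x, x \in `[c, d] -> `|v x| <= M.
  have [cd|dc] := leP c d; last first.
    exists 0 => x; rewrite in_itv/= => /andP[cx xd].
    by have := le_trans cx xd; rewrite leNgt dc.
  have : {within `[c, d], continuous (fun x => `|v x|)}.
    by apply: continuous_subspaceT => x; apply: continuous_comp; [exact: cv|exact: norm_continuous].
  by move=> /(EVT_max cd)[z _ vz]; exists `|v z|.
apply: (@rint_sub0 _ `[c, d]%classic) => //.
- by apply: subset_itvSoo; rewrite bnd_simp.
- by move=> x _ /negP xs; rewrite v0 ?mulr0.
- apply: (rint_mulr (C := M)) => //; first exact: locally_integrable_itv fi _ _.
  by apply: measurable_funTS; exact: continuous_measurable_fun.
Qed.

Lemma weak_deriv_unique b f h1 h2 : weak_deriv b f h1 -> weak_deriv b f h2 ->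
  {ae mu, forall x, x \in `]0, b[ -> h1 x = h2 x}.
Proof.
move=> [fi h1i fh1] [_ h2i fh2].
have := @weak_deriv0_ae b (fun x => h1 x - h2 x) (locally_integrableB h1i h2i).
have h0 v : test_fun b v -> \int[mu]_(x in Ioo b) ((h1 x - h2 x) * v x) = 0.
  move=> vt; under eq_Rintegral do rewrite mulrBl.
  rewrite RintegralB//; [|exact: rint_test..].
  by apply/eqP; rewrite subr_eq0 -eqr_opp -fh1// -fh2.
by move=> /(_ h0); apply: aeS => x hx /hx/eqP; rewrite subr_eq0 => /eqP.
Qed.

End weak_derivatives.

(** * Square-integrable functions: real-valued norm and inner product *)

Section square_integrable.
Context {R : realType}.
Notation mu := (@lebesgue_measure R).
Implicit Types (b : R) (f g h : R -> R) (D : set R).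

Lemma eq_Rintegral_ae D f g : measurable D -> measurable_fun D f -> measurable_fun D g ->
  {ae mu, forall x, D x -> f x = g x} ->
  \int[mu]_(x in D) f x = \int[mu]_(x in D) g x.
Proof.
move=> mD mf mg fg; congr fine; apply: ae_eq_integral => //.
- exact/measurable_EFinP.
- exact/measurable_EFinP.
- by apply: aeS fg => x + Dx => ->.
Qed.

Lemma rint_ae D f g : measurable D -> measurable_fun D f ->
  {ae mu, forall x, D x -> `|f x| <= g x} -> rint D g -> rint D f.
Proof.
move=> mD mf fg gi; apply/integrableP; split; first exact/measurable_EFinP.
have mg := rint_meas gi.
have /integrableP[_] := rint_normr gi; apply: le_lt_trans.
apply: ae_ge0_le_integral => //.
- by apply/measurable_EFinP; exact: measurableT_comp.
- by apply: measurableT_comp => //; apply/measurable_EFinP; exact: measurableT_comp.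
- by apply: aeS fg => x fgx Dx; rewrite lee_fin normr_id (le_trans (fgx Dx))// ler_norm.
Qed.

Lemma le_Rintegral_ae D f g : measurable D -> rint D f -> rint D g ->
  {ae mu, forall x, D x -> f x <= g x} ->
  \int[mu]_(x in D) f x <= \int[mu]_(x in D) g x.
Proof.
move=> mD fi gi fg; have mf := rint_meas fi; have mg := rint_meas gi.
(* The minimum agrees with f almost everywhere and is below g everywhere. *)
have mm : measurable_fun D (fun x => Num.min (f x) (g x)) by exact: measurable_minr.
rewrite (@eq_Rintegral_ae _ f (fun x => Num.min (f x) (g x)))//; last first.
  by apply: aeS fg => x + Dx => /(_ Dx) fgx; rewrite min_l.
apply: le_Rintegral => //; last by move=> x _; rewrite ge_min lexx orbT.
apply: (@rint_ae _ _ (fun x => `|f x|)) => //; last exact: rint_normr.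
by apply: aeS fg => x + Dx => /(_ Dx) fgx; rewrite min_l.
Qed.

Lemma L2P b f : L2 b f <-> measurable_fun (Ioo b) f /\ rint (Ioo b) (fun x => f x ^+ 2).
Proof.
have E : (\int[mu]_x (`|(EFin \o f \_ (Ioo b)) x| `^ 2) =
          \int[mu]_(x in Ioo b) `|(f x ^+ 2)%:E|)%E.
  rewrite [RHS]integral_mkcond; apply: eq_integral => x _ /=.
  rewrite !patchE; case: ifPn => _.
    by rewrite powR_mulrn// normrX.
  (* Outside (0, b) a restricted function takes the default value [point], which is 0 in R. *)
  have p0 : (point : R) = 0 by [].
  by rewrite p0 normr0 powR0// pnatr_eq0.
split.
- move=> fL; have : f \_ (Ioo b) \in Lfun mu 2%:E := fL.
  move=> /andP[]; rewrite !inE/= => mf fin.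
  have {}mf : measurable_fun (Ioo b) f by apply/(measurable_restrictT _ _).2.
  split => //; apply/integrableP; split.
    by apply/measurable_EFinP; exact: measurable_funX.
  rewrite -E; move: fin; rewrite /= /finite_norm unlock; apply: contraTT.
  rewrite -!leNgt !leye_eq => /eqP ->.
  by rewrite poweRyr// invr_eq0.
- move=> [mf /integrableP[_ fi]]; suff : f \_ (Ioo b) \in Lfun mu 2%:E by [].
  apply/andP; split; rewrite inE.
    exact/(measurable_restrictT _ _).1.
  by rewrite /= /finite_norm unlock; apply: poweR_lty; rewrite E.
Qed.

(** A real-valued integral reads an infinite value as 0, so this is the norm only for f in [L2]. *)
Definition nrm b f : R := Num.sqrt (\int[mu]_(x in Ioo b) (f x ^+ 2)).
Definition ip b f g : R := \int[mu]_(x in Ioo b) (f x * g x).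

Lemma nrm_ge0 b f : 0 <= nrm b f. Proof. exact: sqrtr_ge0. Qed.

Lemma sq_nrm b f : nrm b f ^+ 2 = \int[mu]_(x in Ioo b) (f x ^+ 2).
Proof. by rewrite sqr_sqrtr// Rintegral_ge0// => x _; exact: sqr_ge0. Qed.

Lemma ip_sq b f : ip b f f = nrm b f ^+ 2.
Proof. by rewrite sq_nrm; apply: eq_Rintegral => x _; rewrite expr2. Qed.

Lemma L2norm_nrm b f : L2 b f -> L2norm b f = (nrm b f)%:E.
Proof.
move=> /L2P[mf fi]; rewrite /L2norm unlock.
have -> : (\int[mu]_x (`|(EFin \o f \_ (Ioo b)) x| `^ 2) =
          \int[mu]_(x in Ioo b) (f x ^+ 2)%:E)%E.
  rewrite [RHS]integral_mkcond; apply: eq_integral => x _ /=.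
  rewrite !patchE; case: ifPn => _.
    by rewrite powR_mulrn// real_normK ?num_real.
  have p0 : (point : R) = 0 by [].
  by rewrite p0 normr0 powR0// pnatr_eq0.
rewrite rint_ereal// poweR_EFin powR12_sqrt//.
by rewrite Rintegral_ge0// => x _; exact: sqr_ge0.
Qed.

Lemma L2_meas b f : L2 b f -> measurable_fun (Ioo b) f.
Proof. by move=> /L2P[]. Qed.

Lemma L2_sq b f : L2 b f -> rint (Ioo b) (fun x => f x ^+ 2).
Proof. by move=> /L2P[]. Qed.

Lemma rintM b f g : L2 b f -> L2 b g -> rint (Ioo b) (fun x => f x * g x).
Proof.
move=> /L2P[mf fi] /L2P[mg gi].
apply: (@rint_le _ _ _ (fun x => f x ^+ 2 + g x ^+ 2)) => //; last exact: rintD.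
  exact: measurable_funM.
move=> x _; rewrite ler_norml; apply/andP; split; nra.
Qed.

Lemma L2D b f g : L2 b f -> L2 b g -> L2 b (fun x => f x + g x).
Proof.
move=> fL gL; apply/L2P; split; first by apply: measurable_funD; exact: L2_meas.
have -> : (fun x => (f x + g x) ^+ 2) = (fun x => f x ^+ 2 + (2 * (f x * g x) + g x ^+ 2)).
  by apply/funext => x; ring.
by apply: rintD => //; [exact: L2_sq|apply: rintD => //; [apply: rintZl => //; exact: rintM|exact: L2_sq]].
Qed.

Lemma L2Z b c f : L2 b f -> L2 b (fun x => c * f x).
Proof.
move=> fL; apply/L2P; split; first by apply: measurable_funM => //; exact: L2_meas.
have -> : (fun x => (c * f x) ^+ 2) = (fun x => c ^+ 2 * f x ^+ 2).
  by apply/funext => x; rewrite exprMn.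
by apply: rintZl => //; exact: L2_sq.
Qed.

Lemma L2N b f : L2 b f -> L2 b (fun x => - f x).
Proof. by move=> /(L2Z (-1)); under eq_fun do rewrite mulN1r. Qed.

Lemma L2B b f g : L2 b f -> L2 b g -> L2 b (fun x => f x - g x).
Proof. by move=> fL gL; apply: L2D => //; exact: L2N. Qed.

Lemma L2_le b f g : measurable_fun (Ioo b) f ->
  {ae mu, forall x, Ioo b x -> `|f x| <= `|g x|} -> L2 b g -> L2 b f.
Proof.
move=> mf fg gL; apply/L2P; split => //.
apply: (@rint_ae _ _ (fun x => g x ^+ 2)) => //; last exact: L2_sq.
  exact: measurable_funX.
apply: aeS fg => x + bx => /(_ bx) fgx.
by rewrite ger0_norm ?sqr_ge0// -real_normK ?num_real// -[leRHS]real_normK ?num_real// lerXn2r ?nnegrE.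
Qed.

Lemma L2_bounded b f C : measurable_fun (Ioo b) f ->
  {ae mu, forall x, Ioo b x -> `|f x| <= C} -> L2 b f.
Proof.
move=> mf fC; apply/L2P; split => //.
apply: (@rint_ae _ _ (fun x => C ^+ 2)) => //; first exact: measurable_funX.
  apply: aeS fC => x + bx => /(_ bx) fCx.
  by rewrite normrX lerXn2r// nnegrE// (le_trans _ fCx).
by apply: (@rint_bounded _ _ _ `|C ^+ 2|) => //; exact: mu_itv_lty.
Qed.

Lemma ipC b f g : ip b f g = ip b g f.
Proof. by apply: eq_Rintegral => x _; rewrite mulrC. Qed.

Lemma ipDl b f g h : L2 b f -> L2 b g -> L2 b h ->
  ip b (fun x => f x + g x) h = ip b f h + ip b g h.
Proof.
move=> fL gL hL; rewrite /ip -RintegralD//; [|exact: rintM..].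
by apply: eq_Rintegral => x _; rewrite mulrDl.
Qed.

Lemma ipZl b c f h : L2 b f -> L2 b h -> ip b (fun x => c * f x) h = c * ip b f h.
Proof.
move=> fL hL; rewrite /ip -RintegralZl//; last exact: rintM.
by apply: eq_Rintegral => x _; rewrite mulrA.
Qed.

Lemma ipNl b f h : L2 b f -> L2 b h -> ip b (fun x => - f x) h = - ip b f h.
Proof.
by move=> fL hL; rewrite -mulN1r -ipZl//; apply: eq_Rintegral => x _; rewrite !mulNr mul1r.
Qed.

Lemma ipBl b f g h : L2 b f -> L2 b g -> L2 b h ->
  ip b (fun x => f x - g x) h = ip b f h - ip b g h.
Proof. by move=> fL gL hL; rewrite ipDl ?ipNl//; exact: L2N. Qed.

Lemma ipDr b f g h : L2 b f -> L2 b g -> L2 b h ->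
  ip b h (fun x => f x + g x) = ip b h f + ip b h g.
Proof. by move=> fL gL hL; rewrite ipC ipDl// [ip b f h]ipC [ip b g h]ipC. Qed.

Lemma ipBr b f g h : L2 b f -> L2 b g -> L2 b h ->
  ip b h (fun x => f x - g x) = ip b h f - ip b h g.
Proof. by move=> fL gL hL; rewrite ipC ipBl// [ip b f h]ipC [ip b g h]ipC. Qed.

Lemma ipZr b c f h : L2 b f -> L2 b h -> ip b h (fun x => c * f x) = c * ip b h f.
Proof. by move=> fL hL; rewrite ipC ipZl// ipC. Qed.

Lemma nrmD_sq b f g : L2 b f -> L2 b g ->
  nrm b (fun x => f x + g x) ^+ 2 = nrm b f ^+ 2 + 2 * ip b f g + nrm b g ^+ 2.
Proof.
move=> fL gL; have fgL := L2D fL gL.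
by rewrite -!ip_sq ipDl// !ipDr// [ip b g f]ipC; ring.
Qed.

Lemma nrmZ_sq b c f : L2 b f -> nrm b (fun x => c * f x) ^+ 2 = c ^+ 2 * nrm b f ^+ 2.
Proof. by move=> fL; have cfL := L2Z c fL; rewrite -!ip_sq ipZl// ipZr//; ring. Qed.

Lemma nrmZ b c f : L2 b f -> nrm b (fun x => c * f x) = `|c| * nrm b f.
Proof.
move=> fL; apply: (@pexpIrn _ 2) => //; rewrite ?nnegrE ?nrm_ge0 ?mulr_ge0 ?nrm_ge0//.
by rewrite nrmZ_sq// exprMn real_normK ?num_real.
Qed.

Lemma nrmN b f : L2 b f -> nrm b (fun x => - f x) = nrm b f.
Proof.
move=> fL; rewrite /nrm; congr Num.sqrt; apply: eq_Rintegral => x _.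
by rewrite sqrrN.
Qed.

Lemma nrmB_sym b f g : nrm b (fun x => f x - g x) = nrm b (fun x => g x - f x).
Proof.
rewrite /nrm; congr Num.sqrt; apply: eq_Rintegral => x _.
by rewrite -sqrrN opprB.
Qed.

Lemma cauchy_schwarz b f g : L2 b f -> L2 b g -> `|ip b f g| <= nrm b f * nrm b g.
Proof.
move=> fL gL; set A := nrm b f; set B := nrm b g; set p := ip b f g.
have A0 : 0 <= A := nrm_ge0 b f. have B0 : 0 <= B := nrm_ge0 b g.
have H c : 0 <= A ^+ 2 + 2 * (c * p) + c ^+ 2 * B ^+ 2.
  rewrite -ipZr// -nrmZ_sq// -nrmD_sq ?sqr_ge0//; exact: L2Z.
suff : p ^+ 2 <= (A * B) ^+ 2.
  by rewrite -[X in X <= _ -> _]real_normK ?num_real// ler_pXn2r// nnegrE// mulr_ge0.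
have [B1|B1] := eqVneq B 0; last first.
  (* The minimizer in c of the quadratic in [H]. *)
  rewrite exprMn; have := H (- p / B ^+ 2).
  have -> : A ^+ 2 + 2 * (- p / B ^+ 2 * p) + (- p / B ^+ 2) ^+ 2 * B ^+ 2 =
            A ^+ 2 - p ^+ 2 / B ^+ 2 by field.
  by rewrite subr_ge0 ler_pdivrMr// exprn_gt0// lt_def B1.
rewrite B1 mulr0 expr0n/=.
have [->|p1] := eqVneq p 0; first by rewrite expr0n.
(* With B = 0 the expression in [H] is affine in c, and this c gives it the value -1. *)
have := H (- (A ^+ 2 + 1) / (2 * p)); rewrite B1 expr0n mulr0 addr0.
have -> : A ^+ 2 + 2 * (- (A ^+ 2 + 1) / (2 * p) * p) = -1 by field.
by rewrite oppr_ge0 ler10.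
Qed.

Lemma nrmD b f g : L2 b f -> L2 b g -> nrm b (fun x => f x + g x) <= nrm b f + nrm b g.
Proof.
move=> fL gL; rewrite -(@ler_pXn2r _ 2)// ?nnegrE ?addr_ge0 ?nrm_ge0//.
have := le_trans (ler_norm _) (cauchy_schwarz fL gL).
rewrite nrmD_sq//; nra.
Qed.

Lemma nrmB b f g : L2 b f -> L2 b g -> nrm b (fun x => f x - g x) <= nrm b f + nrm b g.
Proof. by move=> fL gL; rewrite -(nrmN gL) nrmD//; exact: L2N. Qed.

Lemma nrm_dist b f g : L2 b f -> L2 b g ->
  `|nrm b f - nrm b g| <= nrm b (fun x => f x - g x).
Proof.
move=> fL gL; rewrite ler_norml; apply/andP; split.
  rewrite lerNl opprB lerBlDl nrmB_sym; apply: le_trans (nrmD _ _) => //; last exact: L2B.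
  by rewrite le_eqVlt; apply/orP; left; apply/eqP; congr nrm; apply/funext => x; ring.
rewrite lerBlDl; apply: le_trans (nrmD _ _) => //; last exact: L2B.
by rewrite le_eqVlt; apply/orP; left; apply/eqP; congr nrm; apply/funext => x; ring.
Qed.

Lemma nrm_ae b f g : L2 b f -> L2 b g -> {ae mu, forall x, Ioo b x -> f x = g x} ->
  nrm b f = nrm b g.
Proof.
move=> /L2P[mf _] /L2P[mg _] fg; congr Num.sqrt; apply: eq_Rintegral_ae => //.
- exact: measurable_funX.
- exact: measurable_funX.
- by apply: aeS fg => x + bx => ->.
Qed.

End square_integrable.

(** * Bochner integrals paired with a fixed function *)

Section bochner.
Context {R : realType}.
Notation mu := (@lebesgue_measure R).
Implicit Types (b l T : R) (D : set R).

(* [f2] need not be measurable: the integral is then a lower integral, and the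
   norms integrated in the Bochner definitions are only a.e. equal to measurable
   functions. *)
Lemma lower_integral_le D (f1 f2 : R -> \bar R) : measurable D -> measurable_fun D f1 ->
  (forall x, D x -> 0 <= f1 x)%E -> (forall x, D x -> 0 <= f2 x)%E ->
  {ae mu, forall x, D x -> (f1 x <= f2 x)%E} ->
  (\int[mu]_(x in D) f1 x <= \int[mu]_(x in D) f2 x)%E.
Proof.
move=> mD mf1 f10 f20 [N [mN N0 sub]].
rewrite (ge0_negligible_integral mN)//.
rewrite !ge0_integralE//; last by move=> x [Dx _]; exact: f10.
apply: ereal_sup_le => _ [h hf <-]; exists h => // x; apply: le_trans (hf x) _.
rewrite !patchE; have [Dx|Dx] := pselect (D x); last first.
  by rewrite !memNset//; case.
rewrite [x \in D]mem_set//; have [Nx|Nx] := pselect (N x).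
  by rewrite memNset ?f20//; case.
rewrite mem_set//; apply: contrapT => f12; apply: Nx; apply: sub => /=.
by move=> /(_ Dx).
Qed.

(** The limit g may fail to be measurable on the exceptional set N; setting it to 0 there gives a
    pointwise limit of measurable functions. *)
Lemma ae_cvg_measurable D (G : nat -> R -> R) (g : R -> R) : measurable D ->
  (forall n, measurable_fun D (G n)) ->
  {ae mu, forall x, D x -> G n x @[n --> \oo] --> g x} ->
  exists2 H, measurable_fun D H & {ae mu, forall x, D x -> H x = g x}.
Proof.
move=> mD mG [N [mN N0 sub]].
have mDN : measurable (D `\` N) by exact: measurableD.
exists (g \_ (D `\` N)).
  apply: (@measurable_fun_cvg _ _ _ _ (fun n => (G n) \_ (D `\` N))).
    move=> n; apply/measurable_restrict => //.
    by apply: measurable_funS (mG n) => // x [[]].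
  move=> x Dx; rewrite patchE; under eq_fun do rewrite patchE.
  case: ifPn => [/[!inE] -[_ Nx]|_]; last exact: cvg_cst.
  by apply: contrapT => h; apply: Nx; apply: sub => /= /(_ Dx).
exists N; split => // x /= h; apply: contrapT => Nx; apply: h => Dx.
by rewrite patchE mem_set.
Qed.

Lemma L2_sum l n (c : 'I_n -> R) (v : 'I_n -> R -> R) : (forall i, L2 l (v i)) ->
  L2 l (fun x => \sum_i c i * v i x).
Proof.
elim: n c v => [|n IH] c v vL.
  under eq_fun do rewrite big_ord0.
  by apply: (@L2_bounded _ _ _ 0) => //; apply: aeW => x _; rewrite normr0.
under eq_fun do rewrite big_ord_recl.
by apply: L2D; [exact: L2Z|exact: IH].
Qed.

Lemma ip_sum l n (c : 'I_n -> R) (v : 'I_n -> R -> R) psi : (forall i, L2 l (v i)) ->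
  L2 l psi -> ip l (fun x => \sum_i c i * v i x) psi = \sum_i c i * ip l (v i) psi.
Proof.
move=> + pL; elim: n c v => [|n IH] c v vL.
  rewrite big_ord0 /ip; under eq_Rintegral do rewrite big_ord0 mul0r.
  by rewrite Rintegral_cst// mul0r.
rewrite big_ord_recl -IH// -ipZl// -ipDl//; [|exact: L2Z|exact: L2_sum].
by apply: eq_Rintegral => x _; rewrite big_ord_recl.
Qed.

Lemma rint_indic T (A : set R) : measurable A -> rint (Ioo T) (\1_A : R -> R).
Proof.
move=> mA; apply: (@rint_bounded _ _ _ 1) => //; first exact: mu_itv_lty.
by move=> x _; rewrite indicE; case: (_ \in _); rewrite ?normr1 ?normr0.
Qed.

Lemma step_fun_L2 l (s : step R) t : step_in (L2 l) s -> L2 l (step_fun s t).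
Proof. by move=> [_ sL]; exact: L2_sum. Qed.

Lemma step_int_L2 l T (s : step R) : step_in (L2 l) s -> L2 l (step_int T s).
Proof. by move=> [_ sL]; exact: L2_sum. Qed.

Lemma ip_step l (s : step R) psi t : step_in (L2 l) s -> L2 l psi ->
  ip l (step_fun s t) psi = \sum_i \1_(stepset i) t * ip l (@stepval R s i) psi.
Proof. by move=> [_ sL] pL; exact: ip_sum. Qed.

Lemma measurable_ip_step l (s : step R) psi D : step_in (L2 l) s -> L2 l psi ->
  measurable_fun D (fun t => ip l (step_fun s t) psi).
Proof.
move=> sL pL; under eq_fun do rewrite ip_step//.
apply: measurable_sum => i; apply: measurable_funM => //.
by apply: measurable_funTS; apply: measurable_indic; case: sL.
Qed.

Lemma measurable_nrm_step l (s : step R) D : step_in (L2 l) s ->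
  measurable_fun D (fun t => nrm l (step_fun s t)).
Proof.
move=> sL; apply: (@measurableT_comp _ _ _ _ _ _ (@Num.sqrt R) _ (fun t => \int[mu]_(x in Ioo l) (step_fun s t x ^+ 2))).
  exact: continuous_measurable_fun (@sqrt_continuous R).
(* Expanding one factor of the squared norm over the pieces of the step function reduces to scalar
   products already known to be measurable in t. *)
have -> : (fun t => \int[mu]_(x in Ioo l) (step_fun s t x ^+ 2)) =
    (fun t => \sum_i \1_(stepset i) t * ip l (step_fun s t) (@stepval R s i)).
  apply/funext => t; rewrite -sq_nrm -ip_sq ip_step//; last exact: step_fun_L2.
  by apply: eq_bigr => i _; rewrite ipC.
apply: measurable_sum => i; apply: measurable_funM; last first.
  by apply: measurable_ip_step => //; case: sL.
by apply: measurable_funTS; apply: measurable_indic; case: sL.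
Qed.

Lemma Rintegral_ip_step l T (s : step R) psi : step_in (L2 l) s -> L2 l psi ->
  rint (Ioo T) (fun t => ip l (step_fun s t) psi) /\
  \int[mu]_(t in Ioo T) ip l (step_fun s t) psi = ip l (step_int T s) psi.
Proof.
move=> sL pL; have vL i : L2 l (@stepval R s i) by case: sL.
have mA i : measurable (@stepset R s i) by case: sL.
rewrite ip_sum//; under eq_Rintegral do rewrite ip_step//.
have -> : (fun t => ip l (step_fun s t) psi) =
    (fun t => \sum_i \1_(stepset i) t * ip l (@stepval R s i) psi).
  by apply/funext => t; rewrite ip_step.
(* The list of indices is made arbitrary for the induction. *)
suff H r : rint (Ioo T) (fun t => \sum_(i <- r) \1_(stepset i) t * ip l (@stepval R s i) psi) /\
    \int[mu]_(t in Ioo T) (\sum_(i <- r) \1_(stepset i) t * ip l (@stepval R s i) psi) =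
    \sum_(i <- r) fine (mu (Ioo T `&` @stepset R s i)) * ip l (@stepval R s i) psi.
  exact: H.
elim: r => [|i r [IH1 IH2]].
  rewrite big_nil; under eq_Rintegral do rewrite big_nil.
  rewrite Rintegral_cst// mul0r; split => //.
  have -> : (fun t => \sum_(i <- [::]) \1_(stepset i) t * ip l (@stepval R s i) psi) = cst 0.
    by apply/funext => t; rewrite big_nil.
  by apply: (@rint_bounded _ _ _ 0) => //; [exact: mu_itv_lty|move=> x _; rewrite normr0].
rewrite big_cons -IH2; have iA := rint_indic T (mA i).
split.
  have -> : (fun t => \sum_(j <- i :: r) \1_(stepset j) t * ip l (@stepval R s j) psi) =
    (fun t => \1_(stepset i) t * ip l (@stepval R s i) psi +
              \sum_(j <- r) \1_(stepset j) t * ip l (@stepval R s j) psi).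
    by apply/funext => t; rewrite big_cons.
  by apply: rintD => //; exact: rintZr.
under eq_Rintegral do rewrite big_cons.
rewrite RintegralD//; last exact: rintZr.
rewrite RintegralZr//; congr (_ * _ + _).
rewrite /Rintegral (_ : (\int[mu]_(x in Ioo T) (\1_(stepset i) x)%:E)%E = mu (Ioo T `&` @stepset R s i))//.
by rewrite classical_sets.setIC integral_indic//; exact: mA.
Qed.

Lemma cvg_nrm l (w : nat -> R -> R) : (forall n, L2 l (w n)) ->
  L2norm l (w n) @[n --> \oo] --> 0%E -> nrm l (w n) @[n --> \oo] --> 0.
Proof.
move=> wL; under eq_fun do rewrite L2norm_nrm//.
by move=> /fine_cvgP[_].
Qed.

Lemma cvg_ip l (w : nat -> R -> R) f psi : (forall n, L2 l (w n)) -> L2 l f -> L2 l psi ->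
  nrm l (fun x => f x - w n x) @[n --> \oo] --> 0 ->
  ip l (w n) psi @[n --> \oo] --> ip l f psi.
Proof.
move=> wL fL pL w0; apply/cvgrPdist_le => e e0.
have c0 : 0 < nrm l psi + 1 by rewrite ltr_wpDl// nrm_ge0.
have /cvgrPdist_le/(_ (e / (nrm l psi + 1))) := w0.
rewrite divr_gt0// => /(_ isT); apply: filterS => n.
rewrite sub0r normrN ger0_norm ?nrm_ge0// => wn.
rewrite -ipBl//; apply: le_trans (cauchy_schwarz (L2B fL (wL n)) pL) _.
apply: (@le_trans _ _ (e / (nrm l psi + 1) * (nrm l psi + 1))).
  by apply: ler_pM; rewrite ?nrm_ge0// lerDl.
by rewrite divfK// gt_eqF.
Qed.

(** Pairing with psi is continuous along the approximating step functions. These converge only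
    almost everywhere, hence the representative H. *)
Lemma strongly_measurable_ip l T f psi : strongly_measurable T (L2 l) (L2norm l) f ->
  {ae mu, forall t, t \in `]0, T[ -> L2 l (f t)} -> L2 l psi ->
  exists2 H, measurable_fun (Ioo T) H & {ae mu, forall t, Ioo T t -> H t = ip l (f t) psi}.
Proof.
move=> [s sL sf] fL pL.
apply: (@ae_cvg_measurable _ (fun n t => ip l (step_fun (s n) t) psi)) => //.
  by move=> n; exact: measurable_ip_step.
apply: aeS2 fL sf => t ftL sft Dt.
have {}ftL := ftL Dt; have {}sft := sft Dt.
have stL n : L2 l (step_fun (s n) t) by exact: step_fun_L2.
by apply: cvg_ip => //; apply: cvg_nrm sft => n; exact: L2B.
Qed.

Lemma strongly_measurable_nrm l T f : strongly_measurable T (L2 l) (L2norm l) f ->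
  {ae mu, forall t, t \in `]0, T[ -> L2 l (f t)} ->
  exists2 M, measurable_fun (Ioo T) M & {ae mu, forall t, Ioo T t -> M t = nrm l (f t)}.
Proof.
move=> [s sL sf] fL.
apply: (@ae_cvg_measurable _ (fun n t => nrm l (step_fun (s n) t))) => //.
  by move=> n; exact: measurable_nrm_step.
apply: aeS2 fL sf => t ftL sft Dt.
have {}ftL := ftL Dt; have {}sft := sft Dt.
have stL n : L2 l (step_fun (s n) t) by exact: step_fun_L2.
have := @cvg_nrm l _ (fun n => L2B ftL (stL n)) sft.
move=> h0; apply/cvgrPdist_le => e e0.
have /cvgrPdist_le/(_ e e0) := h0; apply: filterS => n.
by rewrite sub0r normrN ger0_norm ?nrm_ge0//; apply: le_trans; exact: nrm_dist.
Qed.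

(** M is a measurable representative of the norm of f; the integral of its square is bounded by the
    lower integral in [bochner_L2]. *)
Lemma bochner_L2_nrm l T f : bochner_L2 T (L2 l) (L2norm l) f ->
  exists2 M, rint (Ioo T) M & {ae mu, forall t, Ioo T t -> L2 l (f t) /\ nrm l (f t) = M t}.
Proof.
move=> [fL sf fi]; have [M mM Mf] := strongly_measurable_nrm sf fL.
exists M; last by apply: aeS2 fL Mf => t h1 h2 Dt; split; [exact: h1|rewrite h2].
have M2 : rint (Ioo T) (fun t => M t ^+ 2).
  apply/integrableP; split; first by apply/measurable_EFinP; exact: measurable_funX.
  apply: le_lt_trans fi; apply: lower_integral_le => //.
  - apply: measurableT_comp => //; apply/measurable_EFinP; exact: measurable_funX.
  - by move=> x _; exact: poweR_ge0.
  - apply: aeS2 fL Mf => t h1 h2 Dt.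
    rewrite /= h2// L2norm_nrm ?poweR_EFin ?powR_mulrn ?nrm_ge0//; last exact: h1.
    by rewrite ger0_norm ?sqr_ge0.
(* The constant 1 is integrable because the interval has finite length, which takes M^2 to M. *)
apply: (@rint_le _ _ _ (fun t => M t ^+ 2 + 1)) => //.
  move=> t _; rewrite ler_norml; apply/andP; split; nra.
apply: rintD => //; apply: (@rint_bounded _ _ _ 1) => //; first exact: mu_itv_lty.
by move=> x _; rewrite normr1.
Qed.

(** The identity holds for step functions by [Rintegral_ip_step], and by Cauchy-Schwarz both sides
    pass to the limit under the convergences required in [bochner_integral]. *)
Lemma bochner_integral_ip l T f w psi H : bochner_integral T (L2 l) (L2norm l) f w ->
  {ae mu, forall t, t \in `]0, T[ -> L2 l (f t)} -> L2 l psi ->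
  measurable_fun (Ioo T) H -> {ae mu, forall t, Ioo T t -> H t = ip l (f t) psi} ->
  rint (Ioo T) H /\ \int[mu]_(t in Ioo T) H t = ip l w psi.
Proof.
move=> [wL [s [sL sf si sw]]] fL pL mH Hf.
have c0 : 0 < nrm l psi + 1 by rewrite ltr_wpDl// nrm_ge0.
pose G n t := ip l (step_fun (s n) t) psi.
have Gi n : rint (Ioo T) (G n) by have [] := Rintegral_ip_step T (sL n) pL.
have mGH n : measurable_fun (Ioo T) (fun t => `|H t - G n t|).
  by apply: measurableT_comp => //; apply: measurable_funB => //; exact: rint_meas.
(* Adding 1 makes the constant invertible. It stands on the left, where the integrand is measurable
   and a factor may be moved out; the norm on the right need not be measurable. *)
have bd n : ((nrm l psi + 1)^-1%:E * \int[mu]_(t in Ioo T) `|H t - G n t|%:E <=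
    \int[mu]_(t in Ioo T) L2norm l (f t \- step_fun (s n) t)%R)%E.
  rewrite -ge0_integralZl//; [|by apply/measurable_EFinP; exact: mGH|by rewrite lee_fin invr_ge0 ltW].
  apply: lower_integral_le => //.
  - by apply/measurable_EFinP; apply: measurable_funM.
  - by move=> x _; rewrite -EFinM lee_fin mulr_ge0// invr_ge0 ltW.
  - by move=> x _; exact: Lnorm_ge0.
  - apply: aeS2 fL Hf => t h1 h2 Dt; rewrite -EFinM h2//; have {}h1 := h1 Dt.
    have stL := step_fun_L2 t (sL n).
    rewrite L2norm_nrm; last exact: L2B.
    rewrite lee_fin -ipBl// ler_pdivrMl// mulrC.
    apply: le_trans (cauchy_schwarz (L2B h1 stL) pL) _.
    by apply: ler_wpM2l; rewrite ?nrm_ge0// lerDl.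
have /fine_cvgP[sfin s0] := si.
have HGi : \forall n \near \oo, rint (Ioo T) (fun t => H t - G n t) /\
    \int[mu]_(t in Ioo T) `|H t - G n t| <= (nrm l psi + 1) *
    fine (\int[mu]_(t in Ioo T) L2norm l (f t \- step_fun (s n) t)%R)%E.
  apply: filterS sfin => n sn; have := bd n.
  rewrite -(fineK sn) lee_pdivrMl// => bdn.
  have HG : rint (Ioo T) (fun t => H t - G n t).
    apply/integrableP; split.
      by apply/measurable_EFinP; apply: measurable_funB => //; exact: rint_meas.
    by apply: le_lt_trans bdn _; rewrite ltry.
  split => //; rewrite -lee_fin -rint_ereal//; exact: rint_normr.
have Hi : rint (Ioo T) H.
  have [N _ /(_ N (leqnn N))[HG _]] := HGi.
  have -> : H = fun t => (H t - G N t) + G N t by apply/funext => t; rewrite subrK.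
  exact: rintD.
split => //.
have step_cv : ip l (step_int T (s n)) psi @[n --> \oo] --> ip l w psi.
  apply: cvg_ip => //; first by move=> n; exact: step_int_L2.
  by apply: cvg_nrm sw => n; apply: L2B => //; exact: step_int_L2.
apply: (cvg_unique (@Rhausdorff R) _ step_cv).
apply/cvgrPdist_le => e e0.
have /cvgrPdist_le/(_ (e / (nrm l psi + 1))) := s0.
rewrite divr_gt0// => /(_ isT); apply: filterS2 HGi => n [HG1 HG2] sn.
have [_ <-] := Rintegral_ip_step T (sL n) pL.
rewrite -/(G n) -(RintegralB _ Hi (Gi n))//.
apply: le_trans (le_normr_Rintegral _ HG1) _ => //.
apply: le_trans HG2 _; rewrite -ler_pdivlMl// mulrC.
by apply: le_trans sn; rewrite sub0r normrN ler_norm.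
Qed.

End bochner.

(** * Energy estimate for continuous curves in L^2 *)

Section energy.
Context {R : realType}.
Notation mu := (@lebesgue_measure R).
Implicit Types (b l T : R) (D : set R).

Definition L2_continuous l T (u : R -> R -> R) :=
  forall t, t \in `[0, T] -> L2 l (u t) /\
     (fun s => L2norm l (u s \- u t)) @ within [set` `[0, T]] (nbhs t) --> 0%E.

Lemma L2_continuousP l T (u : R -> R -> R) t e : L2_continuous l T u ->
  t \in `[0, T] -> 0 < e ->
  \forall s \near t, s \in `[0, T] -> nrm l (fun x => u s x - u t x) <= e.
Proof.
move=> uc tT e0; have [uL] := uc _ tT.
move=> /fine_cvgP[_ /cvgrPdist_le/(_ _ e0)]; rewrite /prop_near1 /within/=.
apply: (@filterS _ (nbhs t)) => s /= + sT => /(_ sT).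
have [usL _] := uc _ sT.
rewrite sub0r normrN L2norm_nrm/=; last exact: L2B.
by rewrite ger0_norm ?nrm_ge0.
Qed.

Lemma L2_continuousB l T (u v : R -> R -> R) : L2_continuous l T u -> L2_continuous l T v ->
  L2_continuous l T (fun t x => u t x - v t x).
Proof.
move=> uc vc t tT; have [utL _] := uc _ tT; have [vtL _] := vc _ tT.
split; first exact: L2B.
have fE s : s \in `[0, T] -> L2norm l ((fun x => u s x - v s x) \- (fun x => u t x - v t x)) =
    (nrm l (fun x => (u s x - u t x) - (v s x - v t x)))%:E.
  move=> sT; have [usL _] := uc _ sT; have [vsL _] := vc _ sT.
  rewrite L2norm_nrm; last by apply: L2B; exact: L2B.
  by congr (nrm _ _)%:E; apply/funext => x /=; ring.
apply/fine_cvgP; split.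
  near=> s; rewrite fE//; near: s; exact: withinT.
apply/cvgrPdist_le => e e0; have e2 : 0 < e / 2 by rewrite divr_gt0.
have h1 := L2_continuousP uc tT e2.
have h2 := L2_continuousP vc tT e2.
rewrite /prop_near1 /within/=; apply: filterS2 h1 h2 => s h1 h2 sT.
have {}h1 := h1 sT; have {}h2 := h2 sT.
have [usL _] := uc _ sT; have [vsL _] := vc _ sT.
rewrite sub0r normrN fE//= ger0_norm ?nrm_ge0//.
apply: le_trans (nrmB _ _) _; [exact: L2B|exact: L2B|lra].
Unshelve. all: by end_near. Qed.

Lemma L2_continuous_nrm l T (u : R -> R -> R) : L2_continuous l T u ->
  {within `[0, T], continuous (fun t => nrm l (u t))}.
Proof.
move=> uc; apply/subspace_continuousP => t /= tT.
apply/cvgrPdist_le => e e0; rewrite /prop_near1 /within/=.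
apply: filterS (L2_continuousP uc tT e0) => s h sT; have {}h := h sT.
have [utL _] := uc _ tT; have [usL _] := uc _ sT.
by rewrite distrC (le_trans (nrm_dist _ _)).
Qed.

Lemma L2_continuous_ip l T (u : R -> R -> R) psi : L2_continuous l T u -> L2 l psi ->
  {within `[0, T], continuous (fun t => ip l (u t) psi)}.
Proof.
move=> uc pL; apply/subspace_continuousP => t /= tT.
have c0 : 0 < nrm l psi + 1 by rewrite ltr_wpDl// nrm_ge0.
apply/cvgrPdist_le => e e0; rewrite /prop_near1 /within/=.
have e1 : 0 < e / (nrm l psi + 1) by rewrite divr_gt0.
apply: filterS (L2_continuousP uc tT e1) => s h sT; have {}h := h sT.
have [utL _] := uc _ tT; have [usL _] := uc _ sT.
rewrite distrC -ipBl// (le_trans (cauchy_schwarz (L2B usL utL) pL))//.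
apply: (@le_trans _ _ (e / (nrm l psi + 1) * (nrm l psi + 1))).
  by apply: ler_pM; rewrite ?nrm_ge0// lerDl.
by rewrite divfK// gt_eqF.
Qed.

(** Heine-Cantor argument with the compactness of [0, T] in near-covering form, the parameter being
    d -> 0+. Around each t half of the radius r that works for e / 2 is kept: if t' is within r / 2
    of t and d < r / 2, points within d of t' are within r of t. *)
Lemma L2_unif_continuous l T (u : R -> R -> R) e : L2_continuous l T u -> 0 < e ->
  exists2 d, 0 < d & forall s t, s \in `[0, T] -> t \in `[0, T] -> `|s - t| <= d ->
    nrm l (fun x => u s x - u t x) <= e.
Proof.
move=> uc e0; have e2 : 0 < e / 2 by rewrite divr_gt0.
have /compact_near_coveringP/near_covering_withinP := @segment_compact R 0 T.
move=> /(_ R (0 : R)^'+ (fun d t => forall s, s \in `[0, T] -> `|s - t| <= d ->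
    nrm l (fun x => u s x - u t x) <= e)) H.
have [|d /= d0] := H _.
  move=> t /= tT; have /nbhs_ballP[r /= r0 hr] := L2_continuousP uc tT e2.
  have r2 : 0 < r / 2 by rewrite divr_gt0.
  exists (ball t (r / 2), [set d | 0 < d < r / 2]).
    split; first exact: nbhsx_ballx.
    near=> d; rewrite /=; apply/andP; split; near: d; [exact: nbhs_right_gt|exact: nbhs_right_lt].
  move=> [t' d]/= [tt' /andP[d0 dr]] t'T s sT std.
  have [utL _] := uc _ tT; have [ut'L _] := uc _ t'T; have [usL _] := uc _ sT.
  have h1 : nrm l (fun x => u t' x - u t x) <= e / 2.
    by apply: hr => //; apply: le_ball tt'; lra.
  have h2 : nrm l (fun x => u s x - u t x) <= e / 2.
    apply: hr => //; rewrite /ball/=; move: tt'; rewrite /ball/= => tt'.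
    have -> : t - s = (t - t') - (s - t') by ring.
    by rewrite (le_lt_trans (ler_normB _ _))//; lra.
  have -> : (fun x => u s x - u t' x) = (fun x => (u s x - u t x) - (u t' x - u t x)).
    by apply/funext => x; ring.
  apply: le_trans (nrmB _ _) _; [exact: L2B|exact: L2B|lra].
move=> hd; exists (d / 2); first by rewrite divr_gt0.
move=> s t sT tT st; apply: (hd (d / 2)) => //=.
- rewrite /ball/= sub0r normrN gtr0_norm ?divr_gt0//; lra.
- by rewrite divr_gt0.
Unshelve. all: by end_near. Qed.

Lemma L2_continuous_bounded l T (u : R -> R -> R) : 0 <= T -> L2_continuous l T u ->
  exists U, forall t, t \in `[0, T] -> nrm l (u t) <= U.
Proof.
move=> T0 /L2_continuous_nrm /(EVT_max T0)[c _ hc].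
by exists (nrm l (u c)).
Qed.

(** Fundamental theorem of calculus for u, tested against each fixed psi; H is an integrable
    representative of the pairing of ut with psi. *)
Definition has_increments l T (u ut : R -> R -> R) := forall psi, L2 l psi ->
  exists H, [/\ rint (Ioo T) H, {ae mu, forall t, Ioo T t -> H t = ip l (ut t) psi} &
    forall s t, 0 < s -> s <= t -> t < T ->
      ip l (u t) psi - ip l (u s) psi = \int[mu]_(x in `]s, t]) H x].

Lemma has_incrementsB l T (u ut v vt : R -> R -> R) :
  L2_continuous l T u -> L2_continuous l T v ->
  {ae mu, forall t, Ioo T t -> L2 l (ut t)} -> {ae mu, forall t, Ioo T t -> L2 l (vt t)} ->
  has_increments l T u ut -> has_increments l T v vt ->
  has_increments l T (fun t x => u t x - v t x) (fun t x => ut t x - vt t x).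
Proof.
move=> uc vc utL vtL hu hv psi pL.
have [H [Hi Hut Hu]] := hu psi pL; have [K [Ki Kvt Kv]] := hv psi pL.
exists (fun t => H t - K t); split.
- exact: rintB.
- have := aeS2 (fun t (a : Ioo T t -> L2 l (ut t)) (b : Ioo T t -> L2 l (vt t)) =>
    conj a b) utL vtL.
  move=> L; have := aeS2 (fun t (a : Ioo T t -> H t = ip l (ut t) psi)
    (b : Ioo T t -> K t = ip l (vt t) psi) => conj a b) Hut Kvt.
  apply: aeS2 L => t [h1 h2] [h3 h4] Dt.
  by rewrite ipBl ?h3 ?h4//; [exact: h1|exact: h2].
- move=> s t s0 st tT.
  have cc x : 0 < x -> x < T -> x \in `[0, T].
    by move=> x0 xT; rewrite in_itv/= !ltW.
  have [|usL _] := uc s; first by rewrite cc// (le_lt_trans st).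
  have [|vsL _] := vc s; first by rewrite cc// (le_lt_trans st).
  have [|u_tL _] := uc t; first by rewrite cc// (lt_le_trans s0).
  have [|v_tL _] := vc t; first by rewrite cc// (lt_le_trans s0).
  have st' : `]s, t]%classic `<=` Ioo T.
    by apply: subset_itv; rewrite bnd_simp// ltW.
  rewrite !ipBl// RintegralB//; [|exact: rintS Hi|exact: rintS Ki].
  by rewrite -Hu// -Kv//; ring.
Qed.

(** The pairing of u with psi has weak derivative H in t, by [bochner_integral_ip] on both integrals
    in [weak_time_deriv]. Since it is continuous, all points of (0, T) are Lebesgue points and
    [weak_deriv_increment] applies everywhere. *)
Lemma weak_time_deriv_increments l T (u ut : R -> R -> R) : L2_continuous l T u ->
  bochner_L2 T (L2 l) (L2norm l) ut -> weak_time_deriv l T u ut ->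
  has_increments l T u ut.
Proof.
move=> uc utb uut psi pL.
have [utL sut _] := utb.
have [M Mi Mut] := bochner_L2_nrm utb.
have [H mH Hut] := strongly_measurable_ip sut utL pL.
have Hi : rint (Ioo T) H.
  apply: (@rint_ae _ _ _ (fun t => nrm l psi * M t)) => //; last exact: rintZl.
  apply: aeS2 Mut Hut => t h1 h2 Dt; have [h3 <-] := h1 Dt.
  by rewrite h2// mulrC cauchy_schwarz.
exists H; split => //.
have Fc := L2_continuous_ip uc pL.
have Tcc : Ioo T `<=` `[0, T]%classic by exact: subset_itv_oo_cc.
have FiT : rint `[0, T] (fun t => ip l (u t) psi).
  by apply: continuous_compact_integrable => //; exact: segment_compact.
have Fi : rint (Ioo T) (fun t => ip l (u t) psi) by exact: rintS FiT.
have wd : weak_deriv T (fun t => ip l (u t) psi) H.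
  split; [exact: open_integrable_locally|exact: open_integrable_locally|].
  move=> theta tt; have [w wu wut] := uut theta tt.
  have wL : L2 l w by case: wu.
  have thm D : measurable_fun D theta.
    apply: measurable_funTS; apply: continuous_measurable_fun => x.
    apply: differentiable_continuous; apply/derivable1_diffP; case: tt => h _; exact: (h 0%N x).
  have thm' D : measurable_fun D (derive1 theta).
    apply: measurable_funTS; apply: continuous_measurable_fun => x.
    apply: differentiable_continuous; apply/derivable1_diffP; case: tt => h _; exact: (h 1%N x).
  have [] := @bochner_integral_ip _ l T _ _ psi (fun t => ip l (u t) psi * derive1 theta t) wu.
  - by apply: aeW => t tT; apply: L2Z; case: (uc t) => //; exact: Tcc.
  - exact: pL.
  - by apply: measurable_funM => //; exact: rint_meas.
  - apply: aeW => t tT; rewrite ipZl 1?mulrC//; by case: (uc t) => //; exact: Tcc.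
  move=> _ ->.
  have [] := @bochner_integral_ip _ l T _ _ psi (fun t => H t * theta t) wut.
  - by apply: aeS utL => t + tT => /(_ tT) h; exact: L2Z.
  - exact: pL.
  - exact: measurable_funM.
  - apply: aeS2 utL Hut => t h1 h2 tT.
    by rewrite ipZl ?h2 1?mulrC//; exact: h1.
  by move=> _ ->; rewrite ipNl// opprK.
move=> s t s0 st tT.
have lp x : 0 < x -> x < T -> lebesgue_pt (fun t => ip l (u t) psi) x.
  move=> x0 xT; have xD : Ioo T x by rewrite /= in_itv/= x0.
  apply: (@continuous_lebesgue_pt _ _ _ (Ioo T)) => //.
  - exact: rint_meas.
  - have /(continuous_within_itvP _ (lt_trans x0 xT))[Fo _ _] := Fc.
    by apply: Fo; rewrite in_itv/= x0.
apply: (weak_deriv_increment wd) => //; apply: lp => //.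
  exact: le_lt_trans tT.
exact: lt_le_trans st.
Qed.

Lemma itv_oc_split (a b c : R) (g : R -> R) : a <= b -> b <= c -> rint `]a, c] g ->
  \int[mu]_(x in `]a, c]) g x = \int[mu]_(x in `]a, b]) g x + \int[mu]_(x in `]b, c]) g x.
Proof.
move=> ab bc gi; apply/eqP; rewrite addrC -subr_eq; apply/eqP.
by apply: Rintegral_itvB; rewrite ?bnd_simp.
Qed.

Lemma fine_mu_itv_oc (s t : R) : s <= t -> fine (mu `]s, t]) = t - s.
Proof.
rewrite lebesgue_measure_itv/= lte_fin le_eqVlt => /predU1P[->|->].
  by rewrite ltxx subrr.
by rewrite -EFinB.
Qed.

(** The inequality on short intervals telescopes over n + 1 equal steps of length at most d. *)
Lemma sum_increments_le (a b : R) (phi g : R -> R) d : 0 < d -> a <= b -> rint `]a, b] g ->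
  (forall s t, a <= s -> s <= t -> t <= b -> t - s <= d ->
     phi t - phi s <= \int[mu]_(x in `]s, t]) g x) ->
  phi b - phi a <= \int[mu]_(x in `]a, b]) g x.
Proof.
move=> d0 ab gi H.
have [n hn] : exists n : nat, b - a <= n.+1%:R * d.
  exists (Num.truncn ((b - a) / d)); rewrite -ler_pdivrMr//.
  by apply: ltW; apply: truncnS_gt.
pose h := (b - a) / n.+1%:R.
have n0 : 0 < n.+1%:R :> R by rewrite ltr0n.
have h0 : 0 <= h by rewrite divr_ge0 ?subr_ge0// ltW.
have hd : h <= d by rewrite ler_pdivrMr// mulrC.
have nh : n.+1%:R * h = b - a by rewrite /h mulrC divfK// gt_eqF.
suff K k : (k <= n.+1)%N ->
    phi (a + k%:R * h) - phi a <= \int[mu]_(x in `]a, (a + k%:R * h)]) g x.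
  have E : a + (b - a) = b by ring.
  by have := K n.+1 (leqnn _); rewrite nh E.
elim: k => [_|k IH kn].
  by rewrite mul0r addr0 subrr set_itv_ge ?bnd_simp ?ltxx// Rintegral_set0.
have kh0 : 0 <= k%:R * h by rewrite mulr_ge0.
have kb : a + k.+1%:R * h <= b.
  by rewrite -lerBrDl -nh ler_wpM2r// ler_nat.
have kk : a + k%:R * h <= a + k.+1%:R * h by rewrite lerD2l ler_wpM2r// ler_nat.
rewrite (@itv_oc_split a (a + k%:R * h))//; last 2 first.
- by rewrite lerDl.
- by apply: rintS gi => //; apply: subset_itvl; rewrite bnd_simp.
have -> : phi (a + k.+1%:R * h) - phi a =
  (phi (a + k%:R * h) - phi a) + (phi (a + k.+1%:R * h) - phi (a + k%:R * h)) by ring.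
apply: lerD; first exact/IH/ltnW.
apply: H => //; first by rewrite lerDl.
by rewrite -natr1 mulrDl mul1r; lra.
Qed.

(* No chain rule for |w|^2: over a short interval [p, q] the increment of |w|^2 is
   the integral of <w', w(p) + w(q)>, which uniform continuity of w compares with
   2 <w', w>; the increments are then summed over a fine partition. *)
Lemma energy_increment l T (w wt : R -> R -> R) (M : R -> R) (c s t : R) :
  L2_continuous l T w -> has_increments l T w wt -> rint (Ioo T) M ->
  {ae mu, forall t, Ioo T t -> L2 l (wt t) /\ nrm l (wt t) <= M t} ->
  {ae mu, forall t, Ioo T t -> ip l (wt t) (w t) <= c} ->
  0 < s -> s <= t -> t < T ->
  nrm l (w t) ^+ 2 - nrm l (w s) ^+ 2 <= 2 * c * (t - s).
Proof.
move=> wc winc Mi wtM wtc s0 st tT.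
have stT : `]s, t]%classic `<=` Ioo T by apply: subset_itv; rewrite bnd_simp// ltW.
have inT x : s <= x -> x <= t -> x \in `[0, T].
  by move=> sx xt; rewrite in_itv/= (le_trans (ltW s0) sx) (le_trans xt (ltW tT)).
have wL x : s <= x -> x <= t -> L2 l (w x) by move=> sx xt; case: (wc x) => //; exact: inT.
(* The integral that multiplies e does not depend on e, so e may tend to 0. *)
suff K e : 0 < e -> nrm l (w t) ^+ 2 - nrm l (w s) ^+ 2 <=
    2 * c * (t - s) + e * (2 * \int[mu]_(x in `]s, t]) M x).
  apply/ler_addgt0Pl => e e0; set I := \int[mu]_(_ in _) _ in K.
  have I0 : 0 < 2 * `|I| + 1 by rewrite ltr_wpDl// mulr_ge0.
  apply: (le_trans (K (e / (2 * `|I| + 1)) _)); first by rewrite divr_gt0.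
  rewrite addrC lerD2r mulrAC ler_pdivrMr// ler_pM2l//.
  by rewrite (le_trans (_ : _ <= 2 * `|I|)) ?lerDl// ler_pM2l// ler_norm.
move=> e0; have [d d0 hd] := L2_unif_continuous wc e0.
have Ms : rint `]s, t] M by exact: rintS Mi.
have cs : rint `]s, t] (fun=> 2 * c).
  by apply: (@rint_bounded _ _ _ `|2 * c|) => //; exact: mu_itv_lty.
have gi : rint `]s, t] (fun x => 2 * c + e * (2 * M x)).
  by apply: rintD => //; apply: rintZl => //; exact: rintZl.
suff : nrm l (w t) ^+ 2 - nrm l (w s) ^+ 2 <= \int[mu]_(x in `]s, t]) (2 * c + e * (2 * M x)).
  rewrite RintegralD//; last by apply: rintZl => //; exact: rintZl.
  rewrite Rintegral_cst// RintegralZl//; last exact: rintZl.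
  rewrite fine_mu_itv_oc//.
  by rewrite (RintegralZl _ _ Ms).
apply: (@sum_increments_le s t (fun x => nrm l (w x) ^+ 2) _ d) => //.
move=> p q sp pq qt qpd.
have qT : q < T by exact: le_lt_trans tT.
have p0 : 0 < p by exact: lt_le_trans sp.
have pqT : `]p, q]%classic `<=` Ioo T.
  by apply: subset_itv; rewrite bnd_simp// ltW.
have wpL : L2 l (w p) by apply: wL => //; exact: le_trans qt.
have wqL : L2 l (w q) by apply: wL => //; exact: le_trans pq.
have psL : L2 l (fun x => w q x + w p x) by exact: L2D.
have [H [Hi Hwt Hw]] := winc _ psL.
have -> : nrm l (w q) ^+ 2 - nrm l (w p) ^+ 2 =
    ip l (w q) (fun x => w q x + w p x) - ip l (w p) (fun x => w q x + w p x).
  by rewrite -!ip_sq !ipDr// [ip l (w p) (w q)]ipC; ring.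
rewrite Hw//; apply: le_Rintegral_ae => //.
- exact: rintS Hi.
- by apply: rintS gi => //; apply: subset_itv; rewrite bnd_simp.
have W := aeS2 (fun x (h1 : Ioo T x -> H x = _) (h2 : Ioo T x -> _ /\ _) => conj h1 h2) Hwt wtM.
apply: aeS2 W wtc => x [h1 h2] h3 xpq; have xT := pqT _ xpq.
rewrite h1//; have {h2}[wtxL wtxM] := h2 xT; have {}h3 := h3 xT.
have /andP[px xq] : p < x <= q by move: xpq; rewrite /= in_itv.
have sx : s <= x by rewrite (le_trans sp)// ltW.
have xt : x <= t by rewrite (le_trans xq).
have wxL : L2 l (w x) := wL _ sx xt.
have dq : nrm l (fun y => w q y - w x y) <= e.
  apply: hd; [exact: inT (le_trans sp pq) qt|exact: inT|].
  by rewrite ger0_norm ?subr_ge0//; lra.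
have dp : nrm l (fun y => w p y - w x y) <= e.
  apply: hd; [exact: inT sp (le_trans pq qt)|exact: inT|].
  by rewrite distrC ger0_norm ?subr_ge0; [lra|exact: ltW].
have M0 : 0 <= M x by rewrite (le_trans _ wtxM)// nrm_ge0.
(* Replacing w q and w p by w x costs at most e M x each. *)
have cs1 z : L2 l z -> nrm l z <= e -> ip l (wt x) z <= M x * e.
  move=> zL ze; apply: le_trans (ler_norm _) _; apply: le_trans (cauchy_schwarz _ _) _ => //.
  by apply: ler_pM; rewrite ?nrm_ge0.
have := cs1 _ (L2B wqL wxL) dq; have := cs1 _ (L2B wpL wxL) dp.
by rewrite !ipBr// ipDr//; lra.
Qed.

(** [energy_increment] covers the open interval: there f is nonincreasing. The one-sided continuity
    of the norm at 0 and at T carries the inequality to the endpoints. *)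
Lemma energy_bound l T (w wt : R -> R -> R) (M : R -> R) (c : R) : 0 < T ->
  L2_continuous l T w -> has_increments l T w wt -> rint (Ioo T) M ->
  {ae mu, forall t, Ioo T t -> L2 l (wt t) /\ nrm l (wt t) <= M t} ->
  {ae mu, forall t, Ioo T t -> ip l (wt t) (w t) <= c} ->
  nrm l (w T) ^+ 2 <= nrm l (w 0) ^+ 2 + 2 * c * T.
Proof.
move=> T0 wc winc Mi wtM wtc.
pose f x := nrm l (w x) ^+ 2 - 2 * c * x.
have /(continuous_within_itvP _ T0)[_ n0 nT] := L2_continuous_nrm wc.
have f0 : f x @[x --> 0^'+] --> f 0.
  apply: cvgB; first by rewrite expr2; under eq_fun do rewrite expr2; exact: cvgM.
  by apply: cvgM; [exact: cvg_cst|apply: cvg_at_right_filter; exact: cvg_id].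
have fT : f x @[x --> T^'-] --> f T.
  apply: cvgB; first by rewrite expr2; under eq_fun do rewrite expr2; exact: cvgM.
  by apply: cvgM; [exact: cvg_cst|apply: cvg_at_left_filter; exact: cvg_id].
have fle s t : 0 < s -> s <= t -> t < T -> f t <= f s.
  by move=> s0 st tT; have := energy_increment wc winc Mi wtM wtc s0 st tT; rewrite /f; lra.
have f0le t : 0 < t -> t < T -> f t <= f 0.
  move=> t0 tT; apply: (ler_cvg_to (cvg_cst (f t)) f0); near=> s.
  have s0 : 0 < s by near: s; exact: nbhs_right_gt.
  have st : s <= t by near: s; exact: nbhs_right_le.
  exact: fle.
have : f T <= f 0.
  apply: (ler_cvg_to fT (cvg_cst (f 0))); near=> t.
  have t0 : 0 < t by near: t; exact: nbhs_left_gt.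
  have tT : t < T by near: t; exact: nbhs_left_lt.
  exact: f0le.
by rewrite /f; lra.
Unshelve. all: by end_near. Qed.

End energy.

(** * Test functions and weak gradients *)

Section gradients.
Context {R : realType}.
Notation mu := (@lebesgue_measure R).
Implicit Types (b l : R) (f g h v w : R -> R).

Lemma derive1n_lin (c1 c2 : R) v w :
  (forall n x, derivable (derive1n n v) x 1) -> (forall n x, derivable (derive1n n w) x 1) ->
  forall n x, is_derive x (1 : R) (derive1n n (fun x => c1 * v x + c2 * w x))
    (c1 * derive1n n.+1 v x + c2 * derive1n n.+1 w x) /\
    derive1n n (fun x => c1 * v x + c2 * w x) x = c1 * derive1n n v x + c2 * derive1n n w x.
Proof.
move=> dv dw.
have D n x : is_derive x (1 : R) (fun x => c1 * derive1n n v x + c2 * derive1n n w x)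
    (c1 * derive1n n.+1 v x + c2 * derive1n n.+1 w x).
  have d1 : is_derive x (1 : R) (derive1n n v) (derive1n n.+1 v x).
    by rewrite derive1nS derive1E; apply: derivableP; exact: dv.
  have d2 : is_derive x (1 : R) (derive1n n w) (derive1n n.+1 w x).
    by rewrite derive1nS derive1E; apply: derivableP; exact: dw.
  exact: is_deriveD (is_deriveZ c1 d1) (is_deriveZ c2 d2).
have E n : derive1n n (fun x => c1 * v x + c2 * w x) =
    fun x => c1 * derive1n n v x + c2 * derive1n n w x.
  elim: n => [//|n IH]; apply/funext => x.
  by rewrite derive1nS IH derive1E; case: (D n x).
by move=> n x; rewrite E; split.
Qed.

Lemma test_fun_lin b (c1 c2 : R) v w : test_fun b v -> test_fun b w ->
  test_fun b (fun x => c1 * v x + c2 * w x).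
Proof.
move=> [dv [c [d [c0 db v0]]]] [dw [c' [d' [c0' db' w0]]]]; split.
  by move=> n x; have [[]] := derive1n_lin c1 c2 dv dw n x.
exists (Num.min c c'), (Num.max d d'); split.
- by rewrite lt_min c0.
- by rewrite gt_max db.
- move=> x; rewrite in_itv/= ge_min le_max => xcd.
  rewrite v0 ?w0 ?mulr0 ?addr0//; apply: contra xcd; rewrite in_itv/= => /andP[-> ->];
  by rewrite ?orbT.
Qed.

Lemma test_fun_derive1 b v : test_fun b v -> test_fun b (derive1 v).
Proof.
move=> [dv [c [d [c0 db v0]]]]; split; first by move=> n x; rewrite -derive1Sn; exact: dv.
exists c, d; split => // x xcd; rewrite derive1E.
have /@near_eq_derive -> // : \near x, v x = cst 0 x.
  move: xcd; rewrite in_itv/= negb_and -!ltNge => /orP[xc|dx].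
    near=> y; rewrite v0// in_itv/= negb_and -!ltNge; apply/orP; left.
    by near: y; exact: lt_nbhsl.
  near=> y; rewrite v0// in_itv/= negb_and -!ltNge; apply/orP; right.
  by near: y; exact: lt_nbhsr.
by rewrite derive_val.
Unshelve. all: by end_near. Qed.

Lemma test_fun_continuous b v : test_fun b v -> continuous v.
Proof.
move=> [dv _] x; apply: differentiable_continuous; apply/derivable1_diffP.
exact: (dv 0%N x).
Qed.

Lemma test_fun_bounded b v : test_fun b v -> exists C, forall x, `|v x| <= C.
Proof.
move=> vt; have cv := test_fun_continuous vt; have [_ [c [d [c0 db v0]]]] := vt.
have [cd|dc] := leP c d; last first.
  exists 0 => x; rewrite v0 ?normr0// in_itv/=; apply/negP => /andP[cx xd].
  by have := le_trans cx xd; rewrite leNgt dc.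
have : {within `[c, d], continuous (fun x => `|v x|)}.
  by apply: continuous_subspaceT => x; apply: continuous_comp; [exact: cv|exact: norm_continuous].
move=> /(EVT_max cd)[z _ vz]; exists `|v z| => x.
have [xcd|xcd] := boolP (x \in `[c, d]); first exact: vz.
by rewrite v0// normr0.
Qed.

Lemma test_fun_L2 b v : test_fun b v -> L2 b v.
Proof.
move=> vt; have [C hC] := test_fun_bounded vt.
apply: (@L2_bounded _ _ _ C); last by apply: aeW => x _.
apply: measurable_funTS; apply: continuous_measurable_fun; exact: test_fun_continuous vt.
Qed.

Lemma L2_rint b f : L2 b f -> rint (Ioo b) f.
Proof.
move=> /L2P[mf f2]; apply: (@rint_le _ _ _ (fun x => f x ^+ 2 + 1)) => //.
  by move=> x _; rewrite ler_norml; apply/andP; split; nra.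
apply: rintD => //; apply: (@rint_bounded _ _ _ 1) => //; first exact: mu_itv_lty.
by move=> x _; rewrite normr1.
Qed.

Lemma L2_locally b f : L2 b f -> locally_integrable (Ioo b) f.
Proof. by move=> /L2_rint fi; apply: open_integrable_locally. Qed.

Lemma Rintegral_derive b (F f : R -> R) : 0 < b -> (forall x, is_derive x (1 : R) F (f x)) ->
  continuous f -> \int[mu]_(x in Ioo b) f x = F b - F 0.
Proof.
move=> b0 DF cf.
have cfw : {within `[0, b], continuous f} by exact: continuous_subspaceT.
have fi : rint `[0, b] f.
  by apply: continuous_compact_integrable => //; exact: segment_compact.
have cF x : {for x, continuous F}.
  by apply: differentiable_continuous; apply/derivable1_diffP; case: (DF x).
rewrite Rintegral_itv_obnd_cbnd; last first.
  by apply: (@rintS _ `[0, b]%classic) => //; exact: subset_itv_oo_cc.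
rewrite Rintegral_itv_bndo_bndc; last first.
  by apply: (@rintS _ `[0, b]%classic) => //; apply: subset_itvl; rewrite bnd_simp.
rewrite /Rintegral (continuous_FTC2 (F := F))//.
- split.
  + by move=> x _; case: (DF x).
  + by apply: cvg_at_right_filter; exact: cF.
  + by apply: cvg_at_left_filter; exact: cF.
- by move=> x _; rewrite derive1E; case: (DF x).
Qed.

Lemma test_fun0 b v x : test_fun b v -> x \notin `]0, b[ -> v x = 0.
Proof.
move=> [_ [c [d [c0 db v0]]]] xb; apply: v0; apply: contra xb.
by rewrite !in_itv/= => /andP[cx xd]; rewrite (lt_le_trans c0 cx) (le_lt_trans xd db).
Qed.

Lemma is_derive_test b v x : test_fun b v -> is_derive x (1 : R) v (derive1 v x).
Proof. by move=> [dv _]; rewrite derive1E; apply: derivableP; exact: (dv 0%N x). Qed.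

Lemma integral_derive1_test b v : 0 < b -> test_fun b v ->
  \int[mu]_(x in Ioo b) derive1 v x = 0.
Proof.
move=> b0 vt; have cv := test_fun_continuous (test_fun_derive1 vt).
rewrite (Rintegral_derive b0 (fun x => is_derive_test x vt) cv).
by rewrite !(test_fun0 vt) ?subrr// in_itv/= ltxx ?andbF.
Qed.

(** Integration by parts: the product of two test functions vanishes at 0 and b. *)
Lemma weak_deriv_test b v : 0 < b -> test_fun b v -> weak_deriv b v (derive1 v).
Proof.
move=> b0 vt; have v't := test_fun_derive1 vt.
split; [exact/L2_locally/test_fun_L2|exact/L2_locally/test_fun_L2|].
move=> w wt; have w't := test_fun_derive1 wt.
have vL := test_fun_L2 vt; have v'L := test_fun_L2 v't.
have wL := test_fun_L2 wt; have w'L := test_fun_L2 w't.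
apply/eqP; rewrite -addr_eq0 -RintegralD//; [|exact: rintM..].
have D x : is_derive x (1 : R) (v * w) (v x * derive1 w x + derive1 v x * w x).
  apply: is_derive_eq (is_deriveM (is_derive_test x vt) (is_derive_test x wt)) _.
  by rewrite /GRing.scale/= [w x * _]mulrC.
have c : continuous (fun x => v x * derive1 w x + derive1 v x * w x).
  move=> x; have h1 : {for x, continuous v} := @test_fun_continuous b v vt x.
  have h2 : {for x, continuous (derive1 v)} := @test_fun_continuous b _ v't x.
  have h3 : {for x, continuous w} := @test_fun_continuous b w wt x.
  have h4 : {for x, continuous (derive1 w)} := @test_fun_continuous b _ w't x.
  exact: (cvgD (cvgM h1 h4) (cvgM h2 h3)).
rewrite (Rintegral_derive b0 D c) !fctE/= !(test_fun0 vt) ?mul0r ?subrr//.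
- by rewrite in_itv/= ltxx.
- by rewrite in_itv/= ltxx andbF.
Qed.

Lemma weak_derivB b f g h k : weak_deriv b f h -> weak_deriv b g k ->
  weak_deriv b (fun x => f x - g x) (fun x => h x - k x).
Proof.
move=> [fi hi fh] [gi ki gk]; split; [exact: locally_integrableB|exact: locally_integrableB|].
move=> v vt; have v't := test_fun_derive1 vt.
rewrite (_ : \int[mu]_(x in Ioo b) ((f x - g x) * derive1 v x) =
  \int[mu]_(x in Ioo b) (f x * derive1 v x - g x * derive1 v x)); last first.
  by apply: eq_Rintegral => x _; rewrite mulrBl.
rewrite (_ : \int[mu]_(x in Ioo b) ((h x - k x) * v x) =
  \int[mu]_(x in Ioo b) (h x * v x - k x * v x)); last first.
  by apply: eq_Rintegral => x _; rewrite mulrBl.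
by rewrite !RintegralB//; [rewrite fh// gk//; ring|exact: rint_test..].
Qed.

Lemma gradP b f : weakly_differentiable b f -> weak_deriv b f (grad b f).
Proof. by move=> wf; rewrite /grad; apply: (xgetPex (cst 0) wf). Qed.

Lemma grad_ae b f h : weak_deriv b f h -> {ae mu, forall x, Ioo b x -> grad b f x = h x}.
Proof. by move=> fh; exact: (weak_deriv_unique (gradP (ex_intro _ h fh)) fh). Qed.

Lemma gradB_ae b f g : weakly_differentiable b f -> weakly_differentiable b g ->
  {ae mu, forall x, Ioo b x -> grad b (fun x => f x - g x) x = grad b f x - grad b g x}.
Proof. by move=> wf wg; apply: grad_ae; apply: weak_derivB; exact: gradP. Qed.

Lemma weakly_differentiableB b f g : weakly_differentiable b f -> weakly_differentiable b g ->
  weakly_differentiable b (fun x => f x - g x).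
Proof. by move=> [h fh] [k gk]; exists (fun x => h x - k x); exact: weak_derivB. Qed.

Lemma grad_meas b f : weakly_differentiable b f -> measurable_fun (Ioo b) (grad b f).
Proof. by move=> /gradP[_ [? _ _] _]. Qed.

Lemma wdiff_meas b f : weakly_differentiable b f -> measurable_fun (Ioo b) f.
Proof. by move=> /gradP[[? _ _] _ _]. Qed.

(** * The degenerate weighted space *)

Section weighted.
Variables (l : R) (a : R -> R).
Hypotheses (l0 : 0 < l) (ac : {within `[0, l], continuous a})
  (apos : forall x, x \in `]0, l[ -> 0 < a x).

Lemma weight_bounded : exists A, forall x, Ioo l x -> `|a x| <= A.
Proof.
have : {within `[0, l], continuous (fun x => `|a x|)}.
  by move=> x; apply: continuous_comp; [exact: ac|exact: norm_continuous].
move=> /(EVT_max (ltW l0))[z _ hz]; exists `|a z| => x xl.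
by apply: hz; apply: subset_itv_oo_cc.
Qed.

Lemma weight_measurable : measurable_fun (Ioo l) a.
Proof.
have ai : rint `[0, l] a.
  by apply: continuous_compact_integrable => //; exact: segment_compact.
by apply: measurable_funS (rint_meas ai) => //; exact: subset_itv_oo_cc.
Qed.

Definition wdens v x : R := a x * (v x ^+ 2 + grad l v x ^+ 2).

Lemma wdens_ge0 v x : Ioo l x -> 0 <= wdens v x.
Proof. by move=> xl; rewrite mulr_ge0 ?addr_ge0 ?sqr_ge0// ltW// apos. Qed.

Lemma wdens_meas v : weakly_differentiable l v -> measurable_fun (Ioo l) (wdens v).
Proof.
move=> wv; apply: measurable_funM; first exact: weight_measurable.
by apply: measurable_funD; apply: measurable_funX; [exact: wdiff_meas|exact: grad_meas].
Qed.

Lemma wH1normE v : wH1norm l a v = ((\int[mu]_(x in Ioo l) (wdens v x)%:E) `^ 2^-1)%E.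
Proof.
rewrite /wH1norm; congr (_ `^ _)%E; apply: eq_integral => x _.
by rewrite /wdens !real_normK ?num_real.
Qed.

Lemma wH1norm_lty v : weakly_differentiable l v ->
  (wH1norm l a v < +oo)%E <-> rint (Ioo l) (wdens v).
Proof.
move=> wv; rewrite wH1normE.
have E : (\int[mu]_(x in Ioo l) (wdens v x)%:E =
    \int[mu]_(x in Ioo l) `|(wdens v x)%:E|)%E.
  by apply: eq_integral => x /[!inE] xl; rewrite gee0_abs// lee_fin wdens_ge0.
split => [h|/integrableP[_ h]].
  apply/integrableP; split; first by apply/measurable_EFinP; exact: wdens_meas.
  rewrite -E; move: h; apply: contraTT; rewrite -!leNgt !leye_eq => /eqP ->.
  by rewrite poweRyr// invr_eq0.
by apply: poweR_lty; rewrite E.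
Qed.

Lemma wH1norm_sqrt v : rint (Ioo l) (wdens v) ->
  wH1norm l a v = (Num.sqrt (\int[mu]_(x in Ioo l) wdens v x))%:E.
Proof.
move=> vi; rewrite wH1normE rint_ereal// poweR_EFin powR12_sqrt//.
by apply: Rintegral_ge0 => x; exact: wdens_ge0.
Qed.

Lemma wdensB_ae v w : weakly_differentiable l v -> weakly_differentiable l w ->
  {ae mu, forall x, Ioo l x ->
    wdens (fun x => v x - w x) x <= 2 * wdens v x + 2 * wdens w x}.
Proof.
move=> wv ww; apply: aeS (gradB_ae wv ww) => x + xl => /(_ xl) gE.
rewrite /wdens gE; have := apos xl; set A := a x => A0.
have -> : 2 * (A * (v x ^+ 2 + grad l v x ^+ 2)) + 2 * (A * (w x ^+ 2 + grad l w x ^+ 2)) =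
  A * (2 * (v x ^+ 2 + grad l v x ^+ 2) + 2 * (w x ^+ 2 + grad l w x ^+ 2)) by ring.
rewrite ler_pM2l//; have H (p q : R) : (p - q) ^+ 2 <= 2 * p ^+ 2 + 2 * q ^+ 2.
  by have := sqr_ge0 (p + q); nra.
by have := H (v x) (w x); have := H (grad l v x) (grad l w x); lra.
Qed.

Lemma rint_wdensB v w : weakly_differentiable l v -> weakly_differentiable l w ->
  rint (Ioo l) (wdens v) -> rint (Ioo l) (wdens w) ->
  rint (Ioo l) (wdens (fun x => v x - w x)) /\
  \int[mu]_(x in Ioo l) wdens (fun x => v x - w x) x <=
  2 * \int[mu]_(x in Ioo l) wdens v x + 2 * \int[mu]_(x in Ioo l) wdens w x.
Proof.
move=> wv ww vi wi; have wvw := weakly_differentiableB wv ww.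
have si : rint (Ioo l) (fun x => 2 * wdens v x + 2 * wdens w x).
  by apply: rintD => //; exact: rintZl.
have di : rint (Ioo l) (wdens (fun x => v x - w x)).
  apply: rint_ae si => //; first exact: wdens_meas.
  by apply: aeS (wdensB_ae wv ww) => x + xl => /(_ xl); rewrite ger0_norm// wdens_ge0.
split; first exact: di.
apply: le_trans (le_Rintegral_ae _ di si (wdensB_ae wv ww)) _; first by [].
rewrite (RintegralD _ (rintZl 2 _ vi) (rintZl 2 _ wi))//.
by rewrite (RintegralZl _ _ vi)// (RintegralZl _ _ wi).
Qed.

Lemma test_fun_wdiff v : test_fun l v -> weakly_differentiable l v.
Proof. by move=> vt; exists (derive1 v); exact: weak_deriv_test. Qed.

Lemma test_fun_wdens v : test_fun l v -> rint (Ioo l) (wdens v).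
Proof.
move=> vt; have v't := test_fun_derive1 vt; have [A hA] := weight_bounded.
have [C hC] := test_fun_bounded vt; have [C' hC'] := test_fun_bounded v't.
apply: (@rint_ae _ _ _ (fun=> A * (C ^+ 2 + C' ^+ 2))) => //.
- by apply: wdens_meas; exact: test_fun_wdiff.
- apply: aeS (grad_ae (weak_deriv_test l0 vt)) => x + xl => /(_ xl) gE.
  rewrite /wdens gE normrM; apply: ler_pM => //; first exact: hA.
  rewrite ger0_norm ?addr_ge0 ?sqr_ge0//.
  have H (p q : R) : `|p| <= q -> p ^+ 2 <= q ^+ 2.
    by move=> pq; rewrite -real_normK ?num_real// lerXn2r ?nnegrE// (le_trans _ pq).
  by apply: lerD; exact: H.
- by apply: (@rint_bounded _ _ _ `|A * (C ^+ 2 + C' ^+ 2)|) => //; exact: mu_itv_lty.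
Qed.

Lemma wH1_wdens v : wH1 l a v -> rint (Ioo l) (wdens v).
Proof.
move=> [wv [w wt /fine_cvgP[wfin _]]].
have [N _ /(_ N (leqnn N)) wN] := wfin.
have wwN := test_fun_wdiff (wt N).
have wvw : weakly_differentiable l (v \- w N) by exact: weakly_differentiableB.
have vwi : rint (Ioo l) (wdens (v \- w N)).
  by apply/wH1norm_lty => //; rewrite ltey_eq wN.
(* To reuse [rint_wdensB], v is written as the difference of v - w N and - w N; the coefficients -1
   and 0 exhibit - w N as a test function. *)
have Nwt := test_fun_lin (-1) 0 (wt N) (wt N).
have -> : v = fun x => (v \- w N) x - (-1 * w N x + 0 * w N x).
  by apply/funext => x /=; ring.
by have [] := rint_wdensB wvw (test_fun_wdiff Nwt) vwi (test_fun_wdens Nwt).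
Qed.

(** The bound (p - q)^2 <= 2 p^2 + 2 q^2 stands in for the triangle inequality: two squares (e /
    2)^2, each doubled, add up to e^2. *)
Lemma wH1norm_dist0B v w e : weakly_differentiable l v -> weakly_differentiable l w ->
  rint (Ioo l) (wdens v) -> rint (Ioo l) (wdens w) -> 0 < e ->
  `|0 - fine (wH1norm l a v)| <= e / 2 -> `|0 - fine (wH1norm l a w)| <= e / 2 ->
  `|0 - fine (wH1norm l a (fun x => v x - w x))| <= e.
Proof.
have arith (p q r : R) : r <= 2 * p + 2 * q -> p <= (e / 2) ^+ 2 -> q <= (e / 2) ^+ 2 ->
    r <= e ^+ 2 by lra.
move=> wv ww vi wi e0; have [i3 le3] := rint_wdensB wv ww vi wi.
have p f : 0 <= \int[mu]_(x in Ioo l) wdens f x by apply: Rintegral_ge0 => x; exact: wdens_ge0.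
have F f : rint (Ioo l) (wdens f) -> `|0 - fine (wH1norm l a f)| =
    Num.sqrt (\int[mu]_(x in Ioo l) wdens f x).
  by move=> fi; rewrite (wH1norm_sqrt fi)/= sub0r normrN ger0_norm// sqrtr_ge0.
have G f : Num.sqrt (\int[mu]_(x in Ioo l) wdens f x) <= e / 2 ->
    \int[mu]_(x in Ioo l) wdens f x <= (e / 2) ^+ 2.
  by move=> h; rewrite -[leLHS]sqr_sqrtr ?p// lerXn2r ?nnegrE ?sqrtr_ge0// divr_ge0// ltW.
move=> k1 k2; have /G h1 : Num.sqrt (\int[mu]_(x in Ioo l) wdens v x) <= e / 2.
  rewrite -(F _ vi); exact: k1.
have /G h2 : Num.sqrt (\int[mu]_(x in Ioo l) wdens w x) <= e / 2.
  rewrite -(F _ wi); exact: k2.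
rewrite (F _ i3).
rewrite -[leRHS]ger0_norm ?(ltW e0)// -sqrtr_sqr ler_wsqrtr//.
exact: arith le3 h1 h2.
Qed.

Lemma wH1B v1 v2 : wH1 l a v1 -> wH1 l a v2 -> wH1 l a (fun x => v1 x - v2 x).
Proof.
move=> [wv1 [w1 w1t c1]] [wv2 [w2 w2t c2]]; split; first exact: weakly_differentiableB.
have wt n : test_fun l (fun x => w1 n x - w2 n x).
  have -> : (fun x => w1 n x - w2 n x) = (fun x => 1 * w1 n x + (-1) * w2 n x).
    by apply/funext => x; ring.
  exact: test_fun_lin.
exists (fun n x => w1 n x - w2 n x); first exact: wt.
move: c1 c2 => /fine_cvgP[f1 c1] /fine_cvgP[f2 c2].
have d1 n : weakly_differentiable l (v1 \- w1 n).
  by apply: weakly_differentiableB => //; exact: test_fun_wdiff.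
have d2 n : weakly_differentiable l (v2 \- w2 n).
  by apply: weakly_differentiableB => //; exact: test_fun_wdiff.
have E n : (fun x => v1 x - v2 x) \- (fun x => w1 n x - w2 n x) =
    fun x => (v1 \- w1 n) x - (v2 \- w2 n) x.
  by apply/funext => x /=; ring.
apply/fine_cvgP; split.
  apply: filterS2 f1 f2 => n f1 f2; rewrite E.
  have i1 : rint (Ioo l) (wdens (v1 \- w1 n)) by apply/wH1norm_lty => //; rewrite ltey_eq f1.
  have i2 : rint (Ioo l) (wdens (v2 \- w2 n)) by apply/wH1norm_lty => //; rewrite ltey_eq f2.
  by have [i3 _] := rint_wdensB (d1 n) (d2 n) i1 i2; rewrite wH1norm_sqrt.
apply/cvgrPdist_le => e e0; have e2 : 0 < e / 2 by rewrite divr_gt0.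
have /cvgrPdist_le/(_ _ e2) c1' := c1; have /cvgrPdist_le/(_ _ e2) c2' := c2.
apply: filterS2 (filterI f1 c1') (filterI f2 c2') => n [{}f1 h1] [{}f2 h2]; move: h1 h2; rewrite /= E.
have i1 : rint (Ioo l) (wdens (v1 \- w1 n)) by apply/wH1norm_lty => //; rewrite ltey_eq f1.
have i2 : rint (Ioo l) (wdens (v2 \- w2 n)) by apply/wH1norm_lty => //; rewrite ltey_eq f2.
by move=> h1 h2; exact: (wH1norm_dist0B (d1 n) (d2 n) i1 i2 e0 h1 h2).
Qed.

End weighted.

End gradients.

(** * Dependence of the solution on the coefficient *)

Section stability.
Context {R : realType}.
Notation mu := (@lebesgue_measure R).

Lemma rint_weightM (l : R) (a f g : R -> R) : measurable_fun (Ioo l) a ->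
  (forall x, x \in `]0, l[ -> 0 < a x) ->
  measurable_fun (Ioo l) f -> measurable_fun (Ioo l) g ->
  rint (Ioo l) (fun x => a x * f x ^+ 2) -> rint (Ioo l) (fun x => a x * g x ^+ 2) ->
  rint (Ioo l) (fun x => a x * f x * g x).
Proof.
move=> ma a0 mf mg fi gi.
apply: (@rint_le _ _ _ (fun x => a x * f x ^+ 2 + a x * g x ^+ 2)) => //.
- by apply: measurable_funM => //; exact: measurable_funM.
- move=> x xl; rewrite -mulrA normrM (gtr0_norm (a0 _ xl)) -mulrDr ler_pM2l ?a0//.
  by rewrite ler_norml; apply/andP; split; nra.
- exact: rintD.
Qed.

Lemma rint_wgrad (l : R) (a v : R -> R) : 0 < l -> {within `[0, l], continuous a} ->
  (forall x, x \in `]0, l[ -> 0 < a x) -> wH1 l a v ->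
  rint (Ioo l) (fun x => a x * grad l v x ^+ 2).
Proof.
move=> l0 ac a0 vH; have vi := wH1_wdens l0 ac a0 vH; have [wv _] := vH.
have ma := weight_measurable ac.
apply: (@rint_le _ _ _ (wdens l a v)) => //.
- by apply: measurable_funM => //; apply: measurable_funX; exact: grad_meas.
- move=> x xl; rewrite /wdens ger0_norm ?ler_pM2l ?a0// ?lerDr ?sqr_ge0//.
  by rewrite mulr_ge0 ?sqr_ge0// ltW// a0.
Qed.

Lemma admissible_meas (l alpha beta : R) (q : R -> R) : admissible l alpha beta q ->
  measurable_fun (Ioo l) q.
Proof. by move=> [[/L2P[]]]. Qed.

Lemma admissible_mul_L2 (l alpha beta : R) (q f : R -> R) : 0 < alpha ->
  admissible l alpha beta q -> L2 l f -> L2 l (fun x => q x * f x).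
Proof.
move=> al0 qA fL; apply: (@L2_le _ _ _ (fun x => beta * f x)); last exact: L2Z.
  apply: measurable_funM; [exact: admissible_meas qA|exact: L2_meas].
have [_ qb] := qA; apply: aeS qb => x + xl => /(_ xl)/andP[q1 q2].
rewrite !normrM; apply: ler_wpM2r => //.
by rewrite !gtr0_norm// ?(lt_le_trans al0)// (le_trans q1).
Qed.

Section two_solutions.
Variables (l T alpha beta : R) (a phi q1 q2 : R -> R) (u1 u2 : R -> R -> R).
Hypotheses (l0 : 0 < l) (T0 : 0 < T) (al0 : 0 < alpha).
Hypotheses (ac : {within `[0, l], continuous a})
  (apos : forall x, x \in `]0, l[ -> 0 < a x).
Hypotheses (q1A : admissible l alpha beta q1) (q2A : admissible l alpha beta q2).
Hypotheses (s1 : weak_solution l T a phi q1 u1) (s2 : weak_solution l T a phi q2 u2).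
Variables (eps U : R).
Hypothesis q12 : {ae mu, forall x, Ioo l x -> `|q1 x - q2 x| <= eps}.
Hypothesis u2U : forall t, t \in `[0, T] -> nrm l (u2 t) <= U.

(** Subtracting the equations leaves three terms for the pairing of w' with w. With W the norm of w,
    the diffusion is <= 0, the term with q1 w is <= -alpha W^2, and the source is <= eps U W. The
    quadratic -alpha W^2 + eps U W has maximum eps^2 U^2 / (4 alpha). *)
Lemma energy_inequality (v1 v2 vt1 vt2 : R -> R) :
  L2 l v1 -> L2 l v2 -> L2 l vt1 -> L2 l vt2 -> wH1 l a v1 -> wH1 l a v2 ->
  nrm l v2 <= U ->
  let w x := v1 x - v2 x in
  ip l vt1 w + \int[mu]_(x in Ioo l) (a x * grad l v1 x * grad l w x) +
    ip l (fun x => q1 x * v1 x) w = 0 ->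
  ip l vt2 w + \int[mu]_(x in Ioo l) (a x * grad l v2 x * grad l w x) +
    ip l (fun x => q2 x * v2 x) w = 0 ->
  0 <= eps ->
  ip l (fun x => vt1 x - vt2 x) w <= eps ^+ 2 * U ^+ 2 / (4 * alpha).
Proof.
move=> v1L v2L vt1L vt2L v1H v2H v2U w.
have wL : L2 l w by exact: L2B.
have wH : wH1 l a w by exact: wH1B.
have [wv1 _] := v1H; have [wv2 _] := v2H; have [ww _] := wH.
have ma := weight_measurable ac.
have q1v1 := admissible_mul_L2 al0 q1A v1L.
have q2v2 := admissible_mul_L2 al0 q2A v2L.
have q1w := admissible_mul_L2 al0 q1A wL.
have q1v2 := admissible_mul_L2 al0 q1A v2L.
set I1 := \int[mu]_(x in Ioo l) (a x * grad l v1 x * grad l w x).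
set I2 := \int[mu]_(x in Ioo l) (a x * grad l v2 x * grad l w x).
move=> E1 E2 e0.
have i1 : rint (Ioo l) (fun x => a x * grad l v1 x * grad l w x).
  by apply: rint_weightM => //; [exact: grad_meas|exact: grad_meas|exact: rint_wgrad|exact: rint_wgrad].
have i2 : rint (Ioo l) (fun x => a x * grad l v2 x * grad l w x).
  by apply: rint_weightM => //; [exact: grad_meas|exact: grad_meas|exact: rint_wgrad|exact: rint_wgrad].
have I12 : 0 <= I1 - I2.
  rewrite /I1 /I2 -(RintegralB _ i1 i2)//.
  have z : rint (Ioo l) (fun=> 0 : R).
    by apply: (@rint_bounded _ _ _ 0) => //; [exact: mu_itv_lty|move=> x _; rewrite normr0].
  have z0 : \int[mu]_(x in Ioo l) (0 : R) = 0 by rewrite Rintegral_cst// mul0r.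
  rewrite -[X in X <= _]z0.
  apply: (le_Rintegral_ae _ z (rintB _ i1 i2)) => //.
  apply: aeS (gradB_ae wv1 wv2) => x + xl => /(_ xl) gE.
  by rewrite -mulrBl -mulrBr -gE -mulrA mulr_ge0 ?(ltW (apos xl))// -expr2 sqr_ge0.
(* q1 v1 - q2 v2 = q1 w + (q1 - q2) v2: the first term gives coercivity, and the source involves v2
   alone. *)
have Q : ip l (fun x => q1 x * v1 x) w - ip l (fun x => q2 x * v2 x) w =
    ip l (fun x => q1 x * w x) w + ip l (fun x => q1 x * v2 x - q2 x * v2 x) w.
  rewrite ipBl// -ipBl// [LHS](_ : _ = ip l (fun x => q1 x * w x + (q1 x * v2 x - q2 x * v2 x)) w).
    by rewrite ipDl//; [rewrite ipBl|exact: L2B].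
  by apply: eq_Rintegral => x _; rewrite /w; ring.
have Qa : alpha * nrm l w ^+ 2 <= ip l (fun x => q1 x * w x) w.
  rewrite -ip_sq -ipZl//; apply: le_Rintegral_ae => //.
  - by apply: rintM => //; exact: L2Z.
  - exact: rintM.
  - have [_ qb] := q1A; apply: aeS qb => x + xl => /(_ xl)/andP[qa _].
    by rewrite -!mulrA ler_wpM2r// -expr2 sqr_ge0.
have dL : L2 l (fun x => q1 x * v2 x - q2 x * v2 x) by exact: L2B.
have dn : nrm l (fun x => q1 x * v2 x - q2 x * v2 x) <= eps * U.
  apply: (@le_trans _ _ (eps * nrm l v2)); last exact: ler_wpM2l.
  rewrite -[X in X * _](ger0_norm e0) -nrmZ// ler_sqrt; last first.
    by apply: Rintegral_ge0 => x _; exact: sqr_ge0.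
  apply: le_Rintegral_ae => //; [exact: L2_sq|exact/L2_sq/L2Z|].
  apply: aeS q12 => x + xl => /(_ xl) h.
  by rewrite -mulrBl !exprMn ler_wpM2r ?sqr_ge0// -real_normK ?num_real// lerXn2r// nnegrE.
have := cauchy_schwarz dL wL.
rewrite ler_norml => /andP[cs _].
have w0 := nrm_ge0 l w.
have : - (eps * U * nrm l w) <= ip l (fun x => q1 x * v2 x - q2 x * v2 x) w.
  by apply: le_trans cs; rewrite lerN2 ler_wpM2r.
rewrite ipBl//; move: E1 E2 I12 Qa Q.
set W := nrm l w in w0 *; set A := ip l _ w; set B := ip l _ w; set C := ip l _ w.
set D := ip l _ w; set EE := ip l _ w; set G := ip l _ w => E1 E2 I12 Qa Q cs'.
have h : A - C <= - (alpha * W ^+ 2) + eps * U * W by lra.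
apply: (le_trans h).
rewrite ler_pdivlMr ?mulr_gt0//.
(* Completing the square. *)
have := sqr_ge0 (eps * U - 2 * alpha * W); nra.
Qed.

(** The initial values agree almost everywhere, so [energy_bound] starts from 0; its 2 c T with c =
    eps^2 U^2 / (4 alpha) is the right-hand side. *)
Lemma solution_dist : nrm l (fun x => u1 T x - u2 T x) ^+ 2 <=
  T * U ^+ 2 / (2 * alpha) * eps ^+ 2.
Proof.
have [c1 [i1 [ut1 [_ ub1 wt1 uH1 E1]]]] := s1.
have [c2 [i2 [ut2 [_ ub2 wt2 uH2 E2]]]] := s2.
have inc1 := weak_time_deriv_increments c1 ub1 wt1.
have inc2 := weak_time_deriv_increments c2 ub2 wt2.
have [M1 M1i h1] := bochner_L2_nrm ub1.
have [M2 M2i h2] := bochner_L2_nrm ub2.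
have L1 : {ae mu, forall t, Ioo T t -> L2 l (ut1 t)} by apply: aeS h1 => t + tT => /(_ tT)[].
have L2' : {ae mu, forall t, Ioo T t -> L2 l (ut2 t)} by apply: aeS h2 => t + tT => /(_ tT)[].
have inc := has_incrementsB c1 c2 L1 L2' inc1 inc2.
have wc := L2_continuousB c1 c2.
have u0L1 : L2 l (u1 0) by case: (c1 0) => //; rewrite in_itv/= lexx ltW.
have u0L2 : L2 l (u2 0) by case: (c2 0) => //; rewrite in_itv/= lexx ltW.
(* A negative [eps] would make (0, l) a null set. *)
have eps0 : 0 <= eps.
  have [N [mN N0 sub]] := q12; rewrite leNgt; apply/negP => e0.
  have : (mu (Ioo l) <= mu N)%E.
    apply: le_measure; rewrite ?inE// => x xl; apply: sub => /= /(_ xl).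
    by move=> /le_lt_trans/(_ e0); rewrite normr_lt0.
  by rewrite N0 lebesgue_measure_itv/= lte_fin l0 -EFinB subr0 lee_fin leNgt l0.
have := @energy_bound _ l T _ _ (fun t => M1 t + M2 t) (eps ^+ 2 * U ^+ 2 / (4 * alpha))
  T0 wc inc (rintD _ M1i M2i).
have -> : nrm l (fun x => u1 0 x - u2 0 x) = 0.
  rewrite /nrm (_ : \int[mu]_(x in Ioo l) ((u1 0 x - u2 0 x) ^+ 2) = 0) ?sqrtr0//.
  have z0 : \int[mu]_(x in Ioo l) (0 : R) = 0 by rewrite Rintegral_cst// mul0r.
  rewrite -[RHS]z0; apply: eq_Rintegral_ae => //.
    by apply: measurable_funX; apply: measurable_funB; exact: L2_meas.
  by apply: aeS2 i1 i2 => x p1 p2 xl; rewrite p1// p2// subrr expr0n.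
rewrite expr0n add0r => H.
have {H} : nrm l (fun x => u1 T x - u2 T x) ^+ 2 <=
    2 * (eps ^+ 2 * U ^+ 2 / (4 * alpha)) * T.
  apply: H => //.
    apply: aeS2 h1 h2 => t p1 p2 tT; have [q1' <-] := p1 tT; have [q2' <-] := p2 tT.
    by split; [exact: L2B|exact: nrmB].
  have [uH1' _ _] := uH1; have [uH2' _ _] := uH2.
  have hh := aeS2 (fun t p q => conj p q) h1 h2.
  have uu := aeS2 (fun t p q => conj p q) uH1' uH2'.
  have ee := aeS2 (fun t p q => conj p q) E1 E2.
  have hu := aeS2 (fun t p q => conj p q) hh uu.
  apply: aeS2 hu ee => t [[p1 p2] [p3 p4]] [p5 p6] tT.
  have [utL1 _] := p1 tT; have [utL2 _] := p2 tT.
  have {}p3 := p3 tT; have {}p4 := p4 tT.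
  have tcc : t \in `[0, T] by exact: subset_itv_oo_cc.
  have [uL1 _] := c1 _ tcc; have [uL2 _] := c2 _ tcc.
  have wL := L2B uL1 uL2; have wH := wH1B l0 ac apos p3 p4.
  apply: (energy_inequality uL1 uL2 utL1 utL2 p3 p4 (u2U tcc)) => //.
    exact: p5 tT _ wL wH.
  exact: p6 tT _ wL wH.
move=> /le_trans; apply; rewrite le_eqVlt; apply/orP; left; apply/eqP.
by field; rewrite gt_eqF.
Qed.

End two_solutions.
End stability.

(** * Completeness of L^2 and Riesz representation *)

Section riesz.
Context {R : realType}.
Notation mu := (@lebesgue_measure R).
Implicit Types (b : R) (f g h v w : R -> R).

Lemma half_expn_sum n : \sum_(k < n) (2^-1 : R) ^+ k = 2 * (1 - 2^-1 ^+ n).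
Proof.
elim: n => [|n IH]; first by rewrite big_ord0 expr0 subrr mulr0.
by rewrite big_ord_recr/= IH exprS; field.
Qed.

Lemma half_expn_ge0 n : 0 <= (2^-1 : R) ^+ n.
Proof. by rewrite exprn_ge0// invr_ge0. Qed.

Lemma nrm_fast b (v : nat -> R -> R) C : (forall n, L2 b (v n)) ->
  (forall n, nrm b (fun x => v n.+1 x - v n x) <= C * 2^-1 ^+ n) ->
  forall n j, nrm b (fun x => v (n + j)%N x - v n x) <= 2 * C * 2^-1 ^+ n.
Proof.
move=> vL hv n j.
have C0 : 0 <= C by have := hv 0%N; rewrite expr0 mulr1; apply: le_trans; exact: nrm_ge0.
(* The induction on j needs the exact geometric sum, not just its bound. *)
apply: (@le_trans _ _ (C * 2^-1 ^+ n * (2 * (1 - 2^-1 ^+ j)))); last first.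
  have := half_expn_ge0 j; have := half_expn_ge0 n => h1 h2.
  rewrite (_ : 2 * C * _ = C * 2^-1 ^+ n * 2); last by ring.
  by apply: ler_wpM2l; [rewrite mulr_ge0|lra].
elim: j => [|j IH].
  rewrite expr0 subrr !mulr0 addn0 (_ : nrm _ _ = 0)//.
  by rewrite /nrm; under eq_Rintegral do rewrite subrr expr0n/=; rewrite Rintegral_cst// mul0r sqrtr0.
have -> : (fun x => v (n + j.+1)%N x - v n x) =
    (fun x => (v (n + j).+1 x - v (n + j)%N x) + (v (n + j)%N x - v n x)).
  by rewrite addnS; apply/funext => x; ring.
apply: le_trans (nrmD _ _) _; [exact: L2B|exact: L2B|].
apply: le_trans (lerD (hv _) IH) _.
by rewrite le_eqVlt; apply/orP; left; apply/eqP; rewrite exprD exprS; field.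
Qed.

Lemma nrm_L1 b f : L2 b f -> \int[mu]_(x in Ioo b) `|f x| <= nrm b f * nrm b (cst 1).
Proof.
move=> fL.
have cL : L2 b (cst 1 : R -> R).
  by apply: (@L2_bounded _ _ _ 1) => //; apply: aeW => x _; rewrite normr1.
have nL : L2 b (fun x => `|f x|).
  have mf := L2_meas fL.
  apply: L2_le fL; first exact: measurableT_comp.
  by apply: aeW => x _; rewrite normr_id.
have -> : \int[mu]_(x in Ioo b) `|f x| = ip b (fun x => `|f x|) (cst 1).
  by apply: eq_Rintegral => x _; rewrite mulr1.
apply: le_trans (ler_norm _) _; apply: le_trans (cauchy_schwarz nL cL) _.
apply: ler_wpM2r; first exact: nrm_ge0.
rewrite /nrm (_ : \int[mu]_(x in Ioo b) (`|f x| ^+ 2) = \int[mu]_(x in Ioo b) (f x ^+ 2))//.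
by apply: eq_Rintegral => x _; rewrite real_normK ?num_real.
Qed.

(** On a bounded interval the L^1 norms of the increments are controlled by their L^2 norms, hence
    summable; the sum of the absolute increments is then finite almost everywhere and the
    telescoping series converges. *)
Lemma ae_cvg_fast b (v : nat -> R -> R) C : (forall n, L2 b (v n)) ->
  (forall n, nrm b (fun x => v n.+1 x - v n x) <= C * 2^-1 ^+ n) ->
  {ae mu, forall x, Ioo b x -> cvgn (fun n => v n x)}.
Proof.
move=> vL hv; have dL n : L2 b (fun x => v n.+1 x - v n x) by exact: L2B.
have dm n : measurable_fun (Ioo b) (fun x => `|v n.+1 x - v n x|%:E).
  by apply/measurable_EFinP; apply: measurableT_comp => //; exact: L2_meas.
pose S x := (\sum_(0 <= k <oo) `|v k.+1 x - v k x|%:E)%E.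
have Sint : (\int[mu]_(x in Ioo b) S x < +oo)%E.
  rewrite /S integral_nneseries//.
  pose K := C * nrm b (cst 1) * 2.
  have C0 : 0 <= C by have := hv 0%N; rewrite expr0 mulr1; apply: le_trans; exact: nrm_ge0.
  apply: (@le_lt_trans _ _ K%:E); last exact: ltry.
  apply: lime_le.
    by apply: is_cvg_nneseries => n _ _; apply: integral_ge0 => x _; rewrite lee_fin.
  apply: nearW => n; rewrite big_mkord.
  apply: (@le_trans _ _ (\sum_(k < n) (C * nrm b (cst 1) * 2^-1 ^+ k)%:E)%E).
    apply: lee_sum => k _; rewrite rint_ereal//; last first.
      by apply: rint_normr; exact: L2_rint.
    rewrite lee_fin; apply: le_trans (nrm_L1 (dL k)) _.
    by rewrite mulrAC ler_wpM2r// nrm_ge0.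
  rewrite sumEFin lee_fin -mulr_sumr half_expn_sum /K.
  apply: ler_wpM2l; first by rewrite mulr_ge0// nrm_ge0.
  by have := half_expn_ge0 n; lra.
have Si : mu.-integrable (Ioo b) S.
  apply/integrableP; split.
    by apply: ge0_emeasurable_sum => // k _; exact: dm.
  have -> : (\int[mu]_(x in Ioo b) `|S x| = \int[mu]_(x in Ioo b) S x)%E.
    apply: eq_integral => x _; rewrite gee0_abs//.
    by apply: nneseries_ge0 => n _ _; rewrite lee_fin.
  exact: Sint.
have Sae : {ae mu, forall x, Ioo b x -> S x \is a fin_num} by exact: integrable_ae Si.
apply: aeS Sae => x + xb => /(_ xb) Sx.
have sc : cvgn (series (fun k => v k.+1 x - v k x)).
  apply: normed_cvg; apply: nnseries_is_cvg => [i|]; first exact: normr_ge0.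
  by move: Sx; rewrite fin_numElt => /andP[].
have -> : (fun n => v n x) = (fun n => v 0%N x + series (telescope (v ^~ x)) n).
  by apply/funext => n; rewrite -[LHS]/((v ^~ x) n) eq_sum_telescope.
by apply: is_cvgD; [exact: is_cvg_cst|exact: sc].
Qed.

(** Fatou's lemma in j, applied to the squares of v (n + j) - v n, carries the bound of [nrm_fast]
    over to h - v n. The geometric rate spares the extraction of a subsequence. *)
Lemma L2_complete_fast b (v : nat -> R -> R) C : (forall n, L2 b (v n)) ->
  (forall n, nrm b (fun x => v n.+1 x - v n x) <= C * 2^-1 ^+ n) ->
  exists2 h, L2 b h & nrm b (fun x => h x - v n x) @[n --> \oo] --> 0.
Proof.
move=> vL hv; have aec := ae_cvg_fast vL hv.
have mIoo : measurable (Ioo b : set R) by [].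
have aec' : {ae mu, forall x, Ioo b x -> v n x @[n --> \oo] --> lim (v n x @[n --> \oo])}.
  by apply: aeS aec => x + xb => /(_ xb).
have [h mh hlim] := ae_cvg_measurable mIoo (fun n => L2_meas (vL n)) aec'.
have mhv n : measurable_fun (Ioo b) (fun x => h x - v n x).
  by apply: measurable_funB => //; exact: L2_meas.
have fat n : (\int[mu]_(x in Ioo b) ((h x - v n x) ^+ 2)%:E <=
    ((2 * C * 2^-1 ^+ n) ^+ 2)%:E)%E.
  pose f j x := ((v (n + j)%N x - v n x) ^+ 2)%:E.
  have dL j : L2 b (fun x => v (n + j)%N x - v n x) by exact: L2B.
  have mf j : measurable_fun (Ioo b) (f j).
    by apply/measurable_EFinP; apply: measurable_funX; exact: L2_meas.
  have -> : (\int[mu]_(x in Ioo b) ((h x - v n x) ^+ 2)%:E =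
      \int[mu]_(x in Ioo b) limn_einf (f ^~ x))%E.
    apply: ae_eq_integral => //.
    - by apply/measurable_EFinP; apply: measurable_funX; exact: mhv.
    - have -> : (fun x => limn_einf (f ^~ x)) = (fun x => - limn_esup (fun j => - f j x))%E by [].
      apply: measurableT_comp => //; apply: measurable_fun_limn_esup => j.
      by apply: measurableT_comp => //; exact: mf.
    - apply: aeS2 aec hlim => x c1 c2 xb; rewrite c2//; have {}c1 := c1 xb.
      have cf : f j x @[j --> \oo] --> ((lim (v n x @[n --> \oo]) - v n x) ^+ 2)%:E.
        apply: cvg_EFin; first exact: nearW.
        have cv : v (n + j)%N x @[j --> \oo] --> lim (v n x @[n --> \oo]).
          rewrite (_ : (fun j => v (n + j)%N x) = (fun j => v (j + n)%N x)).
            by rewrite (cvg_shiftn n (v ^~ x)).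
          by apply/funext => j; rewrite addnC.
        have cb : v (n + j)%N x - v n x @[j --> \oo] --> lim (v n x @[n --> \oo]) - v n x.
          by apply: cvgB => //; exact: cvg_cst.
        exact: (cvgM cb cb).
      by have [-> _] := cvg_limn_einf_sup cf.
  apply: le_trans (fatou _ _ _ _) _ => //.
    by move=> j x _; rewrite lee_fin sqr_ge0.
  rewrite limn_einf_lim; apply: lime_le; first exact: is_cvg_einfs.
  apply: nearW => j; apply: (@le_trans _ _ (\int[mu]_(x in Ioo b) f j x)%E).
    by apply: ereal_inf_lbound; exists j => /=.
  rewrite rint_ereal//; last exact: L2_sq.
  rewrite lee_fin -sq_nrm lerXn2r ?nnegrE ?nrm_ge0//.
    by apply: le_trans (nrm_fast vL hv n j); exact: nrm_ge0.
  exact: nrm_fast.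
have hvL n : L2 b (fun x => h x - v n x).
  apply/L2P; split; first exact: mhv.
  apply/integrableP; split.
    by apply/measurable_EFinP; apply: measurable_funX; exact: mhv.
  apply: le_lt_trans (ltry ((2 * C * 2^-1 ^+ n) ^+ 2)); apply: le_trans (fat n).
  rewrite le_eqVlt; apply/orP; left; apply/eqP; apply: eq_integral => x _.
  by rewrite /= ger0_norm ?sqr_ge0.
exists h.
  have -> : h = fun x => (h x - v 0%N x) + v 0%N x by apply/funext => x; rewrite subrK.
  exact: L2D.
have C0 : 0 <= C by have := hv 0%N; rewrite expr0 mulr1; apply: le_trans; exact: nrm_ge0.
apply: (@squeeze_cvgr _ _ _ _ (cst 0) (fun n => 2 * C * 2^-1 ^+ n)).
- apply: nearW => n; rewrite nrm_ge0/=.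
  have := fat n; rewrite rint_ereal//; last exact: L2_sq.
  rewrite lee_fin -sq_nrm ler_pXn2r ?nnegrE ?nrm_ge0// mulr_ge0 ?mulr_ge0//.
- exact: cvg_cst.
- rewrite -(mulr0 (2 * C)); apply: cvgM; first exact: cvg_cst.
  by apply: cvg_expr; rewrite gtr0_norm ?invr_gt0// invf_lt1// ltr1n.
Qed.

(** The 3 is an integer above the square root of 8. *)
Lemma nrm_fast_of_sq b f n : nrm b f ^+ 2 <= 8 * 4^-1 ^+ n -> nrm b f <= 3 * 2^-1 ^+ n.
Proof.
move=> h; rewrite -(@ler_pXn2r _ 2)// ?nnegrE ?nrm_ge0 ?mulr_ge0 ?half_expn_ge0//.
apply: (le_trans h); rewrite exprMn -exprM mulnC exprM.
have -> : (2^-1 : R) ^+ 2 = 4^-1 by field.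
by apply: ler_wpM2r; [rewrite exprn_ge0// invr_ge0|lra].
Qed.

Lemma cvg_nrm_dist b (v : nat -> R -> R) h : (forall n, L2 b (v n)) -> L2 b h ->
  nrm b (fun x => h x - v n x) @[n --> \oo] --> 0 -> nrm b (v n) @[n --> \oo] --> nrm b h.
Proof.
move=> vL hL c; apply/cvgrPdist_le => e e0.
have /cvgrPdist_le/(_ e e0) := c; apply: filterS => n.
rewrite sub0r normrN ger0_norm ?nrm_ge0//; apply: le_trans; exact: nrm_dist.
Qed.

Lemma quadratic_ge0_slope0 (c B : R) : 0 <= B ->
  (forall s, 0 <= s * c + s ^+ 2 / 2 * B) -> c = 0.
Proof.
move=> B0 H; apply/eqP; rewrite -sqrf_eq0 eq_le sqr_ge0 andbT.
have B1 : 0 < B + 1 by rewrite ltr_wpDl.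
(* The vertex is at -c / B; B + 1 keeps the denominator positive, and the value there is still a
   negative multiple of c^2. *)
have := H (- c / (B + 1)).
have -> : - c / (B + 1) * c + (- c / (B + 1)) ^+ 2 / 2 * B =
    - (c ^+ 2) * ((B + 2) / (2 * (B + 1) ^+ 2)).
  by field; rewrite gt_eqF.
rewrite pmulr_lge0 ?oppr_ge0//.
by rewrite divr_gt0// ?mulr_gt0 ?exprn_gt0// ltr_wpDl.
Qed.

Lemma nrm_lin_sq b c1 c2 v w : L2 b v -> L2 b w ->
  nrm b (fun x => c1 * v x + c2 * w x) ^+ 2 =
  c1 ^+ 2 * nrm b v ^+ 2 + 2 * c1 * c2 * ip b v w + c2 ^+ 2 * nrm b w ^+ 2.
Proof.
move=> vL wL; have cvL := L2Z c1 vL; have cwL := L2Z c2 wL.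
by rewrite (nrmD_sq cvL cwL) (nrmZ_sq c1 vL) (nrmZ_sq c2 wL) (ipZl _ vL cwL) (ipZr _ wL vL);
  move: (nrm b v) (nrm b w) (ip b v w) => p q r; ring.
Qed.

Lemma nrmB_sq b v w : L2 b v -> L2 b w ->
  nrm b (fun x => v x - w x) ^+ 2 = nrm b v ^+ 2 - 2 * ip b v w + nrm b w ^+ 2.
Proof.
move=> vL wL; have -> : (fun x => v x - w x) = fun x => 1 * v x + (-1) * w x.
  by apply/funext => x; ring.
by rewrite nrm_lin_sq//; ring.
Qed.

(* Riesz representation of the functional v |-> \int Q v', by minimizing the
   quadratic energy |v|^2 / 2 + \int Q v' over test functions *)
Lemma weak_deriv_of_bounded b Q K : 0 < b -> locally_integrable (Ioo b) Q -> 0 <= K ->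
  (forall v, test_fun b v ->
    `|\int[mu]_(x in Ioo b) (Q x * derive1 v x)| <= K * nrm b v) ->
  exists2 h, L2 b h & weak_deriv b Q h /\ nrm b h <= K.
Proof.
move=> b0 Qi K0 QK.
pose L v := \int[mu]_(x in Ioo b) (Q x * derive1 v x).
have Llin c1 c2 v w : test_fun b v -> test_fun b w ->
    L (fun x => c1 * v x + c2 * w x) = c1 * L v + c2 * L w.
  move=> vt wt; have v't := test_fun_derive1 vt; have w't := test_fun_derive1 wt.
  have i1 := rint_test Qi v't; have i2 := rint_test Qi w't.
  rewrite /L -(RintegralZl _ _ i1)// -(RintegralZl _ _ i2)//.
  rewrite -(RintegralD _ (rintZl c1 _ i1) (rintZl c2 _ i2))//.
  apply: eq_Rintegral => x _.
  have [dv _] := vt; have [dw _] := wt.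
  have [_] := derive1n_lin c1 c2 dv dw 1 x; rewrite !derive1n1 => ->.
  by ring.
pose E v := nrm b v ^+ 2 / 2 + L v.
pose A := [set E v | v in test_fun b].
have t0 : test_fun b (cst 0 : R -> R).
  split; last by exists (b / 3), (b / 2); split => //; lra.
  by move=> n x; exact: (elementary_smooth (elem_cst 0)).
have A0 : A !=set0 by exists (E (cst 0)); exists (cst 0).
have Alb : has_lbound A.
  (* The minimum over p of p^2 / 2 - K p. *)
  exists (- K ^+ 2 / 2) => _ [v vt <-]; rewrite /E.
  have := QK v vt; rewrite ler_norml => /andP[h _].
  have := sqr_ge0 (nrm b v - K); rewrite -/(L v) in h; nra.
pose m := inf A.
have Em v : test_fun b v -> m <= E v by move=> vt; apply: ge_inf => //; exists v.
(* A tolerance 4^-n in energy becomes 2^-n in norm, the rate required by [L2_complete_fast]. *)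
have /choice[v hv] : forall n : nat, exists v, test_fun b v /\ E v <= m + 4^-1 ^+ n.
  move=> n; have e0 : 0 < (4^-1 : R) ^+ n by rewrite exprn_gt0// invr_gt0.
  have [_ [v vt <-] vm] := inf_adherent e0 (conj A0 Alb).
  by exists v; split => //; exact: ltW.
have vt n : test_fun b (v n) by case: (hv n).
have vE n : E (v n) <= m + 4^-1 ^+ n by case: (hv n).
have vL n : L2 b (v n) := test_fun_L2 (vt n).
have vfast n : nrm b (fun x => v n.+1 x - v n x) <= 3 * 2^-1 ^+ n.
  apply: nrm_fast_of_sq.
  (* Parallelogram identity: |p - q|^2 / 8 is the mean of the energies of p and q minus the energy
     of their midpoint. As the latter is at least m, |p - q|^2 <= 5 * 4^-n, within the 8 * 4^-n of
     [nrm_fast_of_sq]. *)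
  have mid := Em _ (test_fun_lin (2^-1) (2^-1) (vt n.+1) (vt n)).
  have := vE n; have := vE n.+1; move: mid.
  rewrite /E (Llin _ _ _ _ (vt n.+1) (vt n)) (nrm_lin_sq _ _ (vL n.+1) (vL n)).
  rewrite (nrmB_sq (vL n.+1) (vL n)) (exprS 4^-1).
  have q0 : 0 <= (4^-1 : R) ^+ n by rewrite exprn_ge0// invr_ge0.
  move: (nrm b (v n.+1)) (nrm b (v n)) (ip b (v n.+1) (v n)) (L (v n.+1)) (L (v n)) (_ ^+ n) q0.
  by move=> p q r s t q' q0; lra.
have [h hL hc] := L2_complete_fast vL vfast.
exists h => //.
have nc := cvg_nrm_dist vL hL hc.
(* Euler-Lagrange equation. The limit h need not be a test function, so the variation s w is added
   to v n, which is minimal up to 4^-n, before n tends to infinity. *)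
have slope w : test_fun b w -> ip b h w + L w = 0.
  move=> wt; have wL := test_fun_L2 wt.
  apply: (@quadratic_ge0_slope0 _ (nrm b w ^+ 2)) => [|s]; first exact: sqr_ge0.
  have c1 : ip b (v n) w @[n --> \oo] --> ip b h w by exact: cvg_ip.
  have c2 : s * (ip b (v n) w + L w) + s ^+ 2 / 2 * nrm b w ^+ 2 + 4^-1 ^+ n @[n --> \oo] -->
      s * (ip b h w + L w) + s ^+ 2 / 2 * nrm b w ^+ 2 + 0.
    apply: cvgD; last first.
      by apply: cvg_expr; rewrite gtr0_norm ?invr_gt0// invf_lt1// ltr1n.
    apply: cvgD; last exact: cvg_cst.
    by apply: cvgM; [exact: cvg_cst|apply: cvgD => //; exact: cvg_cst].
  rewrite addr0 in c2; apply: (ler_cvg_to (cvg_cst 0) c2); apply: nearW => n.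
  have := Em _ (test_fun_lin 1 s (vt n) wt); have := vE n.
  rewrite /E (Llin _ _ _ _ (vt n) wt) (nrm_lin_sq _ _ (vL n) wL).
  move: (nrm b (v n)) (nrm b w) (ip b (v n) w) (L (v n)) (L w) (4^-1 ^+ n).
  by move=> p q r x y q'; lra.
split.
- split => //; first exact: L2_locally.
  move=> w wt; apply/eqP; rewrite -addr_eq0 addrC; apply/eqP; exact: slope.
(* With w = v n, [slope] makes the pairing of v n and h equal to - L (v n), which is at most K |v
   n|; in the limit |h|^2 <= K |h|. *)
- have c1 : ip b (v n) h @[n --> \oo] --> ip b h h by exact: cvg_ip.
  have c2 : K * nrm b (v n) @[n --> \oo] --> K * nrm b h by apply: cvgM => //; exact: cvg_cst.
  have hK : ip b h h <= K * nrm b h.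
    apply: (ler_cvg_to c1 c2); apply: nearW => n.
    have := slope _ (vt n); have := QK _ (vt n); rewrite -/(L (v n)) ipC.
    by rewrite ler_norml => /andP[q1 q2]; lra.
  have := nrm_ge0 b h; rewrite le_eqVlt => /predU1P[<-//|h0].
  by move: hK; rewrite ip_sq expr2 ler_pM2r.
Qed.

End riesz.

(** * Compactness of the admissible set along an ultrafilter *)

Section compactness.
Context {R : realType}.
Notation mu := (@lebesgue_measure R).
Implicit Types (b : R) (q h : R -> R).

Lemma ae_exists b (P : R -> Prop) : 0 < b -> {ae mu, forall x, x \in `]0, b[ -> P x} ->
  exists2 x, x \in `]0, b[ & P x.
Proof.
move=> b0 [N [mN N0 sub]]; apply: contrapT => nP.
have : (mu (Ioo b) <= mu N)%E.
  apply: le_measure; rewrite ?inE// => x xb; apply: sub => /= Px.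
  by apply: nP; exists x => //; exact: Px.
by rewrite N0 lebesgue_measure_itv/= lte_fin b0 -EFinB subr0 lee_fin leNgt b0.
Qed.

(** Cauchy-Schwarz against the indicator of []s, t]]. *)
Lemma Rintegral_holder b h s t : L2 b h -> 0 < s -> s <= t -> t < b ->
  `|\int[mu]_(x in `]s, t]) h x| <= nrm b h * Num.sqrt (t - s).
Proof.
move=> hL s0 st tb.
have sub : `]s, t]%classic `<=` Ioo b by apply: subset_itv; rewrite bnd_simp// ltW.
have mA : measurable (`]s, t]%classic : set R) by [].
have iL : L2 b (\1_(`]s, t]%classic) : R -> R).
  apply: (@L2_bounded _ _ _ 1); first exact: measurable_indic.
  by apply: aeW => x _; rewrite indicE; case: (_ \in _); rewrite ?normr1 ?normr0.
have E (f : R -> R) : \int[mu]_(x in Ioo b) (f x * (\1_(`]s, t]%classic) x : R)) = \int[mu]_(x in `]s, t]) f x.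
  rewrite (Rintegral_sub0 sub).
    by apply: eq_Rintegral => x /set_mem xs; rewrite indicE mem_set// mulr1.
  by move=> x _ xs; rewrite indicE memNset// mulr0.
have := cauchy_schwarz hL iL; rewrite {1}/ip E => /le_trans; apply.
rewrite le_eqVlt; apply/orP; left; apply/eqP; congr (_ * _).
rewrite /nrm; congr Num.sqrt.
rewrite -fine_mu_itv_oc// -[RHS]mul1r -Rintegral_cst// -E.
by apply: eq_Rintegral => x _; rewrite expr2 mul1r indicE; case: (_ \in _); rewrite ?mulr0 ?mulr1.
Qed.

Lemma holder_representative b q h : 0 < b -> weak_deriv b q h -> L2 b h ->
  exists2 Q : R -> R, {ae mu, forall x, x \in `]0, b[ -> q x = Q x} &
    forall x y : R, x \in `]0, b[ -> y \in `]0, b[ -> `|Q x - Q y| <= nrm b h * Num.sqrt `|x - y|.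
Proof.
move=> b0 qh hL; have [qi _ _] := qh; have L := ae_lebesgue_pt qi.
have hi : rint (Ioo b) h := L2_rint hL.
have [s sb Ls] := ae_exists b0 L.
(* Primitive of h taking the value of q at a Lebesgue point s; a difference of two integrals from 0
   covers x on either side of s. *)
pose Q x := q s + (\int[mu]_(y in `]0, x]) h y - \int[mu]_(y in `]0, s]) h y).
have incr x y : x \in `]0, b[ -> y \in `]0, b[ -> x <= y ->
    \int[mu]_(z in `]0, y]) h z - \int[mu]_(z in `]0, x]) h z = \int[mu]_(z in `]x, y]) h z.
  rewrite !in_itv/= => /andP[x0 xb] /andP[y0 yb] xy.
  rewrite (@itv_oc_split _ 0 x y) ?(ltW x0)//; first by ring.
  by apply: rintS hi => //; apply: subset_itv; rewrite bnd_simp.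
exists Q.
  apply: aeS L => x Lx xb; have {}Lx := Lx xb.
  have [xs|sx] := leP x s.
    have := weak_deriv_increment qh _ xs _ Lx Ls; rewrite -incr//.
    move: xb sb; rewrite !in_itv/= => /andP[x0 _] /andP[_ sb] /(_ x0 sb).
    by move=> H; rewrite /Q -[X in _ + X]opprB -H; ring.
  have := weak_deriv_increment qh _ (ltW sx) _ Ls Lx; rewrite -incr ?ltW//.
  move: xb sb; rewrite !in_itv/= => /andP[_ xb] /andP[s0 _] /(_ s0 xb).
  by move=> H; rewrite /Q -H; ring.
have main x y : x \in `]0, b[ -> y \in `]0, b[ -> x <= y ->
    `|Q x - Q y| <= nrm b h * Num.sqrt `|x - y|.
  move=> xb yb xy; rewrite distrC (distrC x) (ger0_norm (_ : 0 <= y - x)) ?subr_ge0//.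
  have -> : Q y - Q x = \int[mu]_(z in `]x, y]) h z by rewrite -incr// /Q; ring.
  by move: xb yb; rewrite !in_itv/= => /andP[x0 _] /andP[_ yb]; exact: Rintegral_holder.
move=> x y xb yb; have [xy|yx] := leP x y; first exact: main.
by rewrite distrC (distrC x); apply: main => //; exact: ltW.
Qed.

(** Compactness gives a cluster point, and an ultrafilter converges to it: if the preimage of a
    neighbourhood were not in F, its complement would be. *)
Lemma ultra_bounded_cvg (F : set_system nat) (f : nat -> R) (B : R) : UltraFilter F ->
  (forall n, `|f n| <= B) -> exists p : R, f n @[n --> F] --> p.
Proof.
move=> UF fB.
have [|p [_ clp]] := @segment_compact R (- B) B (f @ F) _.
  by apply: (@filterS _ F _ setT) filterT => n _ /=; rewrite in_itv/= -ler_norml.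
exists p => U pU; have [//|nU] := in_ultra_setVsetC (f @^-1` U) UF.
have [x [/= ? ?]] := clp (~` U) U nU pU.
by [].
Qed.

Lemma cvg_le (F : set_system nat) (f : nat -> R) (p C : R) : ProperFilter F ->
  f n @[n --> F] --> p -> (forall n, f n <= C) -> p <= C.
Proof.
move=> FF fp fC; have H := @closed_cvg _ _ F FF f [set x | x <= C] (@closed_le _ C).
by apply: H fp; exact: filterE.
Qed.

(** The ultrafilter yields limits at all points at once, in place of a diagonal extraction. *)
Lemma ultra_arzela_ascoli (F : set_system nat) (Q : nat -> R -> R) b (B G : R) :
  UltraFilter F -> 0 < b ->
  (forall n (x : R), x \in `]0, b[ -> `|Q n x| <= B) ->
  (forall n (x y : R), x \in `]0, b[ -> y \in `]0, b[ -> `|Q n x - Q n y| <= G * Num.sqrt `|x - y|) ->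
  exists Qb : R -> R, [/\ forall x : R, x \in `]0, b[ -> Q n x @[n --> F] --> Qb x,
    forall x y : R, x \in `]0, b[ -> y \in `]0, b[ -> `|Qb x - Qb y| <= G * Num.sqrt `|x - y| &
    forall e : R, 0 < e -> \forall n \near F, forall x : R, x \in `]0, b[ -> `|Q n x - Qb x| <= e].
Proof.
move=> UF b0 QB QG; have FF : ProperFilter F by exact: ultra_proper.
have bh : b / 2 \in `]0, b[ by rewrite in_itv/=; lra.
(* Forced by the Hoelder bound at two distinct points. *)
have G0 : 0 <= G.
  have b4 : b / 4 \in `]0, b[ by rewrite in_itv/=; lra.
  have := QG 0%N _ _ bh b4; have : 0 < Num.sqrt `|b / 2 - b / 4|.
    by rewrite sqrtr_gt0 normr_gt0; lra.
  by move=> s0 /(le_trans (normr_ge0 _)); rewrite pmulr_lge0.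
have lim x : exists p : R, x \in `]0, b[ -> Q n x @[n --> F] --> p.
  have [xb|xb] := boolP (x \in `]0, b[); last by exists 0.
  by have [p hp] := ultra_bounded_cvg UF (fun n => QB n x xb); exists p.
have {lim}[Qb Qbl] := choice lim.
have QbG x y : x \in `]0, b[ -> y \in `]0, b[ -> `|Qb x - Qb y| <= G * Num.sqrt `|x - y|.
  move=> xb yb; have c : `|Q n x - Q n y| @[n --> F] --> `|Qb x - Qb y|.
    by apply: cvg_norm; apply: cvgB; exact: Qbl.
  by apply: cvg_le c _ => n; exact: QG.
exists Qb; split => // e e0.
(* If uniform convergence failed, points [x n] where it fails would converge along
   [F]; by equicontinuity, convergence at one [x m] near their limit forbids this. *)
set A := fun n => forall x, x \in `]0, b[ -> `|Q n x - Qb x| <= e.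
have [//|nA] := in_ultra_setVsetC A UF; exfalso.
have ch n : exists x : R, (x \in `]0, b[) /\ (~ A n -> e < `|Q n x - Qb x|).
  have [An|An] := pselect (A n); first by exists (b / 2).
  have /existsNP[x /not_implyP[xb /negP]] := An; rewrite -ltNge => xe.
  by exists x.
have {ch}[x hx] := choice ch.
have [p xp] : exists p : R, x n @[n --> F] --> p.
  apply: (@ultra_bounded_cvg F x b) => // n; have [+ _] := hx n.
  by rewrite in_itv/= ler_norml => /andP[? ?]; lra.
(* Chosen so that G sqrt d <= e / 4, with G + 1 positive even for G = 0; the final count is e / 4 +
   e / 2 + e / 4. *)
pose d := (e / (4 * (G + 1))) ^+ 2.
have G4 : 0 < 4 * (G + 1) by lra.
have eG : 0 < e / (4 * (G + 1)) by rewrite divr_gt0.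
have d0 : 0 < d by rewrite exprn_gt0.
have Gd : G * Num.sqrt d <= e / 4.
  rewrite /d sqrtr_sqr gtr0_norm// mulrA ler_pdivrMr//; nra.
have d2 : 0 < d / 2 by rewrite divr_gt0.
have D : F [set n | `|p - x n| < d / 2] by move/cvgrPdist_lt : xp => /(_ _ d2).
(* The limit p may be an endpoint of (0, b), so an x m close to it serves as the point of
   comparison. *)
have [m /= mD] := filter_ex D; have [xmb _] := hx m.
have e2 : 0 < e / 2 by rewrite divr_gt0.
have Em : F [set n | `|Qb (x m) - Q n (x m)| < e / 2].
  by move/cvgrPdist_lt : (Qbl _ xmb) => /(_ _ e2).
have [n [/= nD [An En]]] := filter_ex (filterI D (filterI nA Em)).
have [xnb /(_ An) xne] := hx n.
have nm : `|x n - x m| <= d.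
  have -> : x n - x m = (p - x m) - (p - x n) by ring.
  by apply: le_trans (ler_normB _ _) _; lra.
have Gnm : G * Num.sqrt `|x n - x m| <= e / 4.
  by apply: le_trans Gd; apply: ler_wpM2l => //; rewrite ler_sqrt// ltW.
have h1 := le_trans (QG n _ _ xnb xmb) Gnm; have h2 := le_trans (QbG _ _ xnb xmb) Gnm.
have := xne; rewrite ltNge => /negP; apply.
have -> : Q n (x n) - Qb (x n) =
  (Q n (x n) - Q n (x m)) - (Qb (x m) - Q n (x m)) - (Qb (x n) - Qb (x m)) by ring.
apply: le_trans (ler_normB _ _) _; apply: le_trans (lerD (ler_normB _ _) (lexx _)) _.
by move: h1 h2 En; lra.
Qed.

Lemma holder_measurable b (Q : R -> R) (G : R) : 0 <= G ->
  (forall x y : R, x \in `]0, b[ -> y \in `]0, b[ -> `|Q x - Q y| <= G * Num.sqrt `|x - y|) ->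
  measurable_fun (Ioo b) Q.
Proof.
move=> G0 QG; have oI : open (Ioo b : set R) by exact: interval_open.
apply: open_continuous_measurable_fun => // x /set_mem xb.
apply/cvgrPdist_le => e e0.
have eG : 0 < e / (G + 1) by rewrite divr_gt0//; lra.
have /nbhs_ballP[r /= r0 rI] := open_nbhs_nbhs (conj oI xb).
apply/nbhs_ballP; exists (Num.min r ((e / (G + 1)) ^+ 2)) => /=.
  by rewrite lt_min r0 exprn_gt0.
move=> y; rewrite /ball/= lt_min => /andP[yr ye].
apply: le_trans (QG _ _ xb (rI _ yr)) _.
apply: (@le_trans _ _ (G * (e / (G + 1)))).
  apply: ler_wpM2l => //; have -> : e / (G + 1) = Num.sqrt ((e / (G + 1)) ^+ 2).
    by rewrite sqrtr_sqr gtr0_norm.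
  by rewrite ler_sqrt ?exprn_ge0 ?(ltW eG) ?(ltW ye).
by rewrite mulrA ler_pdivrMr; nra.
Qed.

Lemma nrm_le b (f g : R -> R) : L2 b f -> L2 b g ->
  {ae mu, forall x, Ioo b x -> `|f x| <= `|g x|} -> nrm b f <= nrm b g.
Proof.
move=> fL gL fg; rewrite ler_sqrt; last by apply: Rintegral_ge0 => x _; exact: sqr_ge0.
apply: le_Rintegral_ae => //; [exact: L2_sq|exact: L2_sq|].
apply: aeS fg => x + xb => /(_ xb) h.
by rewrite -[leLHS]real_normK ?num_real// -[leRHS]real_normK ?num_real// lerXn2r ?nnegrE.
Qed.

Lemma weak_deriv_bound b q h v : L2 b h -> weak_deriv b q h -> test_fun b v ->
  `|\int[mu]_(x in Ioo b) (q x * derive1 v x)| <= nrm b h * nrm b v.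
Proof.
move=> hL [_ _ qh] vt; rewrite qh// normrN.
exact: cauchy_schwarz hL (test_fun_L2 vt).
Qed.

Lemma ultra_weak_deriv (F : set_system nat) b (q : nat -> R -> R) (qb : R -> R) (G : R) :
  UltraFilter F -> 0 < b -> L2 b qb -> (forall n, H1 b (q n)) ->
  (forall n, nrm b (grad b (q n)) <= G) ->
  (forall e : R, 0 < e -> \forall n \near F, {ae mu, forall x, Ioo b x -> `|q n x - qb x| <= e}) ->
  H1 b qb /\
  forall e : R, 0 < e -> \forall n \near F, nrm b (grad b qb) <= nrm b (grad b (q n)) + e.
Proof.
move=> UF b0 qbL qH qG qqb; have FF : ProperFilter F by exact: ultra_proper.
have [y hy] : exists y : R, nrm b (grad b (q n)) @[n --> F] --> y.
  by apply: (@ultra_bounded_cvg F _ G) => // n; rewrite ger0_norm ?nrm_ge0.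
have y0 : 0 <= y.
  have hN : - nrm b (grad b (q n)) @[n --> F] --> - y by exact: cvgN.
  rewrite -oppr_le0; apply: (cvg_le _ hN) => n.
  by rewrite oppr_le0; exact: nrm_ge0.
have near_y e : 0 < e -> F [set n | `|y - nrm b (grad b (q n))| < e].
  by move=> e0; move/cvgrPdist_lt : hy => /(_ _ e0).
have oneL : L2 b (fun=> 1 : R).
  by apply: (@L2_bounded _ _ _ 1) => //; apply: aeW => x _; rewrite normr1.
have bound v : test_fun b v -> `|\int[mu]_(x in Ioo b) (qb x * derive1 v x)| <= y * nrm b v.
  move=> vt; have v'L := test_fun_L2 (test_fun_derive1 vt).
  (* K collects the factors of the two errors, replacing qb by q n and y by the gradient norm of q
     n; it does not depend on n. *)
  set K := nrm b (fun=> 1 : R) * nrm b (derive1 v) + nrm b v.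
  have K0 : 0 <= K by rewrite addr_ge0 ?mulr_ge0 ?nrm_ge0.
  apply/ler_addgt0Pr => e e0; have eK : 0 < e / (K + 1) by rewrite divr_gt0//; lra.
  have [n [/= h1 h2]] := filter_ex (filterI (qqb _ eK) (near_y _ eK)).
  have [qL wq gL] := qH n; have gq := gradP wq.
  have dL : L2 b (fun x => q n x - qb x) by exact: L2B.
  have h3 := weak_deriv_bound gL gq vt.
  have h4 := cauchy_schwarz dL v'L; rewrite ipBl// in h4.
  have h5 : nrm b (fun x => q n x - qb x) <= e / (K + 1) * nrm b (fun=> 1 : R).
    rewrite -[X in X * _](gtr0_norm eK) -nrmZ//; apply: nrm_le => //; first exact: L2Z.
    by apply: aeS h1 => x + xb => /(_ xb); rewrite mulr1 (gtr0_norm eK).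
  have h6 : `|ip b qb (derive1 v)| <=
      nrm b (grad b (q n)) * nrm b v + e / (K + 1) * nrm b (fun=> 1 : R) * nrm b (derive1 v).
    have -> : ip b qb (derive1 v) =
      ip b (q n) (derive1 v) - (ip b (q n) (derive1 v) - ip b qb (derive1 v)) by ring.
    apply: le_trans (ler_normB _ _) (lerD h3 _).
    by apply: le_trans h4 _; apply: ler_wpM2r => //; exact: nrm_ge0.
  apply: le_trans h6 _.
  have h7 : nrm b (grad b (q n)) <= y + e / (K + 1).
    by move: h2; rewrite distrC => /(le_lt_trans (ler_norm _)) /ltW; rewrite lerBlDl.
  apply: (@le_trans _ _ ((y + e / (K + 1)) * nrm b v +
    e / (K + 1) * nrm b (fun=> 1 : R) * nrm b (derive1 v))).
    by rewrite lerD2r; apply: ler_wpM2r => //; exact: nrm_ge0.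
  have -> : (y + e / (K + 1)) * nrm b v + e / (K + 1) * nrm b (fun=> 1 : R) * nrm b (derive1 v)
     = y * nrm b v + e / (K + 1) * K by rewrite /K; ring.
  rewrite lerD2l mulrAC ler_pdivrMr; last by apply: ltr_wpDl.
  by rewrite ler_pM2l// lerDl.
have [h hL [qh hy']] := weak_deriv_of_bounded b0 (L2_locally qbL) y0 bound.
have wqb : weakly_differentiable b qb by exists h.
have gh := grad_ae qh.
have gL : L2 b (grad b qb).
  apply: (@L2_le _ _ _ h) => //; first exact: grad_meas.
  by apply: aeS gh => x + xb => /(_ xb) ->.
split => // e e0; apply: filterS (near_y _ e0) => n /= ny.
rewrite (nrm_ae gL hL gh); apply: le_trans hy' _.
by rewrite -lerBlDl; apply: le_trans (ler_norm _) _; exact: ltW.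
Qed.

Lemma normr_between (x y z : R) : x <= y <= z -> `|y| <= `|x| + `|z|.
Proof.
move=> /andP[xy yz]; have := ler_norm z; have := ler_norm (- x); rewrite normrN => hx hz.
have := normr_ge0 x; have := normr_ge0 z => z0 x0.
by rewrite ler_norml; apply/andP; split; lra.
Qed.

Lemma admissible_compact (l alpha beta G : R) (q : nat -> R -> R) : 0 < l ->
  (forall n, admissible l alpha beta (q n)) -> (forall n, nrm l (grad l (q n)) <= G) ->
  exists F : set_system nat, exists qb : R -> R,
    [/\ ProperFilter F, \oo `<=` F, admissible l alpha beta qb,
      forall e : R, 0 < e ->
        \forall n \near F, {ae mu, forall x, Ioo l x -> `|q n x - qb x| <= e} &
      forall e : R, 0 < e ->
        \forall n \near F, nrm l (grad l qb) <= nrm l (grad l (q n)) + e].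
Proof.
move=> l0 qA qG.
have G0 : 0 <= G by apply: le_trans (qG 0%N); exact: nrm_ge0.
have rep n : exists Q : R -> R, {ae mu, forall x, x \in `]0, l[ -> q n x = Q x} /\
    forall x y : R, x \in `]0, l[ -> y \in `]0, l[ -> `|Q x - Q y| <= G * Num.sqrt `|x - y|.
  have [[_ wq gL] _] := qA n.
  have [Q qQ hQ] := holder_representative l0 (gradP wq) gL.
  exists Q; split => // x y xl yl; apply: le_trans (hQ _ _ xl yl) _.
  by apply: ler_wpM2r => //; exact: sqrtr_ge0.
have {rep}[Q hQ] := choice rep.
have qb n := (qA n).2.
(* The bounds alpha and beta hold only almost everywhere for q n; one point s where they hold and Q
   n agrees with q n gives a bound on all of (0, l) through the Hoelder estimate. *)
have QB n (x : R) : x \in `]0, l[ -> `|Q n x| <= `|alpha| + `|beta| + G * Num.sqrt l.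
  move=> xl; have [qQ QG] := hQ n.
  have qQb := aeS2 (fun x p1 p2 => conj p1 p2) qQ (qb n).
  have [s sl [/(_ sl) qs /(_ sl) qab]] :=
    ae_exists l0 (aeS (fun x p (_ : x \in `]0, l[) => p) qQb).
  have -> : Q n x = (Q n x - Q n s) + q n s by rewrite qs; ring.
  apply: le_trans (ler_normD _ _) _; rewrite addrC; apply: lerD.
    exact: normr_between.
  apply: le_trans (QG _ _ xl sl) _; apply: ler_wpM2l => //.
  rewrite ler_sqrt; last exact: ltW.
  by move: xl sl; rewrite !in_itv/= ler_norml => /andP[? ?] /andP[? ?]; lra.
(* F refines the filter at infinity, so whatever holds for all large n holds along F. *)
have [F [UF ooF]] := ultraFilterLemma (_ : ProperFilter \oo).
have FF : ProperFilter F by exact: ultra_proper.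
have [Qb [Ql QbG Qu]] := ultra_arzela_ascoli UF l0 QB (fun n => (hQ n).2).
have qQ := ae_foralln (fun n => (hQ n).1).
have {}qb := ae_foralln qb.
have Qbab : {ae mu, forall x, x \in `]0, l[ -> alpha <= Qb x <= beta}.
  apply: aeS2 qQ qb => x h1 h2 xl.
  have Qab n : alpha <= Q n x <= beta by rewrite -h1// h2.
  apply/andP; split.
    have c : - Q n x @[n --> F] --> - Qb x by apply: cvgN; exact: Ql.
    rewrite -lerN2; apply: (cvg_le _ c) => n.
    by rewrite lerN2; have /andP[] := Qab n.
  by apply: (cvg_le _ (Ql _ xl)) => n; have /andP[] := Qab n.
have QbL : L2 l Qb.
  apply: (@L2_bounded _ _ _ (`|alpha| + `|beta|)); first exact: holder_measurable QbG.
  by apply: aeS Qbab => x + xl => /(_ xl); exact: normr_between.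
have qu (e : R) : 0 < e ->
    \forall n \near F, {ae mu, forall x, Ioo l x -> `|q n x - Qb x| <= e}.
  move=> /Qu; apply: filterS => n hn.
  apply: aeS (hQ n).1 => x + xl => /(_ xl) ->.
  exact: hn.
have [QH Qg] := ultra_weak_deriv UF l0 QbL (fun n => (qA n).1) qG qu.
by exists F, Qb; split.
Qed.

End compactness.

(** * Cost functional and existence of a minimizer *)

Section existence.
Context {R : realType}.
Notation mu := (@lebesgue_measure R).

Lemma Linfty_L2 (b : R) (g : R -> R) : Linfty b g -> L2 b g.
Proof.
move=> gL; have : g \_ (Ioo b) \in Lfun mu +oo%E := gL.
move=> /andP[]; rewrite !inE/= => mg fin.
have {}mg : measurable_fun (Ioo b) g by apply/(measurable_restrictT _ _).2.
(* The norm at exponent +oo is defined by cases on whether the whole space has positive measure. *)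
have mu0 : (0 < mu [set: R])%E.
  apply: (@lt_le_trans _ _ (mu (Ioo (1 : R)))).
    by rewrite lebesgue_measure_itv/= lte_fin ltr01 -EFinB subr0 lte_fin.
  by apply: le_measure; rewrite ?inE.
move: fin; rewrite /finite_norm unlock mu0.
set f := abse \o _ => fin.
have [C hC] : exists C : R, (ess_sup mu f <= C%:E)%E.
  by case: (ess_sup mu f) fin => [r _|//|_]; [exists r|exists 0; rewrite leNye].
apply: (@L2_bounded _ _ _ C) => //.
move/ess_supP : hC; apply: aeS => x + xb.
by rewrite /f/= patchE mem_set// lee_fin.
Qed.

Lemma weak_deriv_cst (b c : R) : 0 < b -> weak_deriv b (cst c) (cst 0).
Proof.
move=> b0; have cL d : L2 b (cst d : R -> R).
  by apply: (@L2_bounded _ _ _ `|d|) => //; apply: aeW.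
split; [exact: L2_locally|exact: L2_locally|move=> v vt].
rewrite (RintegralZl _ _ (L2_rint (test_fun_L2 (test_fun_derive1 vt))))//.
rewrite (integral_derive1_test b0 vt) mulr0.
under eq_Rintegral do rewrite mul0r.
by rewrite Rintegral_cst// mul0r oppr0.
Qed.

(** Makes the set of costs nonempty, so that its infimum can be approached. *)
Lemma admissible_cst (l alpha beta : R) : 0 < l -> alpha <= beta ->
  admissible l alpha beta (cst alpha).
Proof.
move=> l0 ab; have wd := weak_deriv_cst alpha l0.
have wq : weakly_differentiable l (cst alpha) by exists (cst 0).
split; last by apply: aeW => x _; rewrite /= lexx.
split => //.
  by apply: (@L2_bounded _ _ _ `|alpha|) => //; apply: aeW.
apply: (@L2_bounded _ _ _ 0); first exact: grad_meas.
by apply: aeS (grad_ae wd) => x + xl => /(_ xl) ->; rewrite normr0.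
Qed.

Lemma J_nrm (l T N : R) (g : R -> R) (u : (R -> R) -> R -> R -> R) (q : R -> R) :
  L2 l (fun x => u q T x - g x) -> L2 l (grad l q) ->
  J l T N g u q =
  (2^-1 * nrm l (fun x => u q T x - g x) ^+ 2 + N / 2 * nrm l (grad l q) ^+ 2)%:E.
Proof.
move=> uL gL; rewrite /J !sq_nrm EFinD !EFinM -!rint_ereal//; try exact: L2_sq.
by congr (_ * _ + _ * _)%E; apply: eq_integral => x _; rewrite real_normK ?num_real.
Qed.

Lemma weak_solution_L2 (l T : R) (a phi q : R -> R) (v : R -> R -> R) : 0 <= T ->
  weak_solution l T a phi q v -> L2 l (v T).
Proof. by move=> T0 [vc _]; have [] := vc T; rewrite // in_itv/= lexx T0. Qed.

(** Here dq and gq stand for the misfit and the gradient norm of the limit, dn and gn for those of a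
    term of the sequence. After squaring, e <= 1 gives e^2 <= e, and D and G bound the cross terms,
    so the error is linear in e. *)
Lemma cost_estimate (N dq dn gq gn K D G e : R) : 0 < N -> 0 < e -> e <= 1 -> 0 <= K ->
  0 <= dq <= dn + K * e -> 0 <= dn <= D -> 0 <= gq <= gn + e -> 0 <= gn <= G ->
  2^-1 * dq ^+ 2 + N / 2 * gq ^+ 2 <=
  2^-1 * dn ^+ 2 + N / 2 * gn ^+ 2 + e * (D * K + K ^+ 2 / 2 + N * G + N / 2).
Proof.
move=> N0 e0 e1 K0 /andP[dq0 dqn] /andP[dn0 dnD] /andP[gq0 gqn] /andP[gn0 gnG].
have Ke : 0 <= K * e by rewrite mulr_ge0// ltW.
have h1 : dq ^+ 2 <= (dn + K * e) ^+ 2 by rewrite lerXn2r// nnegrE// addr_ge0.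
have h2 : gq ^+ 2 <= (gn + e) ^+ 2 by rewrite lerXn2r// nnegrE// addr_ge0// ltW.
have h3 : N / 2 * gq ^+ 2 <= N / 2 * (gn + e) ^+ 2 by apply: ler_wpM2l => //; rewrite divr_ge0// ltW.
have h4 : e ^+ 2 <= e by rewrite expr2 ler_piMr// ltW.
have h5 : K ^+ 2 * e ^+ 2 <= K ^+ 2 * e by apply: ler_wpM2l => //; exact: sqr_ge0.
have h6 : dn * (K * e) <= D * (K * e) by exact: ler_wpM2r.
have h7 : N * (gn * e) <= N * (G * e) by rewrite ler_pM2l// ler_pM2r.
have h8 : N * e ^+ 2 <= N * e by rewrite ler_pM2l.
have -> : 2^-1 * dn ^+ 2 + N / 2 * gn ^+ 2 + e * (D * K + K ^+ 2 / 2 + N * G + N / 2) =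
  2^-1 * (dn ^+ 2 + 2 * (D * (K * e)) + K ^+ 2 * e) + (N / 2 * gn ^+ 2 + N * (G * e) + N * e / 2) by field.
apply: lerD.
  rewrite ler_pM2l ?invr_gt0//; apply: (le_trans h1).
  have -> : (dn + K * e) ^+ 2 = dn ^+ 2 + 2 * (dn * (K * e)) + K ^+ 2 * e ^+ 2 by ring.
  by move: h5 h6; lra.
apply: (le_trans h3).
have -> : N / 2 * (gn + e) ^+ 2 = N / 2 * gn ^+ 2 + N * (gn * e) + N * e ^+ 2 / 2 by field.
by move: h7 h8; lra.
Qed.

End existence.

Theorem theorem3p3 (R : realType) (l T N alpha beta : R) (a phi g : R -> R)
    (u : (R -> R) -> R -> R -> R)
    (hl : 0 < l) (hT : 0 < T) (hN : 0 < N)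
    (halpha : 0 < alpha) (halphabeta : alpha <= beta)
    (haC1 : C_cc l 1 a) (ha0 : a 0 = 0) (hal : a l = 0)
    (hapos : forall x, x \in `]0, l[ -> 0 < a x)
    (hphi : smooth_cc l phi) (hphi0 : forall x, x \in `[0, l] -> 0 <= phi x)
    (hphin0 : exists2 x, x \in `[0, l] & phi x != 0)
    (hg : Linfty l g)
    (hu : forall q, admissible l alpha beta q -> weak_solution l T a phi q (u q)) :
  exists2 qbar : R -> R, admissible l alpha beta qbar &
    forall q, admissible l alpha beta q -> (J l T N g u qbar <= J l T N g u q)%E.
Proof.
have gL := Linfty_L2 hg.
have uL q : admissible l alpha beta q -> L2 l (fun x => u q T x - g x).
  by move=> /hu/(weak_solution_L2 (ltW hT)) uqL; exact: L2B.
have ac : {within `[0, l], continuous a}.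
  have [d [da dc _]] := haC1.
  have dA : {in [set` `[0, l]], d 0%N =1 a} by move=> x; rewrite inE => xl; exact: da.
  exact: subspace_eq_continuous dA (dc 0%N isT).
pose d q := nrm l (fun x => u q T x - g x).
pose j q := 2^-1 * d q ^+ 2 + N / 2 * nrm l (grad l q) ^+ 2.
have Jj q : admissible l alpha beta q -> J l T N g u q = (j q)%:E.
  by move=> qA; apply: J_nrm; [exact: uL|case: qA => -[]].
pose S := [set j q | q in admissible l alpha beta].
have N2 : 0 < N / 2 by rewrite divr_gt0.
have j1 q : 2^-1 * d q ^+ 2 <= j q by rewrite lerDl mulr_ge0 ?sqr_ge0 ?(ltW N2).
have j2 q : N / 2 * nrm l (grad l q) ^+ 2 <= j q.
  by rewrite lerDr mulr_ge0 ?sqr_ge0 ?invr_ge0.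
have Sinf : has_inf S.
  split; first by exists (j (cst alpha)), (cst alpha) => //; exact: admissible_cst.
  by exists 0 => _ [q _ <-]; apply: le_trans (j1 q); rewrite mulr_ge0 ?sqr_ge0 ?invr_ge0.
set m := inf S.
have mS q : admissible l alpha beta q -> m <= j q.
  by move=> qA; apply: ge_inf; [exact: Sinf.2|exists q].
have hq n : exists q, admissible l alpha beta q /\ j q < m + harmonic n.
  have n0 : 0 < harmonic n :> R by rewrite invr_gt0 ltr0n.
  by have [_ [q qA <-] qm] := inf_adherent n0 Sinf; exists q.
have {hq}[q hq] := choice hq.
have qA n := (hq n).1.
have jm n : j (q n) <= m + 1.
  apply: (le_trans (ltW (hq n).2)); rewrite lerD2l.
  by rewrite invf_le1 ?ltr0n// ler1n.
(* Both come from j <= m + 1 along the sequence, each summand of [j] being nonnegative. *)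
pose G := Num.sqrt (2 * (m + 1) / N); pose D := Num.sqrt (2 * (m + 1)).
have qG n : nrm l (grad l (q n)) <= G.
  rewrite -[leLHS]ger0_norm ?nrm_ge0// -sqrtr_sqr; apply: ler_wsqrtr.
  have := le_trans (j2 (q n)) (jm n); rewrite ler_pdivlMr//.
  by move: (nrm l _) => p H; move: H hN; lra.
have dD n : d (q n) <= D.
  rewrite -[leLHS]ger0_norm ?nrm_ge0// -sqrtr_sqr; apply: ler_wsqrtr.
  by have := le_trans (j1 (q n)) (jm n); move: (d (q n)) => p; lra.
have [F [qb [FF ooF qbA qqb gqb]]] := admissible_compact hl qA qG.
exists qb; first exact: qbA.
move=> p pA; rewrite (Jj _ qbA) (Jj _ pA) lee_fin; apply: le_trans (mS _ pA).
(* The solution for the limit coefficient is the one whose norm enters [solution_dist], so U and K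
   are independent of n. *)
have hqb := hu _ qbA; have [uc _] := hqb.
have [U hU] := L2_continuous_bounded (ltW hT) uc.
pose K := Num.sqrt (T * U ^+ 2 / (2 * alpha)).
have C0 : 0 <= T * U ^+ 2 / (2 * alpha).
  apply: divr_ge0; apply: mulr_ge0; [exact: ltW|exact: sqr_ge0|exact: ler0n|exact: ltW].
have dist n e : 0 < e -> {ae leb R, forall x, Ioo l x -> `|q n x - qb x| <= e} ->
    d qb <= d (q n) + K * e.
  move=> e0 qn; have H := solution_dist hl hT halpha ac hapos (qA n) qbA (hu _ (qA n)) hqb qn hU.
  have L1 := weak_solution_L2 (ltW hT) (hu _ (qA n)); have L2' := weak_solution_L2 (ltW hT) hqb.
  have {}H : nrm l (fun x => u (q n) T x - u qb T x) <= K * e.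
    rewrite -[leLHS]ger0_norm ?nrm_ge0// -sqrtr_sqr -[X in K * X](gtr0_norm e0).
    by rewrite -(sqrtr_sqr e) -sqrtrM//; exact: ler_wsqrtr.
  rewrite /d (_ : (fun x => u qb T x - g x) =
    (fun x => (u (q n) T x - g x) - (u (q n) T x - u qb T x))); last by apply/funext => x; ring.
  apply: le_trans (nrmB _ _) _; [exact: uL|exact: L2B|].
  by rewrite lerD2l.
set B := D * K + K ^+ 2 / 2 + N * G + N / 2.
have B0 : 0 <= B.
  by rewrite /B !addr_ge0// ?mulr_ge0 ?sqrtr_ge0 ?sqr_ge0 ?invr_ge0// ltW.
apply/ler_addgt0Pr => e e0.
(* The bound 1 is required by [cost_estimate]; in e' (B + 1) <= e the extra 1 pays for [harmonic n],
   below e', by which j (q n) may exceed m. *)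
pose e' := Num.min 1 (e / (B + 1)).
have B1 : 0 < B + 1 by rewrite ltr_wpDl.
have e'0 : 0 < e' by rewrite lt_min ltr01 divr_gt0.
have e'1 : e' <= 1 by rewrite ge_min lexx.
have e'B : e' * (B + 1) <= e by rewrite -ler_pdivlMr// ge_min lexx orbT.
have hn : F [set n | harmonic n < e'].
  apply: ooF; have := @cvg_harmonic R; move/cvgrPdist_lt => /(_ _ e'0).
  by apply: filterS => n /=; rewrite sub0r normrN ger0_norm// invr_ge0.
have [n [n1 [n2 n3]]] := filter_ex (filterI (qqb _ e'0) (filterI (gqb _ e'0) hn)).
apply: (@le_trans _ _ (j (q n) + e' * B)).
  apply: cost_estimate => //; first exact: sqrtr_ge0.
  - by rewrite nrm_ge0 dist.
  - by rewrite nrm_ge0 dD.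
  - by rewrite nrm_ge0.
  - by rewrite nrm_ge0 qG.
have := (hq n).2; move: n3 e'B; move: (j (q n)) => x.
rewrite /= mulrDr mulr1; move: (harmonic n : R) => y h1 h2 h3.
apply: (@le_trans _ _ (m + e' + e' * B)).
  by rewrite lerD2r ltW// (lt_trans h3)// ltrD2l.
by rewrite -addrA lerD2l addrC.
Qed.
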